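(* Consider the linear error system, with state $\tilde z=(\tilde h,\tilde q)^T$ and $(t,x)\in[0,+\infty)\times[0,L]$, $$\tilde h_t+\tilde q_x=0,\qquad \tilde q_t+a(x)\tilde h_x+b(x)\tilde q_x+\big(a_x(x)+\tilde a(x)\big)\tilde h+\big(b_x(x)+\tilde b(x)\big)\tilde q=0,$$ with the boundary conditions $$\alpha_h\tilde h(t,0)+\alpha_q\tilde q(t,0)=0,\qquad \beta_h\tilde h(t,L)+\beta_q\tilde q(t,L)=0.$$ If there exist two functions $p_i\in C^1([0,L],(0,+\infty))$ $(i=1,2)$ such that $$\left(\frac{\alpha_h-\alpha_q\lambda_2(0)}{\alpha_h+\alpha_q\lambda_1(0)}\right)^{2}<\frac{p_2(0)}{p_1(0)}\frac{\lambda_2(0)}{\lambda_1(0)},\qquad \left(\frac{\beta_h+\beta_q\lambda_1(L)}{\beta_h-\beta_q\lambda_2(L)}\right)^{2}<\frac{p_1(L)}{p_2(L)}\frac{\lambda_1(L)}{\lambda_2(L)},$$ and such that the matrix $-M_x(x)+B^T(x)P(x)+P(x)B(x)$ is positive definite for all $x\in[0,L]$, then this system is $L^2$-exponentially stable, that is, there exist two positive constants $C$ and $\nu$ such that, from any initial condition $\tilde z(0,\cdot)\in L^2([0,L],\mathbb{R}^2)$, the system solution satisfies $$\|\tilde z(t,\cdot)\|_{L^2}\leqslant Ce^{-\nu t}\|\tilde z(0,\cdot)\|_{L^2},\qquad t\in[0,+\infty).$$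
   Context: Let $L>0$ and let $f,g,\alpha,\beta:\mathbb{R}^2\to\mathbb{R}$ be sufficiently smooth functions of $(H,Q)$. Fix a set point $H^*_L$ and a steady state $(H^*(x),Q^* )$, where $Q^*$ is a constant and $H^*:[0,L]\to\mathbb{R}$ solves $$\big(f(H^*,Q^* )\big)_x+g(H^*,Q^* )=0,\qquad H^*(L)=H^*_L,\qquad x\in[0,L].$$ The coefficients are $$a(x)=\frac{\partial f}{\partial H}(H^*(x),Q^* ),\quad b(x)=\frac{\partial f}{\partial Q}(H^*(x),Q^* ),\quad \tilde a(x)=\frac{\partial g}{\partial H}(H^*(x),Q^* ),\quad \tilde b(x)=\frac{\partial g}{\partial Q}(H^*(x),Q^* ),$$ $$\alpha_h=\frac{\partial\alpha}{\partial H}(H^*(0),Q^* ),\quad \alpha_q=\frac{\partial\alpha}{\partial Q}(H^*(0),Q^* ),\quad \beta_h=\frac{\partial\beta}{\partial H}(H^*_L,Q^* ),\quad \beta_q=\frac{\partial\beta}{\partial Q}(H^*_L,Q^* ).$$ Subscripts $t,x$ denote derivatives. Standing hyperbolicity assumption: $b^2(x)+4a(x)>0$ for all $x\in[0,L]$, and the functions $$\lambda_1(x)=\frac{b(x)+\sqrt{b^2(x)+4a(x)}}{2},\qquad -\lambda_2(x)=\frac{b(x)-\sqrt{b^2(x)+4a(x)}}{2}$$ satisfy $\lambda_1(x)>0$ and $\lambda_2(x)>0$ for all $x\in[0,L]$. Define the matrices $$A(x)=\begin{pmatrix} 0 & 1 \\ a(x) & b(x) \end{pmatrix},\quad B(x)=\begin{pmatrix}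 0 & 0 \\ {a_x(x)+\tilde a(x)} & {b_x(x)+\tilde b(x)} \end{pmatrix},\quad N(x)=\begin{pmatrix} \lambda_2(x) & 1 \\ -\lambda_1(x) & 1 \end{pmatrix},$$ $$P(x)=N^T(x)\begin{pmatrix} p_1(x) & 0 \\ 0 & p_2(x) \end{pmatrix}N(x),\qquad M(x)=P(x)A(x)$$ (the matrix $M(x)$ is symmetric), and let $M_x$ be the derivative of $M$ with respect to $x$. The system can be written $\tilde z_t+A(x)\tilde z_x+B(x)\tilde z=0$. For initial data in $L^2$, solutions are understood in the standard (weak) $L^2$ sense for linear hyperbolic systems. *)

(* Defs.v *)
From HB Require Import structures.
From mathcomp Require Import all_boot all_order all_algebra.
From mathcomp Require Import all_classical all_reals all_analysis.

Set Implicit Arguments.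
Unset Strict Implicit.
Unset Printing Implicit Defensive.

Import Order.TTheory GRing.Theory Num.Theory.
Import numFieldNormedType.Exports.

Local Open Scope classical_set_scope.
Local Open Scope ring_scope.

(* The limit is taken inside [D]: at an endpoint of a compact interval this is
   the one-sided derivative, and the values of [F] outside [D] are irrelevant. *)
Definition difference_quotient (R : realType) (V : normedModType R)
    (F : R -> V) (x y : R) : V :=
  (y - x)^-1 *: (F y - F x).

Definition derivable_within (R : realType) (V : normedModType R)
    (D : set R) (F : R -> V) (x : R) : Prop :=
  cvg (difference_quotient F x y @[y --> within D x^']).

Definition derive_within (R : realType) (V : normedModType R)
    (D : set R) (F : R -> V) (x : R) : V :=
  lim (difference_quotient F x y @[y --> within D x^']).

Definition C1_within (R : realType) (V : normedModType R)
    (D : set R) (F : R -> V) : Prop :=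
  (forall x, D x -> derivable_within D F x) /\
  {within D, continuous (derive_within D F)}.

Definition C1_rectangle (R : realType) (V : normedModType R)
    (D E : set R) (F : R -> R -> V) : Prop :=
  [/\ forall t x, D t -> E x -> derivable_within D (F^~ x) t,
      forall t x, D t -> E x -> derivable_within E (F t) x,
      {within D `*` E, continuous (fun tx : R * R => F tx.1 tx.2)},
      {within D `*` E,
        continuous (fun tx : R * R => derive_within D (F^~ tx.2) tx.1)} &
      {within D `*` E,
        continuous (fun tx : R * R => derive_within E (F tx.1) tx.2)}].

Definition partialH (R : realType) (F : R -> R -> R) (H Q : R) : R :=
  derive1 (F^~ Q) H.

Definition partialQ (R : realType) (F : R -> R -> R) (H Q : R) : R :=
  derive1 (F H) Q.

Definition C1_plane (R : realType) (F : R -> R -> R) : Prop :=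
  [/\ forall H Q, derivable (F^~ Q) H 1,
      forall H Q, derivable (F H) Q 1,
      continuous (fun HQ : R * R => F HQ.1 HQ.2),
      continuous (fun HQ : R * R => partialH F HQ.1 HQ.2) &
      continuous (fun HQ : R * R => partialQ F HQ.1 HQ.2)].

Definition C2_plane (R : realType) (F : R -> R -> R) : Prop :=
  [/\ C1_plane F, C1_plane (partialH F) & C1_plane (partialQ F)].

Definition mx22 (R : realType) (m00 m01 m10 m11 : R) : 'M[R]_2 :=
  \matrix_(i < 2, j < 2)
    if i == 0 then (if j == 0 then m00 else m01)
    else (if j == 0 then m10 else m11).

Definition row2 (R : realType) (u v : R) : 'rV[R]_2 :=
  \row_(j < 2) if j == 0 then u else v.

Definition dotcv (R : realType) (u v : 'cV[R]_2) : R := (u^T *m v) 0 0.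

Definition positive_definite (R : realType) (S : 'M[R]_2) : Prop :=
  forall v : 'cV[R]_2, v != 0 -> 0 < dotcv v (S *m v).

Definition lambda1 (R : realType) (a b : R -> R) (x : R) : R :=
  (b x + Num.sqrt (b x ^+ 2 + 4 * a x)) / 2.

(* [- lambda2] is the negative characteristic velocity. *)
Definition lambda2 (R : realType) (a b : R -> R) (x : R) : R :=
  - ((b x - Num.sqrt (b x ^+ 2 + 4 * a x)) / 2).

Definition in_L2 (R : realType) (L : R) (w : R -> 'cV[R]_2) : Prop :=
  (forall i, measurable_fun `[0, L] (fun x => w x i 0)) /\
  (\int[lebesgue_measure]_(x in `[0%R, L]) (dotcv (w x) (w x))%:E < +oo)%E.

Definition norm_L2 (R : realType) (L : R) (w : R -> 'cV[R]_2) : R :=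
  Num.sqrt (\int[lebesgue_measure]_(x in `[0, L]) dotcv (w x) (w x)).

(* The boundary conditions of the system are [c0 *m z(t, 0) = 0] and [cL *m z(t, L) = 0].
   The test functions satisfy the adjoint boundary conditions: the boundary
   terms [phi^T A z] left by the integration by parts vanish for every value of
   [z] allowed by the boundary conditions. *)
Definition test_function (R : realType) (L T : R) (A : R -> 'M[R]_2)
    (c0 cL : 'rV[R]_2) (phi : R -> R -> 'cV[R]_2) : Prop :=
  [/\ C1_rectangle `[0, T] `[0, L] phi,
      forall (t : R) (v : 'cV[R]_2), t \in `[0, T] ->
        c0 *m v = 0 -> dotcv (phi t 0) (A 0 *m v) = 0 &
      forall (t : R) (v : 'cV[R]_2), t \in `[0, T] ->
        cL *m v = 0 -> dotcv (phi t L) (A L *m v) = 0].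

(* phi_t + (A^T phi)_x - B^T phi, from moving the derivatives of
   z_t + A z_x + B z to the test function. *)
Definition adjoint_operator (R : realType) (L T : R) (A B : R -> 'M[R]_2)
    (phi : R -> R -> 'cV[R]_2) (t x : R) : 'cV[R]_2 :=
  derive_within `[0, T] (phi^~ x) t
  + derive_within `[0, L] (fun y => (A y)^T *m phi t y) x
  - (B x)^T *m phi t x.

(* [z] is an element of C^0([0, +oo); L^2([0, L], R^2)) starting from [z0] that
   satisfies z_t + A z_x + B z = 0 and the boundary conditions weakly. Joint
   measurability is no restriction: every such curve of L^2 classes has a jointly
   measurable representative, which agrees with it at every time. *)
Definition L2_solution (R : realType) (L : R) (A B : R -> 'M[R]_2)
    (c0 cL : 'rV[R]_2) (z0 : R -> 'cV[R]_2) (z : R -> R -> 'cV[R]_2) : Prop :=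
  [/\ forall i, measurable_fun ((`[0, +oo[ : set R) `*` (`[0, L] : set R))
        (fun tx : R * R => z tx.1 tx.2 i 0),
      forall t, 0 <= t -> in_L2 L (z t) /\
        norm_L2 L (fun x => z s x - z t x)
          @[s --> within `[0, +oo[ (nbhs t)] --> (0 : R),
      {ae lebesgue_measure, forall x, x \in `[0, L] -> z 0 x = z0 x} &
      forall (T : R) (phi : R -> R -> 'cV[R]_2), 0 < T ->
        test_function L T A c0 cL phi ->
        \int[lebesgue_measure]_(x in `[0, L]) dotcv (phi T x) (z T x)
        - \int[lebesgue_measure]_(x in `[0, L]) dotcv (phi 0 x) (z0 x)
        = \int[lebesgue_measure]_(t in `[0, T])
            \int[lebesgue_measure]_(x in `[0, L])
              dotcv (adjoint_operator L T A B phi t x) (z t x)].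

Definition L2_exponentially_stable (R : realType) (L : R) (A B : R -> 'M[R]_2)
    (c0 cL : 'rV[R]_2) : Prop :=
  exists C nu : R, [/\ 0 < C, 0 < nu &
    forall (z0 : R -> 'cV[R]_2) (z : R -> R -> 'cV[R]_2),
      in_L2 L z0 -> L2_solution L A B c0 cL z0 z ->
      forall t : R, 0 <= t ->
        norm_L2 L (z t) <= C * expR (- nu * t) * norm_L2 L z0].

(* Main.v *)
Require Import Defs.
From HB Require Import structures.
From mathcomp Require Import all_boot all_order all_algebra.
From mathcomp Require Import all_classical all_reals all_analysis.
From mathcomp Require Import measurable_realfun.
From mathcomp Require Import ring lra.

(** The energy [int z^T P z] cannot be differentiated along a weak solution, so
    it is differentiated along a time average. The system is autonomous, hence
    the average [w(t) = int_t^(t+h) z(s) ds] satisfies, weakly in [x] only,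
    [A w_x + B w = - d] with [d = z(t+h) - z(t)], together with the boundary
    conditions. By the du Bois-Reymond lemma [w(t)] is absolutely continuous in
    [x], so that integrating by parts, with [M = P A] and the boundary
    inequalities, gives [2 <w, d>_P <= - nu <w, w>_P]. The left-hand side is the
    time derivative of [<w, w>_P], which therefore decays exponentially;
    dividing by [h^2] and letting [h] tend to [0] transfers the decay to [z]. *)

Set Implicit Arguments.
Unset Strict Implicit.
Unset Printing Implicit Defensive.

Import Order.TTheory GRing.Theory Num.Theory.
Import numFieldNormedType.Exports.

Local Open Scope classical_set_scope.
Local Open Scope ring_scope.

(** * Square-integrable functions and averages *)

(** Three facts carry the argument. First, [a = lambda1 * lambda2] is positive, so [A] is invertible
    and the averaged equation can be solved for [w_x]: it reads [- w_x = k] with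
    [k = A^-1 (d + B w)]. Time-independent test functions then suffice, since with [A^T psi = th]
    the adjoint boundary conditions on [psi] become conditions on the boundary values of [th].
    Secondly, [w^T M k = w^T P A k = w^T P (d + B w)], so the cross term left by the integration by
    parts is the pairing with [d] plus the zeroth-order part of [- M_x + B^T P + P B]. Thirdly, the
    rows of [N] are left eigenvectors of [A], hence [M = N^T diag(p1 lambda1, - p2 lambda2) N], and
    the two boundary inequalities become sign conditions on this form at [0] and at [L]. The average
    is needed because [<z(t), z(t)>_P] is only known to be continuous in [t]; [<w(t), w(t)>_P] is
    differentiable, being the integral of the continuous kernel [<z(s), z(r)>_P] over the square
    [[t, t + h]^2]. *)

Section square_integrable.
Context d (T : measurableType d) (R : realType).
Variables (mu : {measure set T -> \bar R}) (D : set T).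
Hypothesis mD : measurable D.
Implicit Types (u v w : T -> R) (c : R).

Definition square_integrable u :=
  measurable_fun D u /\ mu.-integrable D (EFin \o (fun x => u x ^+ 2)).

Definition pairing u v := \int[mu]_(x in D) (u x * v x).

Lemma square_integrableM u v : square_integrable u -> square_integrable v ->
  mu.-integrable D (EFin \o (fun x => u x * v x)).
Proof.
move=> [mu1 iu] [mv iv].
apply: (le_integrable mD _ _ (integrableD mD iu iv)) => [|x Dx].
  by apply/measurable_EFinP; exact: measurable_funM.
rewrite /= lee_fin (@ger0_norm _ (_ + _)) ?addr_ge0 ?sqr_ge0//.
by rewrite ler_norml; apply/andP; split; nra.
Qed.

Lemma square_integrableD u v : square_integrable u -> square_integrable v ->
  square_integrable (fun x => u x + v x).
Proof.
move=> [mu1 iu] [mv iv]; split; first exact: measurable_funD.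
apply: (le_integrable mD _ _
  (integrableD mD (integrableD mD iu iu) (integrableD mD iv iv))) => [|x Dx].
  apply/measurable_EFinP; apply: measurable_funX.
  exact: measurable_funD.
rewrite /= lee_fin (@ger0_norm _ (_ + _)) ?addr_ge0 ?sqr_ge0//.
by rewrite ger0_norm ?sqr_ge0//; have := sqr_ge0 (u x - v x); nra.
Qed.

Lemma square_integrable_bounded_mul (m : T -> R) c u :
  measurable_fun D m -> (forall x, D x -> `|m x| <= c) ->
  square_integrable u -> square_integrable (fun x => m x * u x).
Proof.
move=> mm mc [mu1 iu]; split; first exact: measurable_funM.
apply: (le_integrable mD _ _ (integrableZl mD (c ^+ 2) iu)) => [|x Dx].
  apply/measurable_EFinP; apply: measurable_funX.
  exact: measurable_funM.
rewrite /= lee_fin ger0_norm ?sqr_ge0// ger0_norm ?(mulr_ge0 (sqr_ge0 _) (sqr_ge0 _))//.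
rewrite exprMn ler_wpM2r ?sqr_ge0// -(real_normK (num_real (m x))).
by rewrite lerXn2r ?nnegrE ?mc// (le_trans _ (mc _ Dx)).
Qed.

Lemma square_integrableZ c u : square_integrable u ->
  square_integrable (fun x => c * u x).
Proof.
by apply: (@square_integrable_bounded_mul (cst c) `|c|) => //; exact: measurable_cst.
Qed.

Lemma square_integrableB u v : square_integrable u -> square_integrable v ->
  square_integrable (fun x => u x - v x).
Proof.
move=> su sv.
have := square_integrableD su (square_integrableZ (-1) sv).
by congr square_integrable; apply/funext => x; rewrite mulN1r.
Qed.

Lemma pairingC u v : pairing u v = pairing v u.
Proof. by apply: eq_Rintegral => x _; rewrite mulrC. Qed.

Lemma pairingDr u v w : square_integrable u -> square_integrable v ->
  square_integrable w ->
  pairing u (fun x => v x + w x) = pairing u v + pairing u w.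
Proof.
move=> su sv sw; rewrite -RintegralD//; [|exact: square_integrableM..].
by apply: eq_Rintegral => x _; rewrite mulrDr.
Qed.

Lemma pairingZr u v c : square_integrable u -> square_integrable v ->
  pairing u (fun x => c * v x) = c * pairing u v.
Proof.
move=> su sv; rewrite -RintegralZl//; last exact: square_integrableM.
by apply: eq_Rintegral => x _; rewrite mulrCA.
Qed.

Lemma pairingDl u v w : square_integrable u -> square_integrable v ->
  square_integrable w ->
  pairing (fun x => v x + w x) u = pairing v u + pairing w u.
Proof. by move=> su sv sw; rewrite 3!(pairingC _ u) pairingDr. Qed.

Lemma pairingZl u v c : square_integrable u -> square_integrable v ->
  pairing (fun x => c * v x) u = c * pairing v u.
Proof. by move=> su sv; rewrite 2!(pairingC _ u) pairingZr. Qed.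

Lemma pairingBl u v w : square_integrable u -> square_integrable v ->
  square_integrable w ->
  pairing (fun x => v x - w x) u = pairing v u - pairing w u.
Proof.
move=> su sv sw; rewrite -RintegralB//; [|exact: square_integrableM..].
by apply: eq_Rintegral => x _; rewrite mulrBl.
Qed.

Lemma pairingBr u v w : square_integrable u -> square_integrable v ->
  square_integrable w ->
  pairing u (fun x => v x - w x) = pairing u v - pairing u w.
Proof. by move=> su sv sw; rewrite 3!(pairingC u) pairingBl. Qed.

Lemma pairing_ge0 u : 0 <= pairing u u.
Proof. by apply: Rintegral_ge0 => x _; rewrite -expr2 sqr_ge0. Qed.

Lemma pairing_cauchy_schwarz u v :
  square_integrable u -> square_integrable v ->
  pairing u v ^+ 2 <= pairing u u * pairing v v.
Proof.
move=> su sv.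
(* The polynomial [<u + c v, u + c v>] in [c] is nonnegative; the rest evaluates it at well-chosen
   points. *)
have quad c : 0 <= pairing u u + 2 * c * pairing u v + c ^+ 2 * pairing v v.
  have := pairing_ge0 (fun x => u x + c * v x).
  have scv := square_integrableZ c sv.
  rewrite pairingDr ?pairingDl//; last exact: square_integrableD.
  by rewrite !pairingZr ?pairingZl// (pairingC v u); nra.
have u0 := pairing_ge0 u; have := pairing_ge0 v.
rewrite le_eqVlt => /predU1P[v0|v0]; last first.
  (* The minimizer of the polynomial. *)
  have := quad (- (pairing u v / pairing v v)).
  have -> : pairing u u + 2 * - (pairing u v / pairing v v) * pairing u v +
      (- (pairing u v / pairing v v)) ^+ 2 * pairing v v =
      (pairing u u * pairing v v - pairing u v ^+ 2) / pairing v v.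
    by field; rewrite gt_eqF.
  by rewrite pmulr_lge0 ?invr_gt0// subr_ge0.
have [->|uv0] := eqVneq (pairing u v) 0.
  by rewrite expr0n mulr_ge0// pairing_ge0.
(* When [<v, v> = 0] the polynomial is affine in [c], and this [c] would give it the value [-1]. *)
have := quad (- ((pairing u u + 1) / (2 * pairing u v))).
rewrite -v0 mulr0 addr0.
have -> : pairing u u + 2 * - ((pairing u u + 1) / (2 * pairing u v)) * pairing u v
    = -1 by field.
by rewrite oppr_ge0 ler10.
Qed.

End square_integrable.

Lemma integrable_cst_lty d (T : measurableType d) (R : realType)
    (mu : {measure set T -> \bar R}) (A : set T) (c : R) :
  measurable A -> (mu A < +oo)%E -> mu.-integrable A (EFin \o cst c).
Proof.
move=> mA Alty; apply/integrableP; split; first exact/measurable_EFinP.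
rewrite /= integral_cst//= -[mu A]fineK ?ge0_fin_numE//.
by rewrite -EFinM ltry.
Qed.

(** * Fubini for real-valued integrals *)

Section Rintegral_fubini.
Context d1 d2 (T1 : measurableType d1) (T2 : measurableType d2) (R : realType).
Variables (m1 : {sigma_finite_measure set T1 -> \bar R}).
Variables (m2 : {sigma_finite_measure set T2 -> \bar R}).
Variables (S : set T1) (X : set T2).
Hypotheses (mS : measurable S) (mX : measurable X).
Variables (g : T1 -> T2 -> R) (K : T1 -> R).
Hypothesis mg : measurable_fun (S `*` X) (fun p : T1 * T2 => g p.1 p.2).
Hypothesis iK : m1.-integrable S (EFin \o K).
Hypothesis gK : forall s, S s -> (\int[m2]_(x in X) `|g s x|%:E <= (K s)%:E)%E.

(** Extension by zero to the whole product: [Fubini] then applies on the full spaces, and every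
    section of [F] is a restriction of a section of [g], or zero. *)
Let F := (EFin \o (fun p : T1 * T2 => g p.1 p.2)) \_ (S `*` X).

Let FE s x : F (s, x) = if s \in S then ((EFin \o g s) \_ X) x else 0%E.
Proof. by rewrite /F !patchE in_setX; case: (s \in S); case: (x \in X). Qed.

Let FE' s x : F (s, x) = if x \in X then ((EFin \o g^~ x) \_ S) s else 0%E.
Proof. by rewrite /F !patchE in_setX; case: (s \in S); case: (x \in X). Qed.

Let mF : measurable_fun setT F.
Proof.
apply/(measurable_restrictT _ _).1 => //; first exact: measurableX.
exact/measurable_EFinP.
Qed.

Let iF : (m1 \x m2)%E.-integrable setT F.
Proof.
apply/integrable12ltyP => //=.
apply: (@le_lt_trans _ _ (\int[m1]_(s in S) (K s)%:E)%E); last first.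
  by rewrite ltey_eq (integrable_fin_num _ iK).
rewrite [leRHS]integral_mkcond; apply: ge0_le_integral => //=.
- by move=> s _; apply: integral_ge0.
- by apply: (measurable_fun_fubini_tonelli_F (abse \o F)) => //=; exact: measurableT_comp.
- by apply/(measurable_restrictT _ _).1 => //; exact: measurable_int iK.
- move=> s _; rewrite patchE; case: ifPn => sS; last first.
    rewrite (eq_integral (cst 0%E)) ?integral0// => x _.
    by rewrite FE (negbTE sS) abse0.
  rewrite (eq_integral ((fun x => `|g s x|%:E) \_ X)) => [|x _]; last first.
    by rewrite FE sS !patchE; case: ifPn => // _; rewrite abse0.
  by rewrite -integral_mkcond gK//; exact: set_mem.
Qed.

Let sec1 s : S s -> m2.-integrable X (EFin \o g s).
Proof.
move=> Ss; apply/integrableP; split; last first.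
  by apply: le_lt_trans (ltry (K s)); exact: gK.
apply/(measurable_restrictT _ _).2 => //.
have := measurableT_comp mF (measurable_pair1 s).
by congr measurable_fun; apply/funext => x /=; rewrite FE mem_set.
Qed.

Let G := fubini_G m1 F.

Let w x := \int[m1]_(s in S) g s x.

Let GE x : X x -> G x = (\int[m1]_(s in S) (g s x)%:E)%E.
Proof.
move=> Xx; rewrite /G /fubini_G [RHS]integral_mkcond; apply: eq_integral => s _.
by rewrite FE' mem_set.
Qed.

Let wE : {in X, fine \o G =1 w}.
Proof. by move=> x /set_mem Xx /=; rewrite GE. Qed.

Let iG : m2.-integrable X G.
Proof.
apply: (@integrableS _ _ _ _ setT) => //.
apply/integrableP; split; first exact: measurable_fubini_G iF.
apply: le_lt_trans ((integrable21ltyP _ _ mF).1 iF).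
apply: ge0_le_integral => //.
- by apply: measurableT_comp => //; exact: measurable_fubini_G iF.
- apply: (measurable_fun_fubini_tonelli_G (abse \o F)) => //=.
  exact: measurableT_comp.
- move=> x _; apply: le_abse_integral => //.
  exact: measurableT_comp mF (measurable_pair2 x).
Qed.

(** Kept beside the real-valued version because a section integral may be infinite on a null set,
    where [fine] would report [0]; [average_square_integrable] needs the true value as an upper
    bound. *)
Lemma integrable_Rintegral_ereal :
  m2.-integrable X (fun x => \int[m1]_(s in S) (g s x)%:E)%E.
Proof. by apply: (eq_integrable mX) iG => x /set_mem /GE. Qed.

Lemma integrable_Rintegral :
  m2.-integrable X (EFin \o (fun x => \int[m1]_(s in S) g s x)).
Proof.
apply: (le_integrable mX _ _ iG) => [|x Xx].
  apply/measurable_EFinP; apply: (eq_measurable_fun _ wE).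
  by apply: measurableT_comp => //; exact: measurable_int iG.
(* [fine] maps both infinities to [0], so [w] is dominated by [G] even where [G] is infinite. *)
by rewrite /= -/(w x) -(wE (mem_set Xx)) /=; case: (G x) => [r| |]//=; rewrite normr0 leey.
Qed.

Lemma ae_integrable_section :
  {ae m2, forall x, X x -> m1.-integrable S (EFin \o g^~ x)}.
Proof.
have := ae_integrable2 iF; apply: filterS => x iFx Xx.
have := integrableS measurableT mS (@subsetT _ _) iFx.
apply: (eq_integrable mS) => s /set_mem Ss /=.
by rewrite FE' mem_set// patchE mem_set.
Qed.

Lemma Rintegral_fubini :
  \int[m2]_(x in X) \int[m1]_(s in S) g s x =
  \int[m1]_(s in S) \int[m2]_(x in X) g s x.
Proof.
(* [G] is integrable, hence finite almost everywhere, and where it is finite it equals [w]. *)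
have E1 : (\int[m2]_(x in X) (w x)%:E = \int[m2]_x G x)%E.
  transitivity (\int[m2]_(x in X) G x)%E.
    apply: ae_eq_integral => //.
    - exact: measurable_int integrable_Rintegral.
    - exact: measurable_int iG.
    - have := integrable_ae mX iG; apply: filterS => x + Xx => /(_ Xx) fG.
      by rewrite -(wE (mem_set Xx)) /= fineK.
  rewrite integral_mkcond; apply: eq_integral => x _; rewrite patchE.
  case: ifPn => // xX; rewrite /G /fubini_G.
  by rewrite (eq_integral (cst 0%E)) ?integral0// => s _; rewrite FE' (negbTE xX).
rewrite /Rintegral E1 -(Fubini iF); congr fine.
rewrite [RHS]integral_mkcond; apply: eq_integral => s _; rewrite patchE.
case: ifPn => sS; last first.
  by rewrite (eq_integral (cst 0%E)) ?integral0// => x _; rewrite FE (negbTE sS).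
rewrite fineK; last by apply: integrable_fin_num => //; apply: sec1; exact: set_mem.
rewrite [RHS]integral_mkcond; apply: eq_integral => x _.
by rewrite FE sS.
Qed.

End Rintegral_fubini.

(** * Averages of a curve of square-integrable functions *)

Section average.
Context d1 d2 (T1 : measurableType d1) (T2 : measurableType d2) (R : realType).
Variables (m1 : {sigma_finite_measure set T1 -> \bar R}).
Variables (m2 : {sigma_finite_measure set T2 -> \bar R}).
Variables (S : set T1) (X : set T2).
Hypotheses (mS : measurable S) (mX : measurable X).
Hypotheses (S_lty : (m1 S < +oo)%E) (X_lty : (m2 X < +oo)%E).
Variables (z : T1 -> T2 -> R) (C : R).
Hypothesis mz : measurable_fun (S `*` X) (fun p : T1 * T2 => z p.1 p.2).
Hypothesis z2 : forall s, S s ->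
  square_integrable m2 X (z s) /\ pairing m2 X (z s) (z s) <= C.

(** There is no division by the measure of [S]: the normalization is postponed to [steklov_decay],
    where [h ^+ 2] is divided out. *)
Definition average x := \int[m1]_(s in S) z s x.

Let integral_le_dominated (f h : T2 -> R) (K : R) :
  measurable_fun X f -> m2.-integrable X (EFin \o h) ->
  (forall x, X x -> `|f x| <= h x) -> \int[m2]_(x in X) h x <= K ->
  (\int[m2]_(x in X) `|f x|%:E <= K%:E)%E.
Proof.
move=> mf ih fh hK; apply: (@le_trans _ _ (\int[m2]_(x in X) (h x)%:E)%E).
  apply: ge0_le_integral => //.
  - by apply/measurable_EFinP; exact: measurableT_comp.
  - exact: measurable_int ih.
rewrite -(@fineK _ (\int[m2]_(x in X) (h x)%:E)%E) ?lee_fin//.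
exact: integrable_fin_num.
Qed.

Let mz_section x : X x -> measurable_fun S (z^~ x).
Proof.
move=> Xx; apply: (@measurable_comp _ _ _ _ _ _ (S `*` X)
  (fun p : T1 * T2 => z p.1 p.2) _ (fun s => (s, x))) => //.
- exact: measurableX.
- by move=> _ [s Ss <-].
- exact: measurable_funS (measurable_pair2 x).
Qed.

Let z_bound1 s : S s ->
  (\int[m2]_(x in X) `|z s x|%:E <= (fine (m2 X) + C)%:E)%E.
Proof.
move=> /z2 [[mzs izs] zC].
have i1 : m2.-integrable X (EFin \o cst 1) by exact: integrable_cst_lty.
apply: (@integral_le_dominated _ (fun x => 1 + z s x ^+ 2)) => //.
- exact: (integrableD mX i1 izs).
- by move=> x Xx; rewrite ler_norml; apply/andP; split; nra.
- by rewrite RintegralD// Rintegral_cst// mul1r lerD2l.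
Qed.

Let z_bound2 s : S s ->
  (\int[m2]_(x in X) `|z s x ^+ 2|%:E <= C%:E)%E.
Proof.
move=> /z2 [[mzs izs] zC].
apply: (@integral_le_dominated _ (fun x => z s x ^+ 2)) => //.
- exact: measurable_funX.
- by move=> x Xx; rewrite ger0_norm ?sqr_ge0.
Qed.

(** Cauchy-Schwarz in [s] bounds [average x ^+ 2] by [m1 S] times the integral of [z s x ^+ 2] over
    [s], and the latter is integrable in [x] by Fubini. *)
Lemma average_square_integrable : square_integrable m2 X average.
Proof.
have iw := integrable_Rintegral mS mX mz (integrable_cst_lty _ mS S_lty) z_bound1.
have mw : measurable_fun X average by apply/measurable_EFinP; exact: measurable_int iw.
(* Adding [1] keeps [c] positive even when [S] is null, so that [c] times an infinite integral is
   still infinite. *)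
split=> //; set c := fine (m1 S) + 1.
have c0 : 0 < c by rewrite ltr_wpDl// fine_ge0.
have mz2 : measurable_fun (S `*` X) (fun p : T1 * T2 => z p.1 p.2 ^+ 2).
  exact: measurable_funX.
have := integrable_Rintegral_ereal mS mX mz2 (integrable_cst_lty _ mS S_lty) z_bound2.
move=> /(integrableZl mX c); apply: (le_integrable mX) => [|x Xx].
  by apply/measurable_EFinP; exact: measurable_funX.
have mzx := mz_section Xx.
have I0 : (0 <= \int[m1]_(s in S) (z s x ^+ 2)%:E)%E.
  by apply: integral_ge0 => s _; rewrite lee_fin sqr_ge0.
rewrite /= ger0_norm ?sqr_ge0// gee0_abs; last by rewrite mule_ge0// lee_fin ltW.
have [Ioo|] := eqVneq (\int[m1]_(s in S) (z s x ^+ 2)%:E)%E +oo%E.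
  by rewrite Ioo gt0_muley ?lte_fin// leey.
rewrite -ltey => Ilty.
have sz : square_integrable m1 S (z^~ x).
  split=> //; apply/integrableP; split.
    by apply/measurable_EFinP; exact: measurable_funX.
  rewrite (eq_integral (fun s => (z s x ^+ 2)%:E))// => s _ /=.
  by rewrite ger0_norm ?sqr_ge0.
have s1 : square_integrable m1 S (cst 1).
  split=> //; rewrite (_ : (fun x => _) = cst 1); first exact: integrable_cst_lty.
  by apply/funext => s; rewrite /= expr1n.
rewrite -(@fineK _ (\int[m1]_(s in S) (z s x ^+ 2)%:E)%E) ?ge0_fin_numE// -EFinM lee_fin.
have := pairing_cauchy_schwarz mS sz s1.
have -> : pairing m1 S (z^~ x) (cst 1) = average x.
  by apply: eq_Rintegral => s _; rewrite /= mulr1.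
have -> : pairing m1 S (cst 1) (cst 1) = fine (m1 S).
  by rewrite /pairing -[RHS]mul1r -Rintegral_cst//; apply: eq_Rintegral => s _ /=; rewrite mulr1.
by move=> /le_trans; apply; rewrite mulrC ler_pM ?fine_ge0 ?lerDl ?pairing_ge0.
Qed.

Lemma pairing_average y : square_integrable m2 X y ->
  pairing m2 X average y = \int[m1]_(s in S) pairing m2 X (z s) y.
Proof.
move=> sy.
have mzy : measurable_fun (S `*` X) (fun p : T1 * T2 => z p.1 p.2 * y p.2).
  apply: measurable_funM => //.
  apply: (@measurable_comp _ _ _ _ _ _ X y _ snd) => //.
  - by move=> _ [p [_ Xp] <-].
  - by case: sy.
  - exact: measurable_funS measurable_snd.
have bzy s : S s -> (\int[m2]_(x in X) `|z s x * y x|%:E <=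
    (C + pairing m2 X y y)%:E)%E.
  move=> Ss; have [[mzs izs] zC] := z2 Ss.
  have [my iy] := sy.
  apply: (@integral_le_dominated _ (fun x => z s x ^+ 2 + y x ^+ 2)) => //.
  - exact: measurable_funM.
  - exact: (integrableD mX izs iy).
  - by move=> x Xx; rewrite ler_norml; apply/andP; split; nra.
  - by rewrite RintegralD// lerD//; exact: le_trans zC.
rewrite -(Rintegral_fubini mS mX mzy (integrable_cst_lty _ mS S_lty) bzy) /pairing /Rintegral; congr fine.
(* Moving [y x] out of the integral over [S] requires [z^~ x] to be integrable, which Fubini grants
   only for almost every [x]. *)
apply: ae_eq_integral => //.
- have [mw _] := average_square_integrable.
  by apply/measurable_EFinP; apply: measurable_funM => //; case: sy.
- exact: measurable_int (integrable_Rintegral mS mX mzy (integrable_cst_lty _ mS S_lty) bzy).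
- have := ae_integrable_section mS mX mz (integrable_cst_lty _ mS S_lty) z_bound1; apply: filterS => x ix Xx.
  by congr EFin; apply/esym/RintegralZr => //; exact: ix.
Qed.

End average.

(** * Primitives of integrable functions *)

Section primitives.
Context {R : realType}.
Notation mu := (@lebesgue_measure R).
Implicit Types (L x : R) (F G k g : R -> R).

Lemma itv_integrableZ (i : interval R) (c : R) k :
  mu.-integrable [set` i] (EFin \o k) ->
  mu.-integrable [set` i] (EFin \o (fun x => c * k x)).
Proof. by move=> ik; apply: (integrableZl _ c ik) => //; exact: measurable_itv. Qed.

Lemma itv_integrableD (i : interval R) k g :
  mu.-integrable [set` i] (EFin \o k) -> mu.-integrable [set` i] (EFin \o g) ->
  mu.-integrable [set` i] (EFin \o (fun x => k x + g x)).
Proof. by move=> ik ig; apply: (integrableD _ ik ig) => //; exact: measurable_itv. Qed.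

Lemma eq_itv_integrable (i : interval R) k g :
  {in i, k =1 g} -> mu.-integrable [set` i] (EFin \o k) ->
  mu.-integrable [set` i] (EFin \o g).
Proof.
move=> kg; apply: eq_integrable => [|x]; first exact: measurable_itv.
by rewrite inE => xi /=; rewrite kg.
Qed.

Lemma continuous_itv_bounded (a b : R) F : {within `[a, b], continuous F} ->
  exists C, forall x, x \in `[a, b] -> `|F x| <= C.
Proof.
move=> cF; have [ab|ba] := leP a b; last first.
  by exists 0 => x; rewrite in_itv/= => /andP[/le_trans h /h]; rewrite leNgt ba.
have [c _ cmax] := EVT_max ab cF; have [e _ emin] := EVT_min ab cF.
exists (`|F c| + `|F e|) => x xab; have := cmax x xab; have := emin x xab.
have := ler_norm (F c); have := ler_norm (- F e); rewrite normrN.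
have := normr_ge0 (F c); have := normr_ge0 (F e).
by move=> *; rewrite ler_norml; apply/andP; split; lra.
Qed.

Lemma continuous_itv_measurable (a b : R) F : {within `[a, b], continuous F} ->
  measurable_fun `[a, b] F.
Proof. by move=> cF; apply: subspace_continuous_measurable_fun. Qed.

Lemma integrableM_continuous (a b : R) F k : {within `[a, b], continuous F} ->
  mu.-integrable `[a, b] (EFin \o k) ->
  mu.-integrable `[a, b] (EFin \o (fun x => F x * k x)).
Proof.
move=> cF ik; have [C FC] := continuous_itv_bounded cF.
have mk : measurable_fun `[a, b] k by apply/measurable_EFinP; exact: measurable_int ik.
apply: (le_integrable _ _ _ (integrableZl _ C ik)) => //.
  by apply/measurable_EFinP; apply: measurable_funM => //; exact: continuous_itv_measurable.
move=> x xI /=; rewrite lee_fin !normrM ler_wpM2r//.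
exact: le_trans (FC _ xI) (ler_norm _).
Qed.

(** [F] is absolutely continuous on [[0, L]] with density [k]. Stating this by integrals lets the
    product rule be proved by Fubini, without almost everywhere derivatives. *)
Definition primitive_on L F k :=
  mu.-integrable `[0, L] (EFin \o k) /\
  forall x, x \in `[0, L] -> F x = F 0 + \int[mu]_(t in `[0, x]) k t.

Lemma primitive_on_continuous L F k : 0 <= L -> primitive_on L F k ->
  {within `[0, L], continuous F}.
Proof.
move=> L0 [ik FE].
have cK := parameterized_integral_continuous L0 ik.
apply: (@subspace_eq_continuous _ _ _ (fun x => F 0 + \int[mu]_(t in `[0, x]) k t)).
  by move=> x /set_mem xI; rewrite -FE.
by move=> x; apply: cvgD; [exact: cvg_cst|exact: cK].
Qed.

Lemma integrable_sub_itv (a b c e : R) k : mu.-integrable `[a, b] (EFin \o k) ->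
  a <= c -> e <= b -> mu.-integrable `[c, e] (EFin \o k).
Proof.
move=> ik ac eb; apply: integrableS ik => //.
by apply: subset_itv; rewrite bnd_simp.
Qed.

(** The square [[0, X]^2] is cut along its diagonal: integrating [k s * g x] over [s < x] in both
    orders gives the integral of [K * g] one way and that of [(G X - G s) * k s] the other. *)
Let triangle (X : R) k g : 0 <= X ->
  mu.-integrable `[0, X] (EFin \o k) -> mu.-integrable `[0, X] (EFin \o g) ->
  let K := fun x => \int[mu]_(t in `[0, x]) k t in
  let G := fun x => \int[mu]_(t in `[0, x]) g t in
  \int[mu]_(x in `[0, X]) (G x * k x + K x * g x) = K X * G X.
Proof.
move=> X0 ik ig K G.
have cK : {within `[0, X], continuous K} by exact: parameterized_integral_continuous.
have cG : {within `[0, X], continuous G} by exact: parameterized_integral_continuous.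
have mk : measurable_fun `[0, X] k by apply/measurable_EFinP; exact: measurable_int ik.
have mg : measurable_fun `[0, X] g by apply/measurable_EFinP; exact: measurable_int ig.
pose h (s x : R) := if s < x then k s * g x else 0.
have hE1 (s x : R) : h s x = (k \_ `]-oo, x[) s * g x.
  by rewrite /h patchE mem_setE in_itv/=; case: ifPn => // _; rewrite mul0r.
have hE2 (s x : R) : h s x = k s * (g \_ `]s, +oo[) x.
  by rewrite /h patchE mem_setE in_itv/= andbT; case: ifPn => // _; rewrite mulr0.
have mh : measurable_fun (`[0, X] `*` `[0, X]) (fun p : R * R => h p.1 p.2).
  have mI : measurable (`[0, X]%classic `*` `[0, X]%classic : set (R * R)).
    exact: measurableX.
  apply: measurable_fun_if => //.
    by apply: measurable_fun_ltr; exact: measurable_funTS.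
  apply: (@measurable_funS _ _ _ _ (`[0, X]%classic `*` `[0, X]%classic)) => //.
  apply: measurable_funM.
  - apply: (@measurable_comp _ _ _ _ _ _ `[0, X]%classic k _ fst) => //.
      by move=> _ [p [Xp _] <-].
    exact: measurable_funTS.
  - apply: (@measurable_comp _ _ _ _ _ _ `[0, X]%classic g _ snd) => //.
      by move=> _ [p [_ Xp] <-].
    exact: measurable_funTS.
pose c := \int[mu]_(x in `[0, X]) `|g x|.
have ikc : mu.-integrable `[0, X] (EFin \o (fun s => `|k s| * c)).
  have := itv_integrableZ c (integrable_norm ik).
  by apply: eq_itv_integrable => s _ /=; rewrite mulrC.
have bh s : `[0, X]%classic s ->
    (\int[mu]_(x in `[0%R, X]) `|h s x|%:E <= (`|k s| * c)%:E)%E.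
  move=> sI; have ig' := integrable_norm ig.
  rewrite -(@RintegralZl _ _ _ mu)// /Rintegral fineK; last first.
    exact: (integrable_fin_num _ (itv_integrableZ `|k s| ig')).
  apply: ge0_le_integral => //.
  - apply/measurable_EFinP; apply: measurableT_comp => //.
    apply: (@measurable_comp _ _ _ _ _ _ (`[0, X]%classic `*` `[0, X]%classic)
      (fun p : R * R => h p.1 p.2) _ (fun x => (s, x))) => //.
    + exact: measurableX.
    + by move=> _ [x Xx <-].
    + exact: measurable_funTS (measurable_pair1 s).
  - by apply: measurable_int (itv_integrableZ `|k s| ig').
  - move=> x xI; rewrite lee_fin /h; case: ifPn => _; first by rewrite normrM.
    by rewrite normr0 mulr_ge0.
have sub0 x : x \in `[0, X] -> mu.-integrable `[0, x] (EFin \o k).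
  by rewrite in_itv/= => /andP[_ xX]; exact: integrable_sub_itv ik _ xX.
have : \int[mu]_(x in `[0, X]) \int[mu]_(s in `[0, X]) h s x =
    \int[mu]_(s in `[0, X]) \int[mu]_(x in `[0, X]) h s x.
  have mI : measurable (`[0, X]%classic : set (measurableTypeR R)).
    exact: measurable_itv.
  exact: (Rintegral_fubini mI mI mh ikc bh).
have -> : \int[mu]_(x in `[0, X]) \int[mu]_(s in `[0, X]) h s x =
    \int[mu]_(x in `[0, X]) (K x * g x).
  apply: eq_Rintegral => x; rewrite inE/= in_itv/= => /andP[x0 xX].
  under eq_Rintegral do rewrite hE1.
  rewrite RintegralZr//; last first.
    rewrite -restrict_EFin; apply/integrable_restrict => //.
    by apply: integrableS ik => //; exact: measurableI.
  congr (_ * _); rewrite -Rintegral_mkcondr /K.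
  rewrite -Rintegral_itv_bndo_bndc; last first.
    by apply: (integrableS _ _ _ ik) => //; apply: subset_itv; rewrite bnd_simp.
  congr (\int[mu]_(_ in _) _); apply/seteqP; split => y /=; rewrite !in_itv/=.
    by move=> [/andP[-> _] ->].
  by move=> /andP[-> yx]; rewrite yx (le_trans (ltW yx) xX).
have -> : \int[mu]_(s in `[0, X]) \int[mu]_(x in `[0, X]) h s x =
    \int[mu]_(s in `[0, X]) (G X * k s - G s * k s).
  apply: eq_Rintegral => s; rewrite inE/= in_itv/= => /andP[s0 sX].
  under eq_Rintegral do rewrite hE2.
  rewrite RintegralZl//; last first.
    rewrite -restrict_EFin; apply/integrable_restrict => //.
    by apply: integrableS ig => //; exact: measurableI.
  rewrite -Rintegral_mkcondr -mulrBl mulrC; congr (_ * _).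
  rewrite /G Rintegral_itvB// ?bnd_simp//.
  congr (\int[mu]_(_ in _) _); apply/seteqP; split => y /=; rewrite !in_itv/= ?andbT.
    by move=> [/andP[_ ->] ->].
  by move=> /andP[sy ->]; rewrite sy (le_trans s0 (ltW sy)).
have iGk : mu.-integrable `[0, X] (EFin \o (fun x => G x * k x)).
  exact: integrableM_continuous.
have iKg : mu.-integrable `[0, X] (EFin \o (fun x => K x * g x)).
  exact: integrableM_continuous.
rewrite RintegralB//; last exact: (itv_integrableZ (G X) ik).
rewrite RintegralZl// RintegralD// -/(K X) => ->.
by rewrite addrC subrK mulrC.
Qed.

(** Each factor is its initial value plus a primitive that vanishes at [0]; the cross terms are
    linear, and the product of the two primitives is [triangle] on [[0, x]]. *)
Lemma primitive_onM L F k G g : 0 <= L -> primitive_on L F k ->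
  primitive_on L G g ->
  primitive_on L (fun x => F x * G x) (fun x => k x * G x + F x * g x).
Proof.
move=> L0 pF pG.
have cF := primitive_on_continuous L0 pF; have cG := primitive_on_continuous L0 pG.
have [ik FE] := pF; have [ig GE] := pG.
have iGk := integrableM_continuous cG ik; have iFg := integrableM_continuous cF ig.
split.
  have := itv_integrableD iGk iFg.
  by apply: eq_itv_integrable => x _ /=; rewrite (mulrC (k x)).
move=> x xI; have /andP[x0 xL] : 0 <= x <= L by move: xI; rewrite in_itv.
have ik' := integrable_sub_itv ik (lexx 0) xL.
have ig' := integrable_sub_itv ig (lexx 0) xL.
have cK' := parameterized_integral_continuous x0 ik'.
have cG' := parameterized_integral_continuous x0 ig'.
have iGk' := integrableM_continuous cG' ik'.
have iKg' := integrableM_continuous cK' ig'.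
rewrite (FE x xI) (GE x xI).
transitivity (F 0 * G 0 + (G 0 * \int[mu]_(t in `[0, x]) k t +
    F 0 * \int[mu]_(t in `[0, x]) g t +
    (\int[mu]_(t in `[0, x]) k t) * \int[mu]_(t in `[0, x]) g t)).
  by ring.
congr (_ + _); rewrite -(triangle x0 ik' ig') -!RintegralZl// -RintegralD//; last 2 first.
- exact: (itv_integrableZ (G 0) ik').
- exact: (itv_integrableZ (F 0) ig').
rewrite -RintegralD//; last 2 first.
- exact: (itv_integrableD (itv_integrableZ (G 0) ik') (itv_integrableZ (F 0) ig')).
- exact: (itv_integrableD iGk' iKg').
apply: eq_Rintegral => y; rewrite inE/= in_itv/= => /andP[y0 yx].
have yI : y \in `[0, L] by rewrite in_itv/= y0 (le_trans yx).
by rewrite (FE y yI) (GE y yI); ring.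
Qed.

Lemma primitive_onD L F k G g : primitive_on L F k ->
  primitive_on L G g ->
  primitive_on L (fun x => F x + G x) (fun x => k x + g x).
Proof.
move=> [ik FE] [ig GE]; split; first exact: (itv_integrableD ik ig).
move=> x xI; have /andP[x0 xL] : 0 <= x <= L by move: xI; rewrite in_itv.
have ik' := integrable_sub_itv ik (lexx 0) xL.
have ig' := integrable_sub_itv ig (lexx 0) xL.
by rewrite (FE x xI) (GE x xI) RintegralD//; ring.
Qed.

End primitives.

Lemma mx_cvg (T : topologicalType) m n (U : Type) (F : set_system U)
    (f : U -> 'M[T]_(m, n)) (M : 'M[T]_(m, n)) : Filter F ->
  (forall i j, f u i j @[u --> F] --> M i j) -> f @ F --> M.
Proof.
move=> FF fM A [P MP PA].
have : \forall u \near F, forall i j, P i j (f u i j).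
  by apply: filter_forall => i; apply: filter_forall => j; exact/fM/MP.
by apply: filterS => u Pu; exact: PA.
Qed.

(** * Derivatives within a set *)

Section derive_within.
Context {R : realType}.

(** The limit is an argument, so the calculus rules below need no uniqueness of limits; this enters
    only in [is_derive_withinE], through [within_itv_proper]. *)
Definition is_derive_within (V : normedModType R) (D : set R) (F : R -> V)
    (x : R) (l : V) :=
  difference_quotient F x y @[y --> within D x^'] --> l.

Implicit Types (D : set R) (F G : R -> R) (x l m : R).

Lemma is_derive_within_eq (V : normedModType R) D (F G : R -> V) x (l : V) : D x ->
  (forall y, D y -> F y = G y) ->
  is_derive_within D F x l -> is_derive_within D G x l.
Proof.
move=> Dx FG; apply: cvg_trans; apply: near_eq_cvg; rewrite near_withinE.
by apply: nearW => y Dy; rewrite /difference_quotient !FG.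
Qed.

Lemma near_within_neq D x : \forall y \near within D x^', y != x.
Proof. by apply: cvg_within; apply: withinT. Qed.

Lemma near_within_dnbhs D x (P : set R) :
  within D x^' P -> nbhs x (fun y => y != x -> D y -> P y).
Proof. by []. Qed.

Lemma is_derive_within_cvg D F x l : is_derive_within D F x l ->
  F y @[y --> within D x^'] --> F x.
Proof.
move=> Fl.
have cx : y - x @[y --> within D x^'] --> 0.
  rewrite -(subrr x); apply: cvgB; last exact: cvg_cst.
  by move=> A xA; apply: cvg_within; exact: cvg_within xA.
have h : (y - x) * difference_quotient F x y + F x
    @[y --> within D x^'] --> 0 * l + F x.
  by apply: cvgD; [exact: cvgM|exact: cvg_cst].
rewrite mul0r add0r in h; apply: cvg_trans h; apply: near_eq_cvg.
near=> y; rewrite /difference_quotient /= /GRing.scale/= mulVKf ?subrK//.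
rewrite subr_eq0; near: y; exact: near_within_neq.
Unshelve. all: by end_near. Qed.

Lemma is_derive_within_cst (V : normedModType R) D x (c : V) :
  is_derive_within D (fun=> c) x 0.
Proof.
rewrite /is_derive_within (_ : difference_quotient _ _ = cst 0); first exact: cvg_cst.
by apply/funext => y; rewrite /difference_quotient subrr scaler0.
Qed.

Lemma is_derive_within_id D x : is_derive_within D id x 1.
Proof.
have h : (1 : R) @[y --> within D x^'] --> (1 : R) by exact: cvg_cst.
apply: cvg_trans h; apply: near_eq_cvg.
near=> y; rewrite /difference_quotient /GRing.scale /= mulVf//.
rewrite subr_eq0; near: y; exact: near_within_neq.
Unshelve. all: by end_near. Qed.

Lemma is_derive_withinD D F G x l m : is_derive_within D F x l ->
  is_derive_within D G x m -> is_derive_within D (fun y => F y + G y) x (l + m).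
Proof.
move=> Fl Gm.
have h : difference_quotient F x y + difference_quotient G x y
    @[y --> within D x^'] --> l + m by exact: cvgD.
apply: cvg_trans h; apply: near_eq_cvg; apply: nearW => y.
by rewrite /difference_quotient /GRing.scale/=; ring.
Qed.

Lemma is_derive_withinM D F G x l m : is_derive_within D F x l ->
  is_derive_within D G x m ->
  is_derive_within D (fun y => F y * G y) x (l * G x + F x * m).
Proof.
move=> Fl Gm.
have h : difference_quotient F x y * G y + F x * difference_quotient G x y
    @[y --> within D x^'] --> l * G x + F x * m.
  apply: cvgD; first exact: cvgM Fl (is_derive_within_cvg Gm).
  exact: cvgM (cvg_cst _) Gm.
apply: cvg_trans h; apply: near_eq_cvg; apply: nearW => y.
by rewrite /difference_quotient /GRing.scale/=; ring.
Qed.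

(** The continuous slope function [g] of [phi] at [F x] avoids a quotient by [F y - F x], which may
    vanish for [y] arbitrarily close to [x]. *)
Lemma is_derive_within_comp D F x l (phi : R -> R) m : is_derive_within D F x l ->
  is_derive (F x) 1 phi m -> is_derive_within D (phi \o F) x (m * l).
Proof.
move=> Fl /is_derive1_caratheodory[g [gE cg <-]].
have cgF : g (F y) @[y --> within D x^'] --> g (F x).
  exact: (cvg_comp _ _ (is_derive_within_cvg Fl) cg).
have h : g (F y) * difference_quotient F x y @[y --> within D x^'] --> g (F x) * l.
  exact: cvgM cgF Fl.
apply: cvg_trans h; apply: near_eq_cvg; apply: nearW => y.
by rewrite /difference_quotient /GRing.scale/= gE; ring.
Qed.

Lemma is_derive_withinZ D F x l c : is_derive_within D F x l ->
  is_derive_within D (fun y => c * F y) x (c * l).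
Proof.
move=> Fl; have := is_derive_withinM (is_derive_within_cst D x c) Fl.
by rewrite mul0r add0r.
Qed.

Lemma is_derive_withinV D F x l : F x != 0 -> is_derive_within D F x l ->
  is_derive_within D (fun y => (F y)^-1) x (- (F x) ^- 2 * l).
Proof.
move=> Fx Fl.
have h : is_derive (F x) 1 (fun y : R => y^-1) (- (F x) ^- 2).
  by have := is_deriveV Fx (is_derive_id (F x) (1 : R)); rewrite /GRing.scale/= mulr1.
exact: is_derive_within_comp Fl h.
Qed.

Lemma is_derive_within_sqrt D F x l : 0 < F x -> is_derive_within D F x l ->
  is_derive_within D (fun y => Num.sqrt (F y)) x ((2 * Num.sqrt (F x))^-1 * l).
Proof. by move=> Fx Fl; exact: is_derive_within_comp Fl (is_derive1_sqrt Fx). Qed.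

Lemma is_derive_within_continuous D F (l : R -> R) :
  (forall x, D x -> is_derive_within D F x (l x)) -> {within D, continuous F}.
Proof.
move=> Fl; apply/subspace_continuousP => x Dx A xA.
have := is_derive_within_cvg (Fl x Dx) xA.
move=> /near_within_dnbhs h0; suff : nbhs x (fun y => D y -> A (F y)) by [].
apply: filterS h0 => y h Dy.
by have [->|yx] := eqVneq y x; [exact: nbhs_singleton|exact: h].
Qed.

Lemma is_derive_is_derive_within D F x l : is_derive x 1 F l ->
  is_derive_within D F x l.
Proof.
move=> Fl; have := is_derive_within_comp (is_derive_within_id D x) Fl.
by rewrite mulr1.
Qed.

(** Every point of [[0, L]] is approached from inside the interval, from the right when [x < L] and
    from the left at [L]. Hence the limit in [derive_within] is unique. *)
Lemma within_itv_proper (L x : R) : 0 < L -> x \in `[0, L] ->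
  ProperFilter (within `[0, L] x^').
Proof.
move=> L0 xI; apply: Build_ProperFilter_ex => P.
rewrite /within /= /dnbhs /within /= => /nbhs_ballP[e /= e0 eP].
move: xI; rewrite in_itv/= => /andP[x0 xL].
have [xl|xl] := ltP x L.
  pose d := Num.min (e / 2) (L - x).
  have d0 : 0 < d by rewrite lt_min divr_gt0//= subr_gt0.
  have de : d < e by rewrite gt_min ltr_pdivrMr// ltr_pMr// ltr1n.
  have dL : d <= L - x by rewrite ge_min lexx orbT.
  exists (x + d); apply: eP.
  - by rewrite /ball/= opprD addrA subrr sub0r normrN gtr0_norm.
  - by rewrite gt_eqF// ltrDl.
  - by rewrite /= in_itv/= addr_ge0 ?(ltW d0)//= -lerBrDl.
pose d := Num.min (e / 2) x.
have x0' : 0 < x by exact: lt_le_trans xl.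
have d0 : 0 < d by rewrite lt_min divr_gt0//=.
have de : d < e by rewrite gt_min ltr_pdivrMr// ltr_pMr// ltr1n.
have dx : d <= x by rewrite ge_min lexx orbT.
exists (x - d); apply: eP.
- by rewrite /ball/= opprB addrC subrK gtr0_norm.
- by rewrite lt_eqF// ltrBlDr ltrDl.
- by rewrite /= in_itv/= subr_ge0 dx/= (le_trans _ xL)// gerBl ltW.
Qed.

Lemma is_derive_within_derivable (V : normedModType R) D (F : R -> V) x (l : V) :
  is_derive_within D F x l -> derivable_within D F x.
Proof. by move=> Fl; apply/cvg_ex; exists l. Qed.

Lemma is_derive_withinE (V : normedModType R) (L : R) (F : R -> V) x (l : V) :
  0 < L -> x \in `[0, L] -> is_derive_within `[0, L] F x l ->
  derive_within `[0, L] F x = l.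
Proof.
by move=> L0 xI Fl; have FF := within_itv_proper L0 xI; exact/cvg_lim.
Qed.

Lemma derivable_withinP (V : normedModType R) D (F : R -> V) x :
  derivable_within D F x -> is_derive_within D F x (derive_within D F x).
Proof. by []. Qed.

Lemma is_derive_within_mx (m n : nat) D (F : R -> 'M[R]_(m.+1, n.+1)) x
    (l : 'M[R]_(m.+1, n.+1)) :
  (forall i j, is_derive_within D (fun y => F y i j) x (l i j)) ->
  is_derive_within D F x l.
Proof.
move=> Fl; apply: mx_cvg => i j; apply: cvg_trans (Fl i j).
by apply: near_eq_cvg; apply: nearW => y; rewrite /difference_quotient !mxE.
Qed.

Lemma mx_within_continuous (T : topologicalType) (m n : nat) (D : set T)
    (F : T -> 'M[R]_(m.+1, n.+1)) :
  (forall i j, {within D, continuous (fun y => F y i j)}) ->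
  {within D, continuous F}.
Proof. by move=> cF x; apply: mx_cvg => i j; exact: cF. Qed.

(** Near an interior point the restriction to [[0, L]] is void. This gives the ordinary derivative
    that the fundamental theorem of calculus asks for. *)
Lemma is_derive_within_interior (L : R) F x l : x \in `]0, L[ ->
  is_derive_within `[0, L] F x l -> is_derive x 1 F l.
Proof.
move=> xI Fl; apply/is_derive1_caratheodory.
exists (fun z => if z == x then l else difference_quotient F x z); split.
- move=> z; case: eqVneq => [->|zx]; first by rewrite !subrr mulr0.
  by rewrite /difference_quotient /GRing.scale/= mulrAC mulVf ?mul1r// subr_eq0.
- rewrite /prop_for /continuous_at eqxx => A lA.
  have oI : nbhs x (fun y : R => y \in `]0, L[).
    exact: near_in_itvoo.
  have := near_within_dnbhs (Fl _ lA); rewrite /fmap /=.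
  apply: filterS2 oI => y yI h /=; have [_|yx] := eqVneq y x.
    exact: nbhs_singleton.
  by apply: h => //; exact: subset_itv_oo_cc.
- by rewrite eqxx.
Qed.

End derive_within.

(** * Continuously differentiable functions and their primitives *)

Section C1_primitives.
Context {R : realType}.
Notation mu := (@lebesgue_measure R).
Implicit Types (L x : R) (F G f k g u U : R -> R).

Lemma itv_oo_cc (a b x : R) : x \in `]a, b[ -> x \in `[a, b].
Proof. by rewrite !in_itv/= => /andP[/ltW -> /ltW ->]. Qed.

(** The derivative is an explicit argument, so that it can be given by a formula; it has to agree
    with [derive_within] on [[0, L]] only. *)
Definition C1_on L F f :=
  (forall x, x \in `[0, L] -> is_derive_within `[0, L] F x (f x)) /\
  {within `[0, L], continuous f}.

Lemma C1_on_continuous L F f : C1_on L F f -> {within `[0, L], continuous F}.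
Proof. by move=> [dF _]; apply: (is_derive_within_continuous (l := f)) => x; exact: dF. Qed.

Lemma continuous_itv_integrable (a b : R) f : {within `[a, b], continuous f} ->
  mu.-integrable `[a, b] (EFin \o f).
Proof. by apply: continuous_compact_integrable; exact: segment_compact. Qed.

Lemma C1_on_primitive L F f : 0 < L -> C1_on L F f -> primitive_on L F f.
Proof.
move=> L0 C1F; have [dF cf] := C1F; have cF := C1_on_continuous C1F.
split; first exact: continuous_itv_integrable.
move=> x; rewrite in_itv/= => /andP[]; rewrite le_eqVlt => /predU1P[<- _|x0 xL].
  by rewrite set_itv1 Rintegral_set1 addr0.
have sub : `[0, x] `<=` `[0, L] by apply: subset_itv; rewrite bnd_simp.
have cF' := continuous_subspaceW sub cF; have cf' := continuous_subspaceW sub cf.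
have [_ cF0 cFx] := (continuous_within_itvP _ x0).1 cF'.
have dF' y : y \in `]0, x[ -> is_derive y 1 F (f y).
  move=> yx; apply: (@is_derive_within_interior _ L).
    by move: yx; rewrite !in_itv/= => /andP[-> yx]; exact: lt_le_trans xL.
  apply: dF; move: yx; rewrite !in_itv/= => /andP[y0 yx].
  by rewrite (ltW y0) (le_trans (ltW yx)).
have E : (\int[mu]_(t in `[0%R, x]) (f t)%:E = (F x)%:E - (F 0)%:E)%E.
  apply: continuous_FTC2 => //.
  - by split => // y yx; have [] := dF' y yx.
  - by move=> y yx; rewrite derive1E; have [] := dF' y yx.
by rewrite /Rintegral E -EFinB /= addrC subrK.
Qed.

(** Projection of the line onto [[0, L]]: composing with it extends a function continuous on the
    interval to one continuous on the whole line. *)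
Definition clamp L x := Num.max 0 (Num.min x L).

Lemma clamp_itv L x : 0 <= L -> clamp L x \in `[0, L].
Proof. by move=> L0; rewrite in_itv/= /clamp le_max lexx/= ge_max L0/= ge_min lexx orbT. Qed.

Lemma clamp_id L x : x \in `[0, L] -> clamp L x = x.
Proof. by rewrite in_itv/= => /andP[x0 xL]; rewrite /clamp (min_idPl xL) (max_idPr x0). Qed.

Lemma continuous_clamp L f : 0 <= L -> {within `[0, L], continuous f} ->
  continuous (f \o clamp L).
Proof.
move=> L0 /subspace_continuousP cf x.
have cc : clamp L y @[y --> x] --> clamp L x.
  apply: (@continuous_max R R (cst 0) (fun y => Num.min y L)); first exact: cvg_cst.
  by apply: (@continuous_min R R id (cst L)); [exact: cvg_id|exact: cvg_cst].
apply: (@cvg_comp _ _ _ _ _ _ (within `[0, L] (nbhs (clamp L x)))); last first.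
  by apply: cf; exact: clamp_itv.
move=> A wA.
have h : nbhs x (fun y => clamp L y \in `[0, L] -> A (clamp L y)) := cc _ wA.
by apply: filterS h => y; apply; exact: clamp_itv.
Qed.

Lemma exists_C1_primitive L f : 0 < L -> {within `[0, L], continuous f} ->
  exists2 F, F 0 = 0 & C1_on L F f.
Proof.
move=> L0 cf; have cg := continuous_clamp (ltW L0) cf.
(* The base point [-1], with [L + 1] on the other side, makes both endpoints of [[0, L]] interior
   points for the fundamental theorem, so that a two-sided derivative exists there. *)
pose G x := \int[mu]_(t in `[-1, x]) (f \o clamp L) t.
exists (fun x => G x - G 0); first by rewrite subrr.
split=> // x xI.
have /andP[x0 xL] : 0 <= x <= L by move: xI; rewrite in_itv.
have ig : mu.-integrable `[-1, L + 1] (EFin \o (f \o clamp L)).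
  by apply: continuous_itv_integrable; exact: continuous_subspaceT.
have [dG GE] : derivable G x 1 /\ derive1 G x = (f \o clamp L) x.
  apply: (@continuous_FTC1_closed _ _ (-1) x (L + 1)) => //.
  - by rewrite ltr_pwDr.
  - exact: lt_le_trans x0.
  - exact: cg.
have dG' : is_derive x 1 G (f x).
  by apply: DeriveDef => //; rewrite -derive1E GE /= clamp_id.
rewrite -[f x]addr0; apply: is_derive_withinD.
  exact: is_derive_is_derive_within.
exact: is_derive_within_cst.
Qed.

Lemma primitive_on_integral L k : mu.-integrable `[0, L] (EFin \o k) ->
  primitive_on L (fun x => \int[mu]_(t in `[0, x]) k t) k.
Proof. by move=> ik; split=> // x _; rewrite set_itv1 Rintegral_set1 add0r. Qed.

Lemma primitive_onE L F k : 0 <= L -> primitive_on L F k ->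
  \int[mu]_(t in `[0, L]) k t = F L - F 0.
Proof.
by move=> L0 [_ /(_ L)] ->; rewrite ?in_itv/= ?L0 ?lexx//; rewrite addrC addKr.
Qed.

Lemma integral_by_parts L F f G g : 0 <= L -> primitive_on L F f ->
  primitive_on L G g ->
  \int[mu]_(t in `[0, L]) (F t * g t) =
  F L * G L - F 0 * G 0 - \int[mu]_(t in `[0, L]) (f t * G t).
Proof.
move=> L0 pF pG; rewrite -(primitive_onE L0 (primitive_onM L0 pF pG)).
have cF := primitive_on_continuous L0 pF; have cG := primitive_on_continuous L0 pG.
have iGf := integrableM_continuous cG pF.1.
have ifG : mu.-integrable `[0, L] (EFin \o (fun x => f x * G x)).
  by apply: eq_itv_integrable iGf => x _ /=; rewrite mulrC.
by rewrite RintegralD//; [rewrite addrAC subrr add0r|exact: integrableM_continuous cF pG.1].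
Qed.

(* A continuous function whose square integrates to zero vanishes: its
   square has a monotone primitive with equal end values. *)
Lemma integral_sqr_eq0 L F : 0 < L -> {within `[0, L], continuous F} ->
  \int[mu]_(t in `[0, L]) (F t ^+ 2) = 0 -> forall x, x \in `]0, L[ -> F x = 0.
Proof.
move=> L0 cF F0 x xI.
have cF2 : {within `[0, L], continuous (fun t => F t ^+ 2)}.
  by move=> t; apply: cvgM; exact: cF.
have [G G0 C1G] := exists_C1_primitive L0 cF2.
have pG := C1_on_primitive L0 C1G.
have GL : G L = 0 by have := primitive_onE (ltW L0) pG; rewrite F0 G0 subr0.
have dG y : y \in `]0, L[ -> is_derive y 1 G (F y ^+ 2).
  move=> yI; apply: (is_derive_within_interior yI).
  by apply: C1G.1; exact: itv_oo_cc.
have mono : {in `[0, L] &, {homo G : y z / y <= z}}.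
  apply: ger0_derive1_le_cc (C1_on_continuous C1G) => y yI.
    by have [] := dG y yI.
  by rewrite derive1E; have [_ ->] := dG y yI; exact: sqr_ge0.
have Gy y : y \in `[0, L] -> G y = 0.
  move=> yI; have /andP[y0 yL] : 0 <= y <= L by move: yI; rewrite in_itv.
  have I0 : 0 \in `[0, L] by rewrite in_itv/= lexx ltW.
  have IL : L \in `[0, L] by rewrite in_itv/= lexx ltW.
  by apply/le_anti; rewrite -{1}GL -G0 !mono.
have := dG x xI; have := is_derive_cst (0 : R) x 1.
move=> [_ D0] [_ DG]; apply/eqP; rewrite -sqrf_eq0 -DG -D0; apply/eqP.
apply: near_eq_derive.
by near=> y; apply: Gy; apply: itv_oo_cc; near: y; exact: near_in_itvoo.
Unshelve. all: by end_near. Qed.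

End C1_primitives.

(** * Weak solutions of the static problem *)

Section du_bois_reymond.
Context {R : realType}.
Notation mu := (@lebesgue_measure R).
Implicit Types (L x c : R) (F G f k g u U w : R -> R).

Lemma Rintegral_itv_cst L c : 0 < L -> \int[mu]_(x in `[0, L]) c = c * L.
Proof.
move=> L0; rewrite Rintegral_cst; last exact: measurable_itv.
by rewrite /= lebesgue_measure_itv/= lte_fin L0 oppr0 adde0.
Qed.

Lemma ae_neq c : {ae mu, forall x, x != c}.
Proof.
exists [set c]; split => //; first exact: lebesgue_measure_set1.
by move=> x /= /negP; rewrite negbK => /eqP.
Qed.

(** By Lebesgue differentiation [u] is almost everywhere the derivative of its integral from [0]. On
    the open interval that integral is the constant [- U 0]; the two endpoints form a null set. *)
Lemma primitive_on_eq0 L U u : 0 < L -> primitive_on L U u ->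
  (forall x, x \in `]0, L[ -> U x = 0) ->
  {ae mu, forall x, x \in `[0, L] -> u x = 0}.
Proof.
move=> L0 [iu UE] U0.
have iT : mu.-integrable setT (EFin \o (u \_ `[0, L])).
  have mI : measurable (`[0, L]%classic : set (measurableTypeR R)) by exact: measurable_itv.
  by rewrite -restrict_EFin; exact: ((integrable_mkcond _ mI).1 iu).
have locu : locally_integrable [set: R] (u \_ `[0, L]).
  by apply: integrable_locally => //; exact: measurable_itv.
have iy y : mu.-integrable [set` Interval (BLeft 0) (BRight y)] (EFin \o (u \_ `[0, L])).
  by apply: integrableS iT => //; exact: measurable_itv.
have := FTC1 iy locu; set V := fun x : R => _ => ftc.
refine (@filterS3 _ (almost_everywhere mu) (ae_filter_ringOfSetsType mu) _ _ _ _
  _ (ae_neq 0) (ae_neq L) ftc).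
move=> x x0 xL dV xI.
have xI' : x \in `]0, L[.
  move: xI; rewrite !in_itv/= => /andP[x0' xL'].
  by rewrite !lt_neqAle x0' xL' xL eq_sym x0.
have x0' : (BLeft (0 : R)%R < BRight x)%E.
  by rewrite (@lte_fin R); move: xI'; rewrite in_itv/= => /andP[].
have [_] := dV x0'; rewrite patchE mem_set// => <-; rewrite derive1E.
transitivity ('D_1 (cst (- U 0)) x : R); last by rewrite derive_cst.
apply: near_eq_derive; near=> y.
have yI : y \in `]0, L[ by near: y; exact: near_in_itvoo.
have yI' := itv_oo_cc yI.
have := UE y yI'; rewrite U0// => /eqP; rewrite eq_sym addrC addr_eq0 => /eqP <-.
apply: eq_Rintegral => t; rewrite inE/= in_itv/= => /andP[t0 ty].
rewrite patchE mem_set//= in_itv/= t0 (le_trans ty)//.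
by move: yI; rewrite in_itv/= => /andP[_ /ltW].
Unshelve. all: by end_near. Qed.

Lemma C1_onD L F f G g : C1_on L F f -> C1_on L G g ->
  C1_on L (fun x => F x + G x) (fun x => f x + g x).
Proof.
move=> [dF cf] [dG cg]; split=> [x xI|x].
  by apply: is_derive_withinD; [exact: dF|exact: dG].
by apply: cvgD; [exact: cf|exact: cg].
Qed.

Lemma C1_onM L F f G g : C1_on L F f -> C1_on L G g ->
  C1_on L (fun x => F x * G x) (fun x => f x * G x + F x * g x).
Proof.
move=> C1F C1G; have cF := C1_on_continuous C1F; have cG := C1_on_continuous C1G.
have [dF cf] := C1F; have [dG cg] := C1G; split=> [x xI|x].
  by apply: is_derive_withinM; [exact: dF|exact: dG].
by apply: cvgD; apply: cvgM; [exact: cf|exact: cG|exact: cF|exact: cg].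
Qed.

Lemma C1_on_cst L c : C1_on L (cst c) (cst 0).
Proof.
split=> [x xI|x]; first exact: is_derive_within_cst.
exact: cvg_cst.
Qed.

Lemma C1_on_id L : C1_on L id (cst 1).
Proof.
split=> [x xI|x]; first exact: is_derive_within_id.
exact: cvg_cst.
Qed.

Lemma eq_C1_on L F f f' : (forall x, x \in `[0, L] -> f x = f' x) ->
  C1_on L F f -> C1_on L F f'.
Proof.
move=> ff' [dF cf]; split=> [x xI|]; first by rewrite -ff'//; exact: dF.
by apply: subspace_eq_continuous cf => x /set_mem xI; apply: ff'.
Qed.

Lemma C1_onZ L c F f : C1_on L F f -> C1_on L (fun x => c * F x) (fun x => c * f x).
Proof.
move=> C1F; apply: (eq_C1_on _ (C1_onM (C1_on_cst L c) C1F)) => x _ /=.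
by rewrite mul0r add0r.
Qed.

(** With [K] a primitive of [k], the hypothesis says that [w + K] is orthogonal to [th'] whenever
    [th] vanishes at both ends, so it should equal its mean [c]. The natural test function, the
    primitive [U] of [w + K - c], is only absolutely continuous, whereas [th] must be [C^1]. Hence
    [U] is integrated twice: [th = H - m x] has [th'' = U], and an integration by parts turns the
    orthogonality into a vanishing integral of [U ^+ 2]. *)
Lemma du_bois_reymond L w k : 0 < L ->
  mu.-integrable `[0, L] (EFin \o w) -> mu.-integrable `[0, L] (EFin \o k) ->
  (forall th th', C1_on L th th' -> th 0 = 0 -> th L = 0 ->
    \int[mu]_(x in `[0, L]) (th' x * w x) = \int[mu]_(x in `[0, L]) (th x * k x)) ->
  exists2 F, primitive_on L F (fun x => - k x) &
    {ae mu, forall x, x \in `[0, L] -> w x = F x}.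
Proof.
move=> L0 iw ik weak; have L0' := ltW L0.
have pK := primitive_on_integral ik; set K := fun x : R => _ in pK.
have cK := primitive_on_continuous L0' pK.
have K0 : K 0 = 0 by rewrite /K set_itv1 Rintegral_set1.
have iK := continuous_itv_integrable cK.
(* The mean of [w + K]: subtracting it makes [U] vanish at [L], which removes the boundary terms
   below. *)
pose c := (\int[mu]_(x in `[0, L]) (w x + K x)) / L.
have iwK := itv_integrableD iw iK.
have icst : mu.-integrable `[0, L] (EFin \o cst (- c)).
  by apply: continuous_itv_integrable => x; exact: cvg_cst.
have iu := itv_integrableD iwK icst.
have pU := primitive_on_integral iu; set U := fun x : R => \int[mu]_(t in `[0, x]) _ in pU.
have cU := primitive_on_continuous L0' pU.
have U0 : U 0 = 0 by rewrite /U set_itv1 Rintegral_set1.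
have UL : U L = 0.
  rewrite /U (RintegralD _ iwK icst); last exact: measurable_itv.
  rewrite [X in _ + X](_ : _ = - c * L); last exact: Rintegral_itv_cst.
  by rewrite /c mulNr divfK ?subrr// gt_eqF.
have [eta eta0 C1eta] := exists_C1_primitive L0 cU.
have [H H0 C1H] := exists_C1_primitive L0 (C1_on_continuous C1eta).
(* The linear correction makes [th] vanish at [L], as an admissible test function must. *)
pose m := H L / L.
have C1th := C1_onD C1H (C1_onZ (- m) (C1_on_id L)).
have C1eta' : C1_on L (fun x => eta x + - m * 1) U.
  have := C1_onD C1eta (C1_on_cst L (- m * 1)).
  by apply: eq_C1_on => x _ /=; rewrite addr0.
have th0 : H 0 + - m * 0 = 0 by rewrite H0 mulr0 addr0.
have thL : H L + - m * L = 0 by rewrite /m mulNr divfK ?subrr// gt_eqF.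
have pth := C1_on_primitive L0 C1th; have peta := C1_on_primitive L0 C1eta'.
have ceta := C1_on_continuous C1eta'.
have /= := weak _ _ C1th th0 thL.
rewrite (integral_by_parts L0' pth pK) /= th0 thL !mul0r subrr sub0r => wk.
have int0 := primitive_onE L0' pth; rewrite /= th0 thL subr0 in int0.
have := integral_by_parts L0' peta pU; rewrite U0 UL !mulr0 subrr sub0r.
have -> : \int[mu]_(t in `[0, L]) ((eta t + - m * 1) * (w t + K t + cst (- c) t)) = 0.
  transitivity (\int[mu]_(t in `[0, L]) (((eta t + - m * 1) * w t +
      (eta t + - m * 1) * K t) + - c * (eta t + - m * 1))).
    by apply: eq_Rintegral => t _ /=; ring.
  rewrite RintegralD//; last 2 first.
  - exact: itv_integrableD (integrableM_continuous ceta iw) (integrableM_continuous ceta iK).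
  - exact: itv_integrableZ pth.1.
  rewrite RintegralD//; [|exact: integrableM_continuous..].
  by rewrite wk addNr add0r RintegralZl ?int0 ?mulr0//; exact: pth.1.
move=> /esym/eqP; rewrite oppr_eq0 => /eqP UU.
have {}UU : \int[mu]_(t in `[0, L]) (U t ^+ 2) = 0.
  by rewrite -[RHS]UU; apply: eq_Rintegral => t _; rewrite expr2.
have Uz := integral_sqr_eq0 L0 cU UU.
have u0 := primitive_on_eq0 L0 pU Uz.
exists (fun x => c - K x).
  split; first by apply: eq_itv_integrable (itv_integrableZ (-1) ik) => x _ /=; rewrite mulN1r.
  move=> x xI; rewrite K0 subr0; congr (_ + _).
  have /andP[x0 xL] : 0 <= x <= L by move: xI; rewrite in_itv.
  rewrite -mulN1r -RintegralZl//; last exact: integrable_sub_itv ik (lexx 0) xL.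
  by apply: eq_Rintegral => t _; rewrite mulN1r.
apply: (filterS _ u0); first exact: (ae_filter_ringOfSetsType mu).
move=> x + xI => /(_ xI) /= /eqP.
by rewrite -addrA addr_eq0 => /eqP ->; rewrite opprD opprK addrC.
Qed.

End du_bois_reymond.

(** * Boundary traces of weak solutions *)

Section dissipation.
Context {R : realType}.
Notation mu := (@lebesgue_measure R).
Implicit Types (L x c : R) (F G f k u v w m p : R -> R).

Lemma ae_eq_Rintegral (i : interval R) f g :
  measurable_fun [set` i] f -> measurable_fun [set` i] g ->
  {ae mu, forall x, x \in i -> f x = g x} ->
  \int[mu]_(x in [set` i]) f x = \int[mu]_(x in [set` i]) g x.
Proof.
move=> mf mg fg; rewrite /Rintegral; congr fine; apply: ae_eq_integral.
- exact: measurable_itv.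
- exact/measurable_EFinP.
- exact/measurable_EFinP.
- refine (@filterS _ (almost_everywhere mu) (ae_filter_ringOfSetsType mu) _ _ _ fg).
  by move=> x h xi /=; rewrite h.
Qed.

Section trace.
Variables (L : R) (w1 w2 k1 k2 : R -> R) (c01 c02 cL1 cL2 : R).
Hypothesis L0 : 0 < L.
Hypotheses (iw1 : mu.-integrable `[0, L] (EFin \o w1))
  (iw2 : mu.-integrable `[0, L] (EFin \o w2))
  (ik1 : mu.-integrable `[0, L] (EFin \o k1))
  (ik2 : mu.-integrable `[0, L] (EFin \o k2)).
Hypothesis weak : forall th1 th1' th2 th2', C1_on L th1 th1' -> C1_on L th2 th2' ->
  (forall v1 v2 : R, c01 * v1 + c02 * v2 = 0 -> th1 0 * v1 + th2 0 * v2 = 0) ->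
  (forall v1 v2 : R, cL1 * v1 + cL2 * v2 = 0 -> th1 L * v1 + th2 L * v2 = 0) ->
  \int[mu]_(x in `[0, L]) (th1' x * w1 x + th2' x * w2 x) =
  \int[mu]_(x in `[0, L]) (th1 x * k1 x + th2 x * k2 x).

(** Test functions with one zero component and the other vanishing at both ends give [F1] and [F2]
    by [du_bois_reymond]. Comparing the weak identity with the integration by parts then leaves
    boundary terms only, and a test function equal to the row of boundary coefficients at one end
    and to zero at the other isolates one boundary condition. *)
Lemma weak_trace : exists F1 F2, [/\
  primitive_on L F1 (fun x => - k1 x), primitive_on L F2 (fun x => - k2 x),
  {ae mu, forall x, x \in `[0, L] -> w1 x = F1 x},
  {ae mu, forall x, x \in `[0, L] -> w2 x = F2 x} &
  c01 * F1 0 + c02 * F2 0 = 0 /\ cL1 * F1 L + cL2 * F2 L = 0].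
Proof.
have L0' := ltW L0.
have C0 := C1_on_cst L (0 : R).
have [F1 pF1 w1F1] : exists2 F, primitive_on L F (fun x => - k1 x) &
    {ae mu, forall x, x \in `[0, L] -> w1 x = F x}.
  apply: du_bois_reymond => // th th' C1th th0 thL.
  have z0 (c c' v1 v2 : R) : c * v1 + c' * v2 = 0 -> 0 * v1 + 0 * v2 = 0 :> R.
    by rewrite !mul0r addr0.
  have := weak C1th C0; rewrite th0 thL => /(_ (z0 _ _) (z0 _ _)).
  under eq_Rintegral do rewrite mul0r addr0.
  by under [in RHS]eq_Rintegral do rewrite mul0r addr0.
have [F2 pF2 w2F2] : exists2 F, primitive_on L F (fun x => - k2 x) &
    {ae mu, forall x, x \in `[0, L] -> w2 x = F x}.
  apply: du_bois_reymond => // th th' C1th th0 thL.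
  have z0 (c c' v1 v2 : R) : c * v1 + c' * v2 = 0 -> 0 * v1 + 0 * v2 = 0 :> R.
    by rewrite !mul0r addr0.
  have := weak C0 C1th; rewrite th0 thL => /(_ (z0 _ _) (z0 _ _)).
  under eq_Rintegral do rewrite mul0r add0r.
  by under [in RHS]eq_Rintegral do rewrite mul0r add0r.
have green th1 th1' th2 th2' : C1_on L th1 th1' -> C1_on L th2 th2' ->
  (forall v1 v2 : R, c01 * v1 + c02 * v2 = 0 -> th1 0 * v1 + th2 0 * v2 = 0) ->
  (forall v1 v2 : R, cL1 * v1 + cL2 * v2 = 0 -> th1 L * v1 + th2 L * v2 = 0) ->
  th1 L * F1 L + th2 L * F2 L = th1 0 * F1 0 + th2 0 * F2 0.
  move=> C1 C2 h0 hL; have := weak C1 C2 h0 hL.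
  have [cth1 cth2] := (C1_on_continuous C1, C1_on_continuous C2).
  have [cF1 cF2] := (primitive_on_continuous L0' pF1, primitive_on_continuous L0' pF2).
  have iF1 := continuous_itv_integrable cF1; have iF2 := continuous_itv_integrable cF2.
  have i1 := integrableM_continuous C1.2 iw1; have i2 := integrableM_continuous C2.2 iw2.
  have j1 := integrableM_continuous C1.2 iF1; have j2 := integrableM_continuous C2.2 iF2.
  rewrite !RintegralD//; [|exact: integrableM_continuous..].
  have parts th th' F k : primitive_on L th th' -> primitive_on L F (fun x => - k x) ->
      mu.-integrable `[0, L] (EFin \o k) ->
      \int[mu]_(x in `[0, L]) (th x * k x) =
      \int[mu]_(x in `[0, L]) (th' x * F x) - (th L * F L - th 0 * F 0).
    move=> pth pF ik; have cth := primitive_on_continuous L0' pth.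
    have -> : \int[mu]_(x in `[0, L]) (th x * k x) =
        - \int[mu]_(x in `[0, L]) (th x * - k x).
      rewrite -mulN1r -RintegralZl//; last exact: integrableM_continuous cth pF.1.
      by apply: eq_Rintegral => x _; ring.
    by rewrite (integral_by_parts L0' pth pF) opprB.
  rewrite (parts _ _ _ _ (C1_on_primitive L0 C1) pF1 ik1).
  rewrite (parts _ _ _ _ (C1_on_primitive L0 C2) pF2 ik2).
  have E (th' w F : R -> R) : {within `[0, L], continuous th'} ->
     mu.-integrable `[0, L] (EFin \o w) -> {within `[0, L], continuous F} ->
     {ae mu, forall x, x \in `[0, L] -> w x = F x} ->
     \int[mu]_(x in `[0, L]) (th' x * w x) = \int[mu]_(x in `[0, L]) (th' x * F x).
    move=> cth' iw cF wF; apply: ae_eq_Rintegral.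
    - apply: measurable_funM; first exact: continuous_itv_measurable.
      by apply/measurable_EFinP; exact: measurable_int iw.
    - by apply: measurable_funM; exact: continuous_itv_measurable.
    - refine (@filterS _ (almost_everywhere mu) (ae_filter_ringOfSetsType mu) _ _ _ wF).
      by move=> x h xi /=; rewrite h.
  rewrite (E _ _ _ C1.2 iw1 cF1 w1F1) (E _ _ _ C2.2 iw2 cF2 w2F2).
  by move=> ?; lra.
exists F1, F2; split => //.
(* Affine interpolation: [s = - L^-1], [r = 1] gives the value [c] at [0] and zero at [L];
   [s = L^-1], [r = 0] gives the reverse. *)
have aff (c s r : R) : C1_on L (fun x => c * (s * x + r)) (fun=> c * s).
  have := C1_onZ c (C1_onD (C1_onZ s (C1_on_id L)) (C1_on_cst L r)).
  by apply: eq_C1_on => x _ /=; rewrite mulr1 addr0.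
have Ln0 : L != 0 by rewrite gt_eqF.
split.
- have := green _ _ _ _ (aff c01 (- L^-1) 1) (aff c02 (- L^-1) 1).
  rewrite mulr0 add0r !mulr1 mulNr mulVf// addNr !mulr0 !mul0r addr0 => h; apply/esym; apply: h => //.
  by move=> v1 v2 _; rewrite !mul0r addr0.
- have := green _ _ _ _ (aff cL1 L^-1 0) (aff cL2 L^-1 0).
  rewrite mulr0 addr0 mulVf// addr0 !mulr0 !mul0r !mulr1 addr0; apply => //.
  by move=> v1 v2 _; rewrite !mul0r addr0.
Qed.

End trace.

End dissipation.

(** * The energy balance of the static problem *)

Section energy.
Context {R : realType}.
Notation mu := (@lebesgue_measure R).
Implicit Types (L x c : R) (F G f k u v w m p : R -> R).

(** [u^T P v] for the symmetric matrix [P] with entries [p11], [p12], [p22]; working with scalar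
    entries postpones the matrix algebra to the final theorem. *)
Definition bform (p11 p12 p22 u1 u2 v1 v2 : R) :=
  p11 * (u1 * v1) + p12 * (u1 * v2 + u2 * v1) + p22 * (u2 * v2).

Notation sqint L := (square_integrable mu `[0, L]).

Lemma integrable_pairing L u v : sqint L u -> sqint L v ->
  mu.-integrable `[0, L] (EFin \o (fun x => u x * v x)).
Proof. by move=> su sv; apply: square_integrableM su sv; exact: measurable_itv. Qed.

Lemma integrable_bform L p11 p12 p22 u1 u2 v1 v2 :
  {within `[0, L], continuous p11} -> {within `[0, L], continuous p12} ->
  {within `[0, L], continuous p22} ->
  sqint L u1 -> sqint L u2 -> sqint L v1 -> sqint L v2 ->
  mu.-integrable `[0, L] (EFin \o (fun x =>
    bform (p11 x) (p12 x) (p22 x) (u1 x) (u2 x) (v1 x) (v2 x))).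
Proof.
move=> c11 c12 c22 su1 su2 sv1 sv2; apply: itv_integrableD.
  apply: itv_integrableD; apply: integrableM_continuous => //.
    exact: integrable_pairing.
  by apply: itv_integrableD; exact: integrable_pairing.
by apply: integrableM_continuous => //; exact: integrable_pairing.
Qed.

Lemma square_integrable_integrable L u : sqint L u ->
  mu.-integrable `[0, L] (EFin \o u).
Proof.
move=> su; have s1 : sqint L (cst 1).
  split; first exact: measurable_cst.
  by apply: continuous_itv_integrable => x; rewrite /= expr1n; exact: cvg_cst.
by apply: eq_itv_integrable (integrable_pairing su s1) => x _ /=; rewrite mulr1.
Qed.

(** [F^T M F] is absolutely continuous with density [F^T M' F - 2 F^T M k], because [F' = - k] and
    [M] is symmetric. Under the integral [w] may replace [F]; the boundary values make sense only
    for [F]. *)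
Lemma energy_identity L F1 F2 k1 k2 w1 w2 m11 m12 m22 m11' m12' m22' : 0 < L ->
  primitive_on L F1 (fun x => - k1 x) -> primitive_on L F2 (fun x => - k2 x) ->
  {ae mu, forall x, x \in `[0, L] -> w1 x = F1 x} ->
  {ae mu, forall x, x \in `[0, L] -> w2 x = F2 x} ->
  sqint L w1 -> sqint L w2 -> sqint L k1 -> sqint L k2 ->
  C1_on L m11 m11' -> C1_on L m12 m12' -> C1_on L m22 m22' ->
  \int[mu]_(x in `[0, L])
    (bform (m11' x) (m12' x) (m22' x) (w1 x) (w2 x) (w1 x) (w2 x) -
     2 * bform (m11 x) (m12 x) (m22 x) (w1 x) (w2 x) (k1 x) (k2 x)) =
  bform (m11 L) (m12 L) (m22 L) (F1 L) (F2 L) (F1 L) (F2 L) -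
  bform (m11 0) (m12 0) (m22 0) (F1 0) (F2 0) (F1 0) (F2 0).
Proof.
move=> L0 pF1 pF2 wF1 wF2 sw1 sw2 sk1 sk2 C11 C12 C22; have L0' := ltW L0.
have p11 := primitive_onM L0' (C1_on_primitive L0 C11) (primitive_onM L0' pF1 pF1).
have p12 := primitive_onM L0' (C1_on_primitive L0 C12)
  (primitive_onD (primitive_onM L0' pF1 pF2) (primitive_onM L0' pF2 pF1)).
have p22 := primitive_onM L0' (C1_on_primitive L0 C22) (primitive_onM L0' pF2 pF2).
have pQ := primitive_onD (primitive_onD p11 p12) p22.
rewrite /bform -(primitive_onE L0' pQ); apply: ae_eq_Rintegral.
- apply/measurable_EFinP.
  have h1 := integrable_bform C11.2 C12.2 C22.2 sw1 sw2 sw1 sw2.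
  have h2 := itv_integrableZ (- 2) (integrable_bform (C1_on_continuous C11)
    (C1_on_continuous C12) (C1_on_continuous C22) sw1 sw2 sk1 sk2).
  have := measurable_int _ (itv_integrableD h1 h2).
  by congr measurable_fun; apply/funext => x /=; congr EFin; rewrite /bform; ring.
- by apply/measurable_EFinP; exact: measurable_int pQ.1.
- refine (@filterS2 _ (almost_everywhere mu) (ae_filter_ringOfSetsType mu) _ _ _ _ wF1 wF2).
  by move=> x h1 h2 xI /=; rewrite h1// h2//; ring.
Qed.

(** Since [k] stands for [- w_x], the right-hand side of the last hypothesis is
    [- (w^T M w)_x - nu w^T P w]. Its first term integrates to the form of [M] at [0] minus that at
    [L], which the two sign hypotheses make nonpositive. *)
Lemma dissipation L w1 w2 (d1 d2 : R -> R) k1 k2 (c01 c02 cL1 cL2 nu : R)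
    m11 m12 m22 m11' m12' m22' p11 p12 p22 : 0 < L ->
  sqint L w1 -> sqint L w2 -> sqint L d1 -> sqint L d2 -> sqint L k1 -> sqint L k2 ->
  C1_on L m11 m11' -> C1_on L m12 m12' -> C1_on L m22 m22' ->
  {within `[0, L], continuous p11} -> {within `[0, L], continuous p12} ->
  {within `[0, L], continuous p22} ->
  (forall th1 th1' th2 th2', C1_on L th1 th1' -> C1_on L th2 th2' ->
    (forall v1 v2 : R, c01 * v1 + c02 * v2 = 0 -> th1 0 * v1 + th2 0 * v2 = 0) ->
    (forall v1 v2 : R, cL1 * v1 + cL2 * v2 = 0 -> th1 L * v1 + th2 L * v2 = 0) ->
    \int[mu]_(x in `[0, L]) (th1' x * w1 x + th2' x * w2 x) =
    \int[mu]_(x in `[0, L]) (th1 x * k1 x + th2 x * k2 x)) ->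
  (forall v1 v2 : R, c01 * v1 + c02 * v2 = 0 ->
    bform (m11 0) (m12 0) (m22 0) v1 v2 v1 v2 <= 0) ->
  (forall v1 v2 : R, cL1 * v1 + cL2 * v2 = 0 ->
    0 <= bform (m11 L) (m12 L) (m22 L) v1 v2 v1 v2) ->
  (forall x, x \in `[0, L] ->
    2 * bform (p11 x) (p12 x) (p22 x) (w1 x) (w2 x) (d1 x) (d2 x) <=
    2 * bform (m11 x) (m12 x) (m22 x) (w1 x) (w2 x) (k1 x) (k2 x) -
    bform (m11' x) (m12' x) (m22' x) (w1 x) (w2 x) (w1 x) (w2 x) -
    nu * bform (p11 x) (p12 x) (p22 x) (w1 x) (w2 x) (w1 x) (w2 x)) ->
  2 * \int[mu]_(x in `[0, L])
        bform (p11 x) (p12 x) (p22 x) (w1 x) (w2 x) (d1 x) (d2 x) <=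
  - nu * \int[mu]_(x in `[0, L])
        bform (p11 x) (p12 x) (p22 x) (w1 x) (w2 x) (w1 x) (w2 x).
Proof.
move=> L0 sw1 sw2 sd1 sd2 sk1 sk2 C11 C12 C22 cp11 cp12 cp22 weak Q0 QL pt.
have [F1 [F2 [pF1 pF2 wF1 wF2 [F0 FL]]]] := weak_trace L0
  (square_integrable_integrable sw1) (square_integrable_integrable sw2)
  (square_integrable_integrable sk1) (square_integrable_integrable sk2) weak.
have E := energy_identity L0 pF1 pF2 wF1 wF2 sw1 sw2 sk1 sk2 C11 C12 C22.
have iwd := integrable_bform cp11 cp12 cp22 sw1 sw2 sd1 sd2.
have iww := integrable_bform cp11 cp12 cp22 sw1 sw2 sw1 sw2.
have h1 := integrable_bform C11.2 C12.2 C22.2 sw1 sw2 sw1 sw2.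
have h2 := itv_integrableZ (- 2) (integrable_bform (C1_on_continuous C11)
  (C1_on_continuous C12) (C1_on_continuous C22) sw1 sw2 sk1 sk2).
have h3 : mu.-integrable `[0, L] (EFin \o (fun x =>
    bform (m11' x) (m12' x) (m22' x) (w1 x) (w2 x) (w1 x) (w2 x) -
     2 * bform (m11 x) (m12 x) (m22 x) (w1 x) (w2 x) (k1 x) (k2 x))).
  by apply: eq_itv_integrable (itv_integrableD h1 h2) => x _; rewrite mulNr.
rewrite -!RintegralZl//.
apply: (@le_trans _ _ (\int[mu]_(x in `[0, L])
  (- 1 * (bform (m11' x) (m12' x) (m22' x) (w1 x) (w2 x) (w1 x) (w2 x) -
     2 * bform (m11 x) (m12 x) (m22 x) (w1 x) (w2 x) (k1 x) (k2 x)) +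
   - nu * bform (p11 x) (p12 x) (p22 x) (w1 x) (w2 x) (w1 x) (w2 x)))).
  apply: le_Rintegral.
  - exact: measurable_itv.
  - exact: itv_integrableZ.
  - by apply: itv_integrableD; exact: itv_integrableZ.
  - by move=> x xI; apply: le_trans (pt x xI) _; lra.
rewrite RintegralD//; [|exact: itv_integrableZ..].
rewrite gerDr RintegralZl// E.
by have := Q0 _ _ F0; have := QL _ _ FL; lra.
Qed.

End energy.

(** * Decay of averaged curves *)

Section moving_average.
Context {R : realType}.
Notation mu := (@lebesgue_measure R).
Implicit Types (C T t s r h : R) (f : R -> R).

Lemma continuous_integrable_itv (a b : R) f : continuous f ->
  mu.-integrable `[a, b] (EFin \o f).
Proof. by move=> cf; apply: continuous_itv_integrable; exact: continuous_subspaceT. Qed.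

Lemma Rintegral_itv_bound (a b C : R) f : continuous f -> a <= b ->
  (forall x, x \in `[a, b] -> `|f x| <= C) ->
  `|\int[mu]_(x in `[a, b]) f x| <= C * (b - a).
Proof.
move=> cf ab fC; have iF := continuous_integrable_itv a b cf.
apply: le_trans (le_normr_Rintegral _ iF) _; first exact: measurable_itv.
have -> : C * (b - a) = \int[mu]_(x in `[a, b]) C.
  rewrite Rintegral_cst; last exact: measurable_itv.
  rewrite /= lebesgue_measure_itv/= lte_fin; case: ltP => // ba.
  by have -> : b - a = 0 by apply/eqP; rewrite subr_eq0; apply/eqP/le_anti; rewrite ba ab.
apply: le_Rintegral => //.
- exact: integrable_norm.
- by apply: continuous_integrable_itv => x; exact: cvg_cst.
Qed.

Lemma Rintegral_itv_split (a b c : R) f : continuous f -> a <= b -> b <= c ->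
  \int[mu]_(x in `[a, c]) f x =
  \int[mu]_(x in `[a, b]) f x + \int[mu]_(x in `[b, c]) f x.
Proof.
move=> cf ab bc.
have := @Rintegral_itvB R f (BLeft a) (BRight c) b (continuous_integrable_itv a c cf).
rewrite !bnd_simp => /(_ ab bc); rewrite Rintegral_itv_obnd_cbnd; first lra.
apply: (@integrableS _ _ _ mu `[b, c]) => //; first exact: subset_itv_oc_cc.
exact: continuous_integrable_itv.
Qed.

(** By additivity the difference reduces to integrals over [[t, t']] and [[t + h, t' + h]], two
    intervals of length [|t - t'|]; hence the factor [2]. *)
Lemma moving_integral_lipschitz C T h f (t t' : R) : continuous f -> 0 < h ->
  0 <= t -> 0 <= t' -> t + h <= T -> t' + h <= T ->
  (forall x, x \in `[0, T] -> `|f x| <= C) ->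
  `|\int[mu]_(x in `[t, t + h]) f x - \int[mu]_(x in `[t', t' + h]) f x| <=
  2 * C * `|t - t'|.
Proof.
wlog tt : t t' / t <= t'.
  move=> H; have [/H//|/ltW tt] := leP t t'.
  by move=> *; rewrite distrC (distrC t); exact: H.
move=> cf h0 t0 t0' tT tT' fC.
have E1 : \int[mu]_(x in `[t, t' + h]) f x =
  \int[mu]_(x in `[t, t + h]) f x + \int[mu]_(x in `[t + h, t' + h]) f x.
  by apply: Rintegral_itv_split; rewrite ?lerDl ?lerD2r// ltW.
have E2 : \int[mu]_(x in `[t, t' + h]) f x =
  \int[mu]_(x in `[t, t']) f x + \int[mu]_(x in `[t', t' + h]) f x.
  by apply: Rintegral_itv_split; rewrite ?lerDl// ltW.
have B1 : `|\int[mu]_(x in `[t + h, t' + h]) f x| <= C * (t' - t).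
  have -> : t' - t = t' + h - (t + h) by ring.
  apply: Rintegral_itv_bound; rewrite ?lerD2r// => x; rewrite in_itv/= => /andP[h1 h2].
  by apply: fC; rewrite in_itv/=; apply/andP; split; lra.
have B2 : `|\int[mu]_(x in `[t, t']) f x| <= C * (t' - t).
  apply: Rintegral_itv_bound => // x; rewrite in_itv/= => /andP[h1 h2].
  by apply: fC; rewrite in_itv/=; apply/andP; split; lra.
rewrite distrC (_ : _ - _ = \int[mu]_(x in `[t + h, t' + h]) f x -
  \int[mu]_(x in `[t, t']) f x); last by lra.
apply: le_trans (ler_normB _ _) _.
by rewrite (distrC t) (@ger0_norm _ (t' - t)) ?subr_ge0//; lra.
Qed.

Lemma moving_integral_derive h f t : continuous f -> 0 < h -> 0 < t ->
  is_derive t 1 (fun t => \int[mu]_(x in `[t, t + h]) f x) (f (t + h) - f t).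
Proof.
move=> cf h0 t0.
pose Phi u := \int[mu]_(x in `[0, u]) f x.
have dPhi (u : R) : 0 < u -> is_derive u 1 Phi (f u).
  move=> u0; have [dP PE] : derivable Phi u 1 /\ derive1 Phi u = f u.
    apply: (@continuous_FTC1_closed _ _ 0 u (u + 1)) => //.
    - by rewrite ltrDl.
    - exact: continuous_integrable_itv.
    - exact: cf.
  by apply: DeriveDef => //; rewrite -derive1E PE.
have d1 : is_derive t 1 (fun t => Phi (t + h)) (f (t + h)).
  have dth : is_derive t 1 (fun u : R => u + h) (1 + 0).
    exact: is_deriveD.
  have th0 : 0 < t + h by rewrite addr_gt0.
  have := @is_derive1_comp _ _ (fun u => u + h) _ _ _ (dPhi _ th0) dth.
  by rewrite addr0 mulr1.
have := is_deriveB d1 (dPhi t t0).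
apply: near_eq_is_derive; near=> u.
have u0 : 0 <= u by apply: ltW; near: u; exact: lt_nbhsr.
change (Phi (u + h) - Phi u = \int[mu]_(x in `[u, u + h]) f x).
rewrite /Phi (@Rintegral_itv_split 0 u (u + h))//; last by rewrite lerDl ltW.
by rewrite addrAC subrr add0r.
Unshelve. all: by end_near. Qed.

Lemma is_derive_quadratic_remainder (K : R) f (t : R) :
  (\forall s \near t, `|f s - f t| <= K * `|s - t| ^+ 2) -> is_derive t 1 f 0.
Proof.
move=> fK; apply/is_derive1_caratheodory.
exists (fun s => (f s - f t) / (s - t)); split => [s||].
- have [->|st] := eqVneq s t; first by rewrite !subrr mulr0.
  by rewrite divfK// subr_eq0.
- have c0 : (`|K| * `|s - t|) @[s --> t] --> (0 : R).
    rewrite [X in _ --> X](_ : 0 = `|K| * `|t - t|); last by rewrite subrr normr0 mulr0.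
    apply: cvgM; first exact: cvg_cst.
    by apply: cvg_norm; apply: cvgB; [exact: cvg_id|exact: cvg_cst].
  rewrite /prop_for /continuous_at subrr mul0r.
  apply: (@squeeze_cvgr _ _ _ _ (fun s => - (`|K| * `|s - t|)) (fun s => `|K| * `|s - t|)).
  + near=> s; rewrite -ler_norml normrM normfV.
    have [->|st] := eqVneq s t; first by rewrite !subrr normr0 invr0 !mulr0.
    rewrite ler_pdivrMr ?normr_gt0 ?subr_eq0// -mulrA -expr2.
    apply: (@le_trans _ _ (K * `|s - t| ^+ 2)); first by near: s.
    by rewrite ler_wpM2r ?exprn_ge0// ler_norm.
  + have c0N : - (`|K| * `|s - t|) @[s --> t] --> (- 0 : R) by exact: cvgN.
    by rewrite oppr0 in c0N; exact: c0N.
  + exact: c0.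
- by rewrite subrr mul0r.
Unshelve. all: by end_near. Qed.

End moving_average.

(** * From the decay of double averages to the decay on the diagonal *)

Section steklov_decay.
Context {R : realType}.
Notation mu := (@lebesgue_measure R).
Variables (G : R -> R -> R) (J : R -> R -> R -> R) (nu : R).
(** In the application [G s r = <z(s), z(r)>_P], [J h t s = <z(s), w(t)>_P] and
    [W h t t' = <w(t), w(t')>_P], where [w(t)] is the integral of [z] over [[t, t + h]]. *)
Let W h t t' := \int[mu]_(s in `[t, t + h]) J h t' s.
Hypothesis cG : continuous (fun p : R * R => G p.1 p.2).
Hypothesis cJ : forall h t : R, 0 < h -> continuous (J h t).
Hypothesis JE : forall h t s : R, 0 < h -> J h t s = \int[mu]_(r in `[t, t + h]) G s r.
Hypothesis WC : forall h t t' : R, 0 < h -> W h t t' = W h t' t.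
Hypothesis W_dissipates : forall h t : R, 0 < h -> 0 < t ->
  2 * (J h t (t + h) - J h t t) <= - nu * W h t t.

Let G_near (s r e : R) : 0 < e ->
  exists2 d, 0 < d & forall s' r', ball s d s' -> ball r d r' -> `|G s r - G s' r'| < e.
Proof.
move=> e0.
have cGsr : (fun p : R * R => G p.1 p.2) @ ((s, r) : R * R) --> G s r by exact: (@cG (s, r)).
move/cvgrPdist_lt : cGsr => /(_ e e0)/nbhs_ballP[d /= d0 dG].
by exists d => // s' r' ss' rr'; exact: (dG (s', r')).
Qed.

Let cGs s : continuous (G s).
Proof.
move=> r; apply/cvgrPdist_lt => e e0.
have [d d0 dG] := G_near s r e0.
near=> r'; apply: dG; first exact: ballxx.
by near: r'; exact: (@nbhsx_ballx _ _ (r : R) d d0).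
Unshelve. all: by end_near. Qed.

Let G_bounded (T : R) : exists C : R, forall s r : R, s \in `[0, T] -> r \in `[0, T] -> `|G s r| <= C.
Proof.
have [T0|T0] := leP 0 T; last first.
  by exists 0 => s r; rewrite in_itv/= => /andP[/le_trans h /h]; rewrite leNgt T0.
have cN : continuous (fun p : R * R => `|G p.1 p.2|).
  by move=> p; apply: cvg_norm; exact: (@cG p).
have ne : (`[0, T]%classic `*` `[0, T]%classic : set (R * R)) !=set0.
  by exists (0, 0); split; rewrite /= in_itv/= lexx.
have cpt : compact (`[0, T]%classic `*` `[0, T]%classic : set (R * R)).
  by apply: (@compact_setX R R); exact: segment_compact.
have [c _ cmax] := compact_EVT_max ne cpt (continuous_subspaceT cN).
exists (`|G c.1 c.2|) => s r sT rT.
by apply: (cmax (s, r)); rewrite inE.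
Qed.

(** By symmetry [rm t - rm t0] is the second difference [W h t t - 2 * W h t t0 + W h t0 t0], in the
    application the squared norm of [w(t) - w(t0)]. Averages being Lipschitz in [t], it is quadratic
    in [t - t0] and contributes nothing to the derivative; what remains is twice the derivative of
    [W h t t0], a moving integral in [t]. Continuity of [G] suffices for this. *)
Let W_derive (h t0 : R) : 0 < h -> 0 < t0 ->
  is_derive t0 1 (fun t => W h t t) (2 * (J h t0 (t0 + h) - J h t0 t0)).
Proof.
move=> h0 t00; pose rm t := W h t t - 2 * W h t t0.
have [C GC] := G_bounded (t0 + 1 + h).
have drm : is_derive t0 1 rm 0.
  (* [4 * C] is [2 * (2 * C)]: the Lipschitz estimate is applied once in each variable of [G], which
     [C] bounds on the square reached as long as [t < t0 + 1]. *)
  apply: (@is_derive_quadratic_remainder _ (4 * C)); near=> t.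
  have tp : 0 < t by near: t; exact: lt_nbhsr.
  have t1 : t < t0 + 1 by near: t; apply: lt_nbhsl; rewrite ltrDl.
  have JJ s : s \in `[0, t0 + 1 + h] -> `|J h t s - J h t0 s| <= 2 * C * `|t - t0|.
    move=> sT; rewrite !JE//.
    apply: (@moving_integral_lipschitz _ C (t0 + 1 + h)) => //; try lra.
    by move=> r rT; exact: GC.
  have := @moving_integral_lipschitz _ (2 * C * `|t - t0|) (t0 + 1 + h) h
    (fun s => J h t s - J h t0 s) t t0.
  have cJJ : continuous (fun s => J h t s - J h t0 s).
    by move=> s; apply: cvgB; exact: cJ.
  move=> /(_ cJJ h0); rewrite !RintegralB; try exact: measurable_itv;
    try (apply: continuous_integrable_itv; exact: cJ).
  rewrite -!/(W _ _ _) (WC t0 t)// => H.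
  have -> : rm t - rm t0 = W h t t - W h t t0 - (W h t t0 - W h t0 t0).
    by rewrite /rm; ring.
  by rewrite expr2 mulrA (_ : 4 * C * _ = 2 * (2 * C * `|t - t0|)); [apply: H => //; lra|ring].
have d2 := moving_integral_derive (@cJ h t0 h0) h0 t00.
have := is_deriveD drm (is_deriveZ 2 d2); rewrite add0r.
apply: near_eq_is_derive; near=> t.
by rewrite /rm /W !fctE /= /GRing.scale/=; ring.
Unshelve. all: by end_near. Qed.

Let W_decay (h t0 t : R) : 0 < h -> 0 < t0 -> t0 <= t ->
  W h t t <= expR (- nu * (t - t0)) * W h t0 t0.
Proof.
move=> h0 t00 tt.
(* Integrating factor: the dissipation inequality makes the derivative of [E] nonpositive. *)
pose E s := W h s s * expR (nu * s).
have dE (s : R) : 0 < s -> is_derive s 1 E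
    ((2 * (J h s (s + h) - J h s s) + nu * W h s s) * expR (nu * s)).
  move=> s0.
  have dX : is_derive s 1 (fun s => expR (nu * s)) (expR (nu * s) * nu).
    have dm : is_derive s 1 (fun u : R => nu * u) nu.
      by have := is_deriveZ nu (is_derive_id s (1 : R)); rewrite /GRing.scale/= mulr1.
    exact: (@is_derive1_comp _ expR (fun u => nu * u) _ _ _ (is_derive_expR _) dm).
  have := is_deriveM (W_derive h0 s0) dX.
  rewrite /GRing.scale/=; congr is_derive; ring.
have mono : {in `]0, t + 1[ &, {homo E : x y /~ x <= y}}.
  apply: ler0_derive1_le_oo => x.
  - by rewrite in_itv/= => /andP[x0 _]; have [] := dE x x0.
  - rewrite in_itv/= => /andP[x0 _]; rewrite derive1E; have [_ ->] := dE x x0.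
    rewrite pmulr_lle0 ?expR_gt0//.
    by have := W_dissipates h0 x0; lra.
  - rewrite inE/= in_itv/= => /andP[x0 _].
    by apply/differentiable_continuous/derivable1_diffP; have [] := dE x x0.
have := mono t t0.
rewrite !in_itv/= t00 (lt_le_trans t00 tt) ltrDl ltr01 /= (le_lt_trans tt) ?ltrDl//.
move=> /(_ isT isT tt); rewrite /E -ler_pdivlMr ?expR_gt0// -mulrA -expRN -expRD.
by rewrite mulrC (_ : nu * t0 + - (nu * t) = - nu * (t - t0)) //; ring.
Qed.

(** [W h t t] is the integral of [G] over a square of side [h] with corner [(t, t)], so continuity
    of [G] makes it close to [h ^+ 2 * G t t]. *)
Let W_diag_cvg (t e : R) : 0 < e ->
  \forall h \near 0^'+, `|W h t t - h ^+ 2 * G t t| <= e * h ^+ 2.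
Proof.
move=> e0.
have [d d0 dG] := G_near t t e0.
near=> h.
have h0 : 0 < h by near: h; exact: nbhs_right_gt.
have hd : h < d by near: h; exact: nbhs_right_lt.
have GB s r : s \in `[t, t + h] -> r \in `[t, t + h] -> `|G s r - G t t| <= e.
  rewrite !in_itv/= => /andP[s1 s2] /andP[r1 r2]; rewrite distrC; apply/ltW/dG.
  by rewrite /ball/= distrC ger0_norm; lra.
  by rewrite /ball/= distrC ger0_norm; lra.
(* Used twice, once in each variable of [G], at the cost of one factor [h] each time. *)
have cB (f : R -> R) (c B : R) : continuous f ->
    (forall x, x \in `[t, t + h] -> `|f x - c| <= B) ->
    `|\int[mu]_(x in `[t, t + h]) f x - h * c| <= B * h.
  move=> cf fB.
  have cfc : continuous (fun x => f x - c).
    by move=> x; apply: cvgB; [exact: cf|exact: cvg_cst].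
  have := Rintegral_itv_bound cfc _ fB; rewrite lerDl (ltW h0) => /(_ isT).
  rewrite RintegralB; try exact: measurable_itv; last 2 first.
  - exact: continuous_integrable_itv.
  - by apply: continuous_integrable_itv => x; exact: cvg_cst.
  rewrite Rintegral_cst; last exact: measurable_itv.
  rewrite /= lebesgue_measure_itv/= lte_fin ltrDl h0 -EFinB/=.
  by rewrite (_ : t + h - t = h) 1?(mulrC c)//; ring.
have -> : e * h ^+ 2 = e * h * h by ring.
have -> : h ^+ 2 * G t t = h * (h * G t t) by ring.
apply: (cB); first exact: cJ.
by move=> s sI; rewrite JE//; apply: cB => // r rI; exact: GB.
Unshelve. all: by end_near. Qed.

Lemma steklov_decay (t0 t : R) : 0 < t0 -> t0 <= t ->
  G t t <= expR (- nu * (t - t0)) * G t0 t0.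
Proof.
move=> t00 tt; set q := expR _.
have q0 : 0 < q by exact: expR_gt0.
apply/ler_addgt0Pr => e e0.
(* With this tolerance the error at [t] and [q] times the error at [t0] add up to [e]. *)
have e0' : 0 < e / (1 + q) by rewrite divr_gt0// addr_gt0.
near (0 : R)^'+ => h.
have h0 : 0 < h by near: h; exact: nbhs_right_gt.
have B1 : `|W h t t - h ^+ 2 * G t t| <= e / (1 + q) * h ^+ 2.
  by near: h; exact: W_diag_cvg.
have B2 : `|W h t0 t0 - h ^+ 2 * G t0 t0| <= e / (1 + q) * h ^+ 2.
  by near: h; exact: W_diag_cvg.
have D := W_decay h0 t00 tt; rewrite -/q in D.
have h20 : 0 < h ^+ 2 by rewrite exprn_gt0.
rewrite -(ler_pM2r h20).
move: B1 B2; rewrite !ler_norml => /andP[B1 _] /andP[_ B2].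
have B3 : q * (W h t0 t0 - h ^+ 2 * G t0 t0) <= q * (e / (1 + q) * h ^+ 2).
  by rewrite ler_pM2l.
have Ee : e / (1 + q) + q * (e / (1 + q)) = e by field; rewrite gt_eqF// addr_gt0.
have -> : (q * G t0 t0 + e) * h ^+ 2 = q * (h ^+ 2 * G t0 t0) +
  (e / (1 + q) * h ^+ 2 + q * (e / (1 + q) * h ^+ 2)).
  by rewrite -[X in _ + X]/_ -{1}Ee; ring.
by rewrite mulrBr in B3; lra.
Unshelve. all: by end_near. Qed.

End steklov_decay.

(** * Continuous curves in [L^2] *)

Section L2_curves.
Context {R : realType}.
Notation mu := (@lebesgue_measure R).
Variable L : R.
Notation I := (`[0, L]%classic : set R).
Notation sqint := (square_integrable mu `[0, L]).
Notation "<< u , v >>" := (pairing mu `[0, L] u v).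
Implicit Types (u v : R -> R -> R) (m p y : R -> R).

Let mI : measurable (`[0, L]%classic : set (measurableTypeR R)).
Proof. exact: measurable_itv. Qed.

Definition L2_continuous u := (forall s : R, sqint (u s)) /\
  forall t : R, << (fun x => u s x - u t x), (fun x => u s x - u t x) >>
    @[s --> t] --> (0 : R).

Lemma L2_continuous_cst y : sqint y -> L2_continuous (fun=> y).
Proof.
move=> sy; split => // t.
rewrite (_ : (fun s => _) = cst 0); first exact: cvg_cst.
apply/funext => s; rewrite /pairing.
under eq_Rintegral do rewrite subrr mul0r.
by rewrite Rintegral_cst// mul0r.
Qed.

Lemma normr_pairing_le (f g : R -> R) : sqint f -> sqint g ->
  `|<< f, g >>| <= Num.sqrt << f, f >> * Num.sqrt << g, g >>.
Proof.
move=> sf sg; rewrite -sqrtrM ?pairing_ge0// -sqrtr_sqr ler_wsqrtr//.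
exact: pairing_cauchy_schwarz.
Qed.

Lemma L2_continuous_weight m u : {within `[0, L], continuous m} ->
  L2_continuous u -> L2_continuous (fun s x => m x * u s x).
Proof.
move=> cm [su cu]; have [C mC] := continuous_itv_bounded cm.
have mm := continuous_itv_measurable cm.
split=> [s|t]; first by apply: (square_integrable_bounded_mul mI mm mC); exact: su.
have h : (C ^+ 2 * << (fun x => u s x - u t x), (fun x => u s x - u t x) >>)
    @[s --> t] --> (0 : R).
  rewrite [X in _ --> X](_ : 0 = C ^+ 2 * 0); last by rewrite mulr0.
  by apply: cvgM; [exact: cvg_cst|exact: cu].
apply: (squeeze_cvgr _ (cvg_cst 0) h); near=> s; rewrite pairing_ge0/=.
have sd : sqint (fun x => u s x - u t x) by exact: square_integrableB.
rewrite /pairing -RintegralZl//; last exact: square_integrableM.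
have smd := square_integrable_bounded_mul mI mm mC sd.
apply: le_Rintegral => //.
- apply: eq_itv_integrable (square_integrableM mI smd smd) => x _ /=.
  by rewrite mulrBr.
- by apply: itv_integrableZ; exact: square_integrableM.
- move=> x xI; rewrite -mulrBr mulrACA -!expr2 ler_wpM2r ?sqr_ge0//.
  have := mC x xI; rewrite -(real_normK (num_real (m x))) => mxC.
  by rewrite lerXn2r ?nnegrE// (le_trans _ mxC).
Unshelve. all: by end_near. Qed.

(** The increment of the pairing splits into three terms, each controlled by Cauchy-Schwarz through
    the norm of an increment. [steklov_decay] needs this joint continuity of its kernel. *)
Lemma pairing_continuous u v : L2_continuous u -> L2_continuous v ->
  continuous (fun p : R * R => << u p.1, v p.2 >>).
Proof.
move=> [su cu] [sv cv] [s t] /=.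
pose N u (s0 s : R) := Num.sqrt << (fun x => u s x - u s0 x), (fun x => u s x - u s0 x) >>.
have N0 u' s0 : (forall t : R, << (fun x => u' s x - u' t x), (fun x => u' s x - u' t x) >>
    @[s --> t] --> (0 : R)) -> N u' s0 s' @[s' --> s0] --> (0 : R).
  move=> /(_ s0) h; rewrite -sqrtr0.
  exact: (cvg_comp _ _ h (@sqrt_continuous R 0)).
have Nu : N u s p.1 @[p --> ((s, t) : R * R)] --> (0 : R).
  exact: (cvg_comp _ _ cvg_fst (N0 _ _ cu)).
have Nv : N v t p.2 @[p --> ((s, t) : R * R)] --> (0 : R).
  exact: (cvg_comp _ _ cvg_snd (N0 _ _ cv)).
apply/cvgrPdist_le => e e0.
have B : N u s p.1 * N v t p.2 + N u s p.1 * Num.sqrt << v t, v t >> +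
    Num.sqrt << u s, u s >> * N v t p.2 @[p --> ((s, t) : R * R)] --> (0 : R).
  rewrite [X in _ --> X](_ : 0 = 0 * 0 + 0 * Num.sqrt << v t, v t >> +
    Num.sqrt << u s, u s >> * 0); last by rewrite !mulr0 mul0r !addr0.
  apply: cvgD; first by apply: cvgD; apply: cvgM; [exact: Nu|exact: Nv|exact: Nu|exact: cvg_cst].
  by apply: cvgM; [exact: cvg_cst|exact: Nv].
move/cvgrPdist_le : B => /(_ e e0) B; apply: filterS B => -[s' t'] /=.
rewrite sub0r normrN; apply: le_trans.
have sdu : sqint (fun x => u s' x - u s x) by exact: square_integrableB.
have sdv : sqint (fun x => v t' x - v t x) by exact: square_integrableB.
have -> : << u s, v t >> - << u s', v t' >> =
  - (<< (fun x => u s' x - u s x), (fun x => v t' x - v t x) >> +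
   << (fun x => u s' x - u s x), v t >> + << u s, (fun x => v t' x - v t x) >>).
  by rewrite pairingBr// !pairingBl// pairingBr//; ring.
rewrite normrN (le_trans _ (ler_norm _))//.
apply: le_trans (ler_normD _ _) _; apply: lerD; last exact: normr_pairing_le.
by apply: le_trans (ler_normD _ _) _; apply: lerD; exact: normr_pairing_le.
Qed.

Lemma continuous2_left (G : R -> R -> R) (r : R) :
  continuous (fun p : R * R => G p.1 p.2) -> continuous (G^~ r).
Proof.
by move=> cG s; apply: (cvg_comp2 cvg_id (cvg_cst _) (@cG (s, r))).
Qed.

Lemma continuous2_diag (G : R -> R -> R) :
  continuous (fun p : R * R => G p.1 p.2) -> continuous (fun s => G s s).
Proof.
by move=> cG s; apply: (cvg_comp2 cvg_id cvg_id (@cG (s, s))).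
Qed.

Section averages.
Variable z : R -> R -> R.
Hypothesis cz : L2_continuous z.
Hypothesis mz : forall a b : R, measurable_fun (`[a, b]%classic `*` `[0, L]%classic)
  (fun p : R * R => z p.1 p.2).
Variables a b : R.
Hypothesis ab : a <= b.

Let z_bounded : exists C, forall s, `[a, b]%classic s ->
  sqint (z s) /\ << z s, z s >> <= C.
Proof.
have cn := @continuous2_diag (fun s r => << z s, z r >>) (pairing_continuous cz cz).
have [C zC] := continuous_itv_bounded (continuous_subspaceT cn : {within `[a, b], continuous _}).
exists C => s sab; split; first exact: cz.1.
exact: le_trans (ler_norm _) (zC s sab).
Qed.

Let itv_lty (c e : R) : (mu `[c, e] < +oo)%E.
Proof. by rewrite lebesgue_measure_itv/=; case: ifP => // _; rewrite -EFinB ltry. Qed.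

Let mab : measurable (`[a, b]%classic : set (measurableTypeR R)).
Proof. exact: measurable_itv. Qed.

Definition time_average := average mu `[a, b] z.

Lemma time_average_square_integrable : sqint time_average.
Proof.
have [C zC] := z_bounded.
exact: (average_square_integrable mab mI (itv_lty a b) (itv_lty 0 L) (@mz a b) zC).
Qed.

Lemma pairing_time_average y : sqint y ->
  << time_average, y >> = \int[mu]_(s in `[a, b]) << z s, y >>.
Proof.
move=> sy; have [C zC] := z_bounded.
exact: (pairing_average mab mI (itv_lty a b) (itv_lty 0 L) (@mz a b) zC sy).
Qed.

End averages.
End L2_curves.

(** * The weighted energy of a continuous curve *)

Section energy_decay.
Context {R : realType}.
Notation mu := (@lebesgue_measure R).
Variable L : R.
Notation sqint := (square_integrable mu `[0, L]).
Notation "<< u , v >>" := (pairing mu `[0, L] u v).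
Variables p11 p12 p22 : R -> R.
Hypotheses (cp11 : {within `[0, L], continuous p11})
  (cp12 : {within `[0, L], continuous p12})
  (cp22 : {within `[0, L], continuous p22}).

Definition energy_form (u1 u2 v1 v2 : R -> R) := \int[mu]_(x in `[0, L])
  bform (p11 x) (p12 x) (p22 x) (u1 x) (u2 x) (v1 x) (v2 x).

Lemma energy_formC u1 u2 v1 v2 :
  energy_form u1 u2 v1 v2 = energy_form v1 v2 u1 u2.
Proof. by apply: eq_Rintegral => x _; rewrite /bform; ring. Qed.

Lemma weight_square_integrable (m u : R -> R) : {within `[0, L], continuous m} ->
  sqint u -> sqint (fun x => m x * u x).
Proof.
move=> cm su; have [C mC] := continuous_itv_bounded cm.
have mI : measurable (`[0, L]%classic : set (measurableTypeR R)) by exact: measurable_itv.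
exact: (square_integrable_bounded_mul mI (continuous_itv_measurable cm) mC su).
Qed.

(** Moving the weights onto the second argument reduces the form to scalar pairings, for which
    continuity and exchange with time averages are already known. *)
Lemma energy_form_pairing u1 u2 v1 v2 :
  sqint u1 -> sqint u2 -> sqint v1 -> sqint v2 ->
  energy_form u1 u2 v1 v2 =
  << u1, (fun x => p11 x * v1 x) >> + << u1, (fun x => p12 x * v2 x) >> +
  << u2, (fun x => p12 x * v1 x) >> + << u2, (fun x => p22 x * v2 x) >>.
Proof.
move=> su1 su2 sv1 sv2.
have i1 := integrable_pairing su1 (weight_square_integrable cp11 sv1).
have i2 := integrable_pairing su1 (weight_square_integrable cp12 sv2).
have i3 := integrable_pairing su2 (weight_square_integrable cp12 sv1).
have i4 := integrable_pairing su2 (weight_square_integrable cp22 sv2).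
have mI : measurable (`[0, L]%classic : set (measurableTypeR R)) by exact: measurable_itv.
rewrite /pairing -(RintegralD mI i1 i2) -(RintegralD mI (itv_integrableD i1 i2) i3).
rewrite -(RintegralD mI (itv_integrableD (itv_integrableD i1 i2) i3) i4).
by apply: eq_Rintegral => x _; rewrite /bform; ring.
Qed.

Variables z1 z2 : R -> R -> R.
Hypotheses (cz1 : L2_continuous L z1) (cz2 : L2_continuous L z2).
Hypothesis mz1 : forall a b : R, measurable_fun (`[a, b]%classic `*` `[0, L]%classic)
  (fun p : R * R => z1 p.1 p.2).
Hypothesis mz2 : forall a b : R, measurable_fun (`[a, b]%classic `*` `[0, L]%classic)
  (fun p : R * R => z2 p.1 p.2).

Let w1 (h t : R) := time_average z1 t (t + h).
Let w2 (h t : R) := time_average z2 t (t + h).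

Let sw1 h t : 0 < h -> sqint (w1 h t).
Proof. by move=> h0; apply: time_average_square_integrable => //; rewrite lerDl ltW. Qed.

Let sw2 h t : 0 < h -> sqint (w2 h t).
Proof. by move=> h0; apply: time_average_square_integrable => //; rewrite lerDl ltW. Qed.

Lemma energy_form_continuous u1 u2 v1 v2 :
  L2_continuous L u1 -> L2_continuous L u2 ->
  L2_continuous L v1 -> L2_continuous L v2 ->
  continuous (fun p : R * R => energy_form (u1 p.1) (u2 p.1) (v1 p.2) (v2 p.2)).
Proof.
move=> cu1 cu2 cv1 cv2.
rewrite (_ : (fun p => _) = fun p : R * R =>
  << u1 p.1, (fun x => p11 x * v1 p.2 x) >> + << u1 p.1, (fun x => p12 x * v2 p.2 x) >> +
  << u2 p.1, (fun x => p12 x * v1 p.2 x) >> + << u2 p.1, (fun x => p22 x * v2 p.2 x) >>).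
  have c1 := pairing_continuous cu1 (L2_continuous_weight cp11 cv1).
  have c2 := pairing_continuous cu1 (L2_continuous_weight cp12 cv2).
  have c3 := pairing_continuous cu2 (L2_continuous_weight cp12 cv1).
  have c4 := pairing_continuous cu2 (L2_continuous_weight cp22 cv2).
  move=> p; apply: cvgD; last exact: c4.
  by apply: cvgD; last exact: c3; apply: cvgD; [exact: c1|exact: c2].
apply/funext => p; apply: energy_form_pairing.
- exact: cu1.1.
- exact: cu2.1.
- exact: cv1.1.
- exact: cv2.1.
Qed.

Lemma energy_form_curve_continuous u1 u2 y1 y2 :
  L2_continuous L u1 -> L2_continuous L u2 -> sqint y1 -> sqint y2 ->
  continuous (fun s => energy_form (u1 s) (u2 s) y1 y2).
Proof.
move=> cu1 cu2 sy1 sy2.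
have := energy_form_continuous cu1 cu2 (L2_continuous_cst sy1) (L2_continuous_cst sy2).
exact: (@continuous2_left _ (fun s _ => energy_form (u1 s) (u2 s) y1 y2) 0).
Qed.

Lemma energy_form_average h t y1 y2 : 0 < h -> sqint y1 -> sqint y2 ->
  energy_form (w1 h t) (w2 h t) y1 y2 =
  \int[mu]_(s in `[t, t + h]) energy_form (z1 s) (z2 s) y1 y2.
Proof.
move=> h0 sy1 sy2; have th : t <= t + h by rewrite lerDl ltW.
have sy11 := weight_square_integrable cp11 sy1.
have sy12 := weight_square_integrable cp12 sy2.
have sy21 := weight_square_integrable cp12 sy1.
have sy22 := weight_square_integrable cp22 sy2.
rewrite energy_form_pairing//; [|exact: sw1|exact: sw2].
rewrite /w1 /w2 !pairing_time_average//.
have ic (u : R -> R -> R) y : L2_continuous L u -> sqint y ->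
    mu.-integrable `[t, t + h] (EFin \o (fun s => << u s, y >>)).
  move=> cu sy; apply: continuous_integrable_itv.
  have := pairing_continuous cu (L2_continuous_cst sy).
  exact: (@continuous2_left _ (fun s _ => << u s, y >>) 0).
have mT : measurable (`[t, t + h]%classic : set (measurableTypeR R)).
  exact: measurable_itv.
have i1 := ic _ _ cz1 sy11; have i2 := ic _ _ cz1 sy12.
have i3 := ic _ _ cz2 sy21; have i4 := ic _ _ cz2 sy22.
rewrite -(RintegralD mT i1 i2) -(RintegralD mT (itv_integrableD i1 i2) i3).
rewrite -(RintegralD mT (itv_integrableD (itv_integrableD i1 i2) i3) i4).
by apply: eq_Rintegral => s _; rewrite energy_form_pairing//; [exact: cz1.1|exact: cz2.1].
Qed.

Variable nu : R.
Hypothesis average_dissipates : forall h t : R, 0 < h -> 0 < t ->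
  2 * energy_form (time_average z1 t (t + h)) (time_average z2 t (t + h))
        (fun x => z1 (t + h) x - z1 t x) (fun x => z2 (t + h) x - z2 t x) <=
  - nu * energy_form (time_average z1 t (t + h)) (time_average z2 t (t + h))
           (time_average z1 t (t + h)) (time_average z2 t (t + h)).

Lemma energy_decay (t0 t : R) : 0 < t0 -> t0 <= t ->
  energy_form (z1 t) (z2 t) (z1 t) (z2 t) <=
  expR (- nu * (t - t0)) * energy_form (z1 t0) (z2 t0) (z1 t0) (z2 t0).
Proof.
have WE h r r' : 0 < h -> energy_form (w1 h r) (w2 h r) (w1 h r') (w2 h r') =
    \int[mu]_(s in `[r, r + h]) energy_form (z1 s) (z2 s) (w1 h r') (w2 h r').
  by move=> h0; apply: energy_form_average => //; [exact: sw1|exact: sw2].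
apply: (@steklov_decay _ (fun s r => energy_form (z1 s) (z2 s) (z1 r) (z2 r))
  (fun h t s => energy_form (z1 s) (z2 s) (w1 h t) (w2 h t))).
- exact: energy_form_continuous.
- move=> h t' h0; apply: energy_form_curve_continuous => //; [exact: sw1|exact: sw2].
- move=> h t' s h0; apply: etrans (energy_formC _ _ _ _) _.
  apply: etrans (energy_form_average t' h0 (cz1.1 s) (cz2.1 s)) _.
  by apply: eq_Rintegral => r _; exact: energy_formC.
- move=> h r r' h0; apply: etrans (esym (WE h r r' h0)) _.
  by apply: etrans (energy_formC _ _ _ _) _; exact: WE.
(* By bilinearity [J h r (r + h) - J h r r] is the form evaluated at the average and the increment
   [z(r + h) - z(r)], the quantity that [average_dissipates] bounds. *)
- move=> h r h0 r0; rewrite -(WE h r r h0).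
  apply: le_trans (average_dissipates h0 r0).
  rewrite ler_pM2l// -/(w1 h r) -/(w2 h r) [X in _ <= X]energy_formC.
  have sw1' := @sw1 h r h0; have sw2' := @sw2 h r h0.
  rewrite -RintegralB; first last.
  - by apply: integrable_bform => //; [exact: cz1.1|exact: cz2.1].
  - by apply: integrable_bform => //; [exact: cz1.1|exact: cz2.1].
  - exact: measurable_itv.
  by rewrite le_eqVlt; apply/orP; left; apply/eqP; apply: eq_Rintegral => x _; rewrite /bform /w1 /w2; ring.
Qed.

End energy_decay.

(** * Weak solutions of the evolution problem *)

Section weak_form.
Context {R : realType}.
Notation mu := (@lebesgue_measure R).
Notation sqint L := (square_integrable mu `[0, L]).

Definition col2 (u v : R) : 'cV[R]_2 := \col_(i < 2) if i == 0 then u else v.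

Lemma dotcvE (u v : 'cV[R]_2) : dotcv u v = u 0 0 * v 0 0 + u 1 0 * v 1 0.
Proof.
rewrite /dotcv !mxE !big_ord_recl big_ord0 addr0 !mxE.
by congr (_ * _ + _ * _); congr (_ _ _); apply/val_inj.
Qed.

Lemma mx22_mul_col (m00 m01 m10 m11 : R) (v : 'cV[R]_2) :
  ((mx22 m00 m01 m10 m11 *m v) 0 0 = m00 * v 0 0 + m01 * v 1 0) *
  ((mx22 m00 m01 m10 m11 *m v) 1 0 = m10 * v 0 0 + m11 * v 1 0).
Proof.
have E : lift ord0 ord0 = 1 :> 'I_2 by apply/val_inj.
by split; rewrite !mxE !big_ord_recl big_ord0 addr0 !mxE /= E.
Qed.

Lemma mx22_tr (m00 m01 m10 m11 : R) : (mx22 m00 m01 m10 m11)^T = mx22 m00 m10 m01 m11.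
Proof.
apply/matrixP => i j; rewrite !mxE.
by case: i => -[|[|//]] ?; case: j => -[|[|//]] ?.
Qed.

Lemma row2_mul_col (c1 c2 : R) (v : 'cV[R]_2) :
  row2 c1 c2 *m v = 0 <-> c1 * v 0 0 + c2 * v 1 0 = 0.
Proof.
have E : lift ord0 ord0 = 1 :> 'I_2 by apply/val_inj.
have mE : (row2 c1 c2 *m v) 0 0 = c1 * v 0 0 + c2 * v 1 0.
  by rewrite !mxE !big_ord_recl big_ord0 addr0 !mxE /= E.
split=> [h|h]; first by rewrite -mE h mxE.
by apply/matrixP => i j; rewrite !ord1 mE h mxE.
Qed.

Lemma in_L2_square_integrable (L : R) (w : R -> 'cV[R]_2) (i : 'I_2) : in_L2 L w ->
  sqint L (fun x => w x i 0).
Proof.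
move=> [mw fw]; split; first exact: mw.
have idot : mu.-integrable `[0, L] (EFin \o (fun x => dotcv (w x) (w x))).
  apply/integrableP; split.
    apply/measurable_EFinP; rewrite (_ : (fun x => _) =
      (fun x => w x 0 0 * w x 0 0 + w x 1 0 * w x 1 0)).
      by apply: measurable_funD; apply: measurable_funM; exact: mw.
    by apply/funext => x; rewrite dotcvE.
  under eq_integral => x _.
    rewrite /= ger0_norm; last by rewrite dotcvE addr_ge0// -expr2 sqr_ge0.
    over.
  exact: fw.
apply: (le_integrable _ _ _ idot); first exact: measurable_itv.
  by apply/measurable_EFinP; apply: measurable_funX; exact: mw.
move=> x xI /=; rewrite lee_fin dotcvE !ger0_norm ?sqr_ge0//; last first.
  by rewrite addr_ge0// -expr2 sqr_ge0.
have [->|->] : i = 0 \/ i = 1.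
  by case: i => -[|[|//]] ?; [left|right]; apply/val_inj.
- by rewrite -!expr2 lerDl sqr_ge0.
- by rewrite -!expr2 lerDr sqr_ge0.
Qed.

Lemma norm_L2_sqr (L : R) (w : R -> 'cV[R]_2) :
  sqint L (fun x => w x 0 0) -> sqint L (fun x => w x 1 0) ->
  norm_L2 L w ^+ 2 =
  pairing mu `[0, L] (fun x => w x 0 0) (fun x => w x 0 0) +
  pairing mu `[0, L] (fun x => w x 1 0) (fun x => w x 1 0).
Proof.
move=> s0 s1.
have E : \int[mu]_(x in `[0, L]) dotcv (w x) (w x) =
  pairing mu `[0, L] (fun x => w x 0 0) (fun x => w x 0 0) +
  pairing mu `[0, L] (fun x => w x 1 0) (fun x => w x 1 0).
  rewrite -RintegralD; [|exact: measurable_itv|exact: integrable_pairing..].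
  by apply: eq_Rintegral => x _; rewrite dotcvE.
by rewrite /norm_L2 E sqr_sqrtr// addr_ge0// pairing_ge0.
Qed.

Lemma continuous_square_integrable (L : R) (f : R -> R) :
  {within `[0, L], continuous f} -> sqint L f.
Proof.
move=> cf; split; first exact: continuous_itv_measurable.
by apply: continuous_itv_integrable => x; apply: cvgM; exact: cf.
Qed.

Lemma within_continuous_snd (T : topologicalType) (D E : set R) (f : R -> T) :
  {within E, continuous f} ->
  {within D `*` E, continuous (fun p : R * R => f p.2)}.
Proof.
move=> /subspace_continuousP cf; apply/subspace_continuousP => -[t x] /= [Dt Ex].
have h : f y @[y --> within E (nbhs x)] --> f x by exact: cf.
apply: (cvg_comp _ _ _ h) => A xA.
have : \forall p \near ((t, x) : R * R), E p.2 -> A p.2.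
  exact: (@cvg_snd _ _ (nbhs t) (nbhs x) _ _ xA).
move=> H.
by rewrite /fmap/= /within/=; apply: filterS H => p Ap [_ Ep]; exact: Ap.
Qed.

End weak_form.

(** * From the evolution problem to the static problem *)

Section weak_solution.
Context {R : realType}.
Notation mu := (@lebesgue_measure R).
Notation sqint L := (square_integrable mu `[0, L]).

Variables (L : R) (a b a' b' e1 e2 : R -> R) (c01 c02 cL1 cL2 : R).
Variables (z0 : R -> 'cV[R]_2) (z : R -> R -> 'cV[R]_2).
Hypothesis L0 : 0 < L.
Hypotheses (C1a : C1_on L a a') (C1b : C1_on L b b').
Hypothesis a_neq0 : forall x, x \in `[0, L] -> a x != 0.
Hypotheses (ce1 : {within `[0, L], continuous e1}) (ce2 : {within `[0, L], continuous e2}).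
Let A x := mx22 0 1 (a x) (b x).
Let B x := mx22 0 0 (e1 x) (e2 x).
Hypothesis solz : L2_solution L A B (row2 c01 c02) (row2 cL1 cL2) z0 z.

(* Solutions are extended to negative times by their initial value, so that
   they become continuous curves defined on the whole line. *)
Definition extended (i : 'I_2) (s x : R) := z (Num.max s 0) x i 0.

Lemma extendedE i s x : 0 <= s -> extended i s x = z s x i 0.
Proof. by move=> s0; rewrite /extended (max_idPl s0). Qed.

Lemma extended_measurable i (s t : R) :
  measurable_fun (`[s, t]%classic `*` `[0, L]%classic)
    (fun p : R * R => extended i p.1 p.2).
Proof.
have [mz _ _ _] := solz.
have -> : (fun p : R * R => extended i p.1 p.2) =
  (fun tx : R * R => z tx.1 tx.2 i 0) \o (fun p => (Num.max p.1 0, p.2)) by [].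
refine (@measurable_comp _ _ _ _ _ _ ((`[0, +oo[ : set R) `*` (`[0, L] : set R))
  (fun tx : R * R => z tx.1 tx.2 i 0) _ (fun p : R * R => (Num.max p.1 0, p.2)) _ _ _ _) => //.
- by apply: measurableX; exact: measurable_itv.
- move=> _ [p [_ pL] <-]; split => //=.
  by rewrite in_itv/= andbT le_max lexx orbT.
- apply: measurable_funTS; apply: measurable_fun_pair => //.
  by apply: measurable_maxr => //; exact: measurable_cst.
Qed.

Let sqz s i : sqint L (extended i s).
Proof.
have [_ cz _ _] := solz; apply: in_L2_square_integrable.
by have [] := cz (Num.max s 0); rewrite ?le_max ?lexx ?orbT.
Qed.

Lemma extended_L2_continuous i : L2_continuous L (extended i).
Proof.
split=> [s|t]; first exact: sqz.
have [_ cz _ _] := solz.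
have tp : 0 <= Num.max t 0 by rewrite le_max lexx orbT.
have [_ zt] := cz _ tp.
(* [Num.max s 0] never leaves [[0, +oo[], so the continuity of [z] relative to that half-line
   becomes two-sided continuity of the extension, also at [0]. *)
have mc : Num.max s 0 @[s --> t] --> within `[0, +oo[ (nbhs (Num.max t 0)).
  have cm : Num.max s 0 @[s --> t] --> Num.max t 0.
    by apply: (@continuous_max R R id (cst 0)); [exact: cvg_id|exact: cvg_cst].
  move=> S wS; have h : nbhs t (fun s => Num.max s 0 \in `[0, +oo[ -> S (Num.max s 0)) := cm _ wS.
  by apply: filterS h => s; apply; rewrite in_itv/= andbT le_max lexx orbT.
have N := cvg_comp _ _ mc zt.
have N2 : norm_L2 L (fun x => z (Num.max s 0) x - z (Num.max t 0) x) ^+ 2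
    @[s --> t] --> (0 : R).
  rewrite [X in _ --> X](_ : 0 = 0 * 0); last by rewrite mulr0.
  by apply: cvgM; exact: N.
apply: (squeeze_cvgr _ (cvg_cst 0) N2); near=> s; rewrite pairing_ge0/=.
have sd j : sqint L (fun x => (z (Num.max s 0) x - z (Num.max t 0) x) j 0).
  have mI : measurable (`[0, L]%classic : set (measurableTypeR R)) by exact: measurable_itv.
  have := square_integrableB mI (sqz s j) (sqz t j).
  by congr square_integrable; apply/funext => x; rewrite !mxE.
rewrite norm_L2_sqr//.
have [->|->] : i = 0 \/ i = 1.
  by case: (i) => -[|[|//]] ?; [left|right]; apply/val_inj.
- rewrite (_ : pairing _ _ _ _ = pairing mu `[0, L]
    (fun x => (z (Num.max s 0) x - z (Num.max t 0) x) 0 0)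
    (fun x => (z (Num.max s 0) x - z (Num.max t 0) x) 0 0)).
    by rewrite lerDl pairing_ge0.
  by apply: eq_Rintegral => x _; rewrite !mxE.
- rewrite (_ : pairing _ _ _ _ = pairing mu `[0, L]
    (fun x => (z (Num.max s 0) x - z (Num.max t 0) x) 1 0)
    (fun x => (z (Num.max s 0) x - z (Num.max t 0) x) 1 0)).
    by rewrite lerDr pairing_ge0.
  by apply: eq_Rintegral => x _; rewrite !mxE.
Unshelve. all: by end_near. Qed.

Section test.
Variables (th1 th1' th2 th2' : R -> R).
Hypotheses (C1th1 : C1_on L th1 th1') (C1th2 : C1_on L th2 th2').
Hypothesis bc0 : forall v1 v2 : R, c01 * v1 + c02 * v2 = 0 -> th1 0 * v1 + th2 0 * v2 = 0.
Hypothesis bcL : forall v1 v2 : R, cL1 * v1 + cL2 * v2 = 0 -> th1 L * v1 + th2 L * v2 = 0.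

(* [psi] solves [A^T psi = th], so that a time-independent test function [psi]
   turns the adjoint operator into [th' - B^T psi]. *)
Definition psi2 x := th1 x * (a x)^-1.
Definition psi1 x := th2 x - b x * psi2 x.

Lemma C1_on_inv : C1_on L (fun x => (a x)^-1) (fun x => - (a x) ^- 2 * a' x).
Proof.
have [da ca'] := C1a.
have dinv x : x \in `[0, L] ->
    is_derive_within `[0, L] (fun x => (a x)^-1) x (- (a x) ^- 2 * a' x).
  by move=> xI; apply: is_derive_withinV; [exact: a_neq0|exact: da].
split=> //; have cinv := is_derive_within_continuous dinv.
rewrite (_ : (fun x => _) = fun x => - ((a x)^-1 * (a x)^-1) * a' x).
  by move=> x; apply: cvgM; [apply: cvgN; apply: cvgM; exact: cinv|exact: ca'].
by apply/funext => x; rewrite -expr2 exprVn.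
Qed.

Let C1psi2 : exists psi2', C1_on L psi2 psi2'.
Proof. by eexists; exact: C1_onM C1th1 C1_on_inv. Qed.

Let C1psi1 : exists psi1', C1_on L psi1 psi1'.
Proof.
have [psi2' C1psi] := C1psi2.
have := C1_onD C1th2 (C1_onZ (- 1) (C1_onM C1b C1psi)).
rewrite (_ : (fun x => _) = psi1); first by eexists; eassumption.
by apply/funext => x; rewrite mulN1r.
Qed.

Let psi x := col2 (psi1 x) (psi2 x).

Let I0 : 0 \in `[0, L]. Proof. by rewrite in_itv/= lexx ltW. Qed.
Let IL : L \in `[0, L]. Proof. by rewrite in_itv/= lexx ltW. Qed.

(** This is [A^T psi = th] in weak form; the adjoint boundary conditions on [psi] thus follow from
    [bc0] and [bcL]. *)
Let psi_A x (v : 'cV[R]_2) : x \in `[0, L] ->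
  dotcv (psi x) (A x *m v) = th1 x * v 0 0 + th2 x * v 1 0.
Proof.
move=> xI; rewrite dotcvE !mx22_mul_col !mxE /= /psi1 /psi2.
by field; exact: a_neq0.
Qed.

Let test_psi (T : R) : 0 < T ->
  test_function L T A (row2 c01 c02) (row2 cL1 cL2) (fun=> psi).
Proof.
move=> T0; have [psi1' C1] := C1psi1; have [psi2' C2] := C1psi2.
have dpsi x : x \in `[0, L] ->
    is_derive_within `[0, L] psi x (col2 (psi1' x) (psi2' x)).
  move=> xI; apply: (@is_derive_within_mx _ 1 0) => i j; rewrite mxE.
  case: ifPn => i0; [have := C1.1 x xI|have := C2.1 x xI];
    by congr is_derive_within; apply/funext => y; rewrite mxE ?(negbTE i0) ?i0.
split.
- split.
  + move=> t x _ _; apply: is_derive_within_derivable; exact: is_derive_within_cst.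
  + by move=> t x _ xI; apply: is_derive_within_derivable; exact: dpsi.
  + apply: (@mx_within_continuous _ _ 1 0) => i j.
    apply: (@within_continuous_snd _ _ _ _ (fun x => psi x i j)).
    case: (boolP (i == 0)) => i0.
      rewrite (_ : (fun x => _) = psi1); first exact: C1_on_continuous C1.
      by apply/funext => x; rewrite mxE i0.
    rewrite (_ : (fun x => _) = psi2); first exact: C1_on_continuous C2.
    by apply/funext => x; rewrite mxE (negbTE i0).
  + apply: (@subspace_eq_continuous _ _ _ (cst (0 : 'cV[R]_2))).
      move=> -[t x] /set_mem[/= tT xI]; apply/esym/is_derive_withinE => //.
      exact: is_derive_within_cst.
    by move=> p; exact: cvg_cst.
  + apply: (@subspace_eq_continuous _ _ _ (fun p => col2 (psi1' p.2) (psi2' p.2))).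
      by move=> -[t x] /set_mem[/= tT xI]; apply/esym/is_derive_withinE => //; exact: dpsi.
    apply: (@mx_within_continuous _ _ 1 0) => i j.
    apply: (@within_continuous_snd _ _ _ _ (fun x => col2 (psi1' x) (psi2' x) i j)).
    case: (boolP (i == 0)) => i0.
      rewrite (_ : (fun x => _) = psi1'); first exact: C1.2.
      by apply/funext => x; rewrite mxE i0.
    rewrite (_ : (fun x => _) = psi2'); first exact: C2.2.
    by apply/funext => x; rewrite mxE (negbTE i0).
- by move=> t v _ /row2_mul_col h; rewrite psi_A// bc0.
- by move=> t v _ /row2_mul_col h; rewrite psi_A// bcL.
Qed.

Let y1 x := th1' x - e1 x * psi2 x.
Let y2 x := th2' x - e2 x * psi2 x.

Let adjoint_psi (T t x : R) (v : 'cV[R]_2) : 0 < T -> t \in `[0, T] -> x \in `[0, L] ->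
  dotcv (adjoint_operator L T A B (fun=> psi) t x) v = v 0 0 * y1 x + v 1 0 * y2 x.
Proof.
move=> T0 tT xI; rewrite /adjoint_operator.
rewrite (is_derive_withinE (l := 0) T0 tT); last exact: is_derive_within_cst.
rewrite (is_derive_withinE (l := col2 (th1' x) (th2' x)) L0 xI); last first.
  apply: (@is_derive_within_mx _ 1 0) => i j; rewrite mxE.
  have E y : y \in `[0, L] -> ((A y)^T *m psi y) i j = if i == 0 then th1 y else th2 y.
    move=> yI; rewrite (ord1 j) /A mx22_tr.
    have [->|->] : i = 0 \/ i = 1.
      by case: (i) => -[|[|//]] ?; [left|right]; apply/val_inj.
    - rewrite mx22_mul_col !mxE /= /psi2; field; exact: a_neq0.
    - rewrite mx22_mul_col !mxE /= /psi1; ring.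
  have xI' : `[0, L]%classic x by [].
  case: ifPn E => i0 E.
    by apply: (is_derive_within_eq xI' _ (C1th1.1 x xI)) => y yI; rewrite E.
  by apply: (is_derive_within_eq xI' _ (C1th2.1 x xI)) => y yI; rewrite E.
rewrite add0r dotcvE /B mx22_tr !mxE /=.
have E00 := (mx22_mul_col 0 (e1 x) 0 (e2 x) (psi x)).
by rewrite -/(psi x); move: E00; rewrite !mxE /= => -[]; rewrite /y1 /y2 => -> ->; ring.
Qed.

Let cpsi2 : {within `[0, L], continuous psi2}.
Proof. by have [p C1] := C1psi2; exact: C1_on_continuous C1. Qed.

Let cpsi1 : {within `[0, L], continuous psi1}.
Proof. by have [p C1] := C1psi1; exact: C1_on_continuous C1. Qed.

Let sy1 : sqint L y1.
Proof.
apply: continuous_square_integrable => x; apply: cvgB; first exact: C1th1.2.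
by apply: cvgM; [exact: ce1|exact: cpsi2].
Qed.

Let sy2 : sqint L y2.
Proof.
apply: continuous_square_integrable => x; apply: cvgB; first exact: C1th2.2.
by apply: cvgM; [exact: ce2|exact: cpsi2].
Qed.

Let mI : measurable (`[0, L]%classic : set (measurableTypeR R)).
Proof. exact: measurable_itv. Qed.

Let spsi1 := continuous_square_integrable cpsi1.
Let spsi2 := continuous_square_integrable cpsi2.

Notation "<< u , v >>" := (pairing mu `[0, L] u v).

Let Phi s := << extended 0 s, y1 >> + << extended 1 s, y2 >>.

Let curve_continuous i y : sqint L y -> continuous (fun s => << extended i s, y >>).
Proof.
move=> sy.
have := pairing_continuous (extended_L2_continuous i) (L2_continuous_cst sy).
exact: (@continuous2_left _ (fun s _ => << extended i s, y >>) 0).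
Qed.

Let cPhi : continuous Phi.
Proof.
by move=> s; apply: cvgD; [exact: (curve_continuous sy1)|exact: (curve_continuous sy2)].
Qed.

(** The initial term does not depend on [T], so it cancels between the identities at [t + h] and at
    [t]. *)
Let weak_at T : 0 < T ->
  << psi1, extended 0 T >> + << psi2, extended 1 T >> -
  \int[mu]_(x in `[0, L]) dotcv (psi x) (z0 x) = \int[mu]_(s in `[0, T]) Phi s.
Proof.
move=> T0; have [_ _ _ weak] := solz; have := weak _ _ T0 (test_psi T0).
have -> : \int[mu]_(x in `[0, L]) dotcv (psi x) (z T x) =
    << psi1, extended 0 T >> + << psi2, extended 1 T >>.
  rewrite -(RintegralD mI); [|exact: integrable_pairing..].
  by apply: eq_Rintegral => x _; rewrite dotcvE !mxE /= !extendedE// ltW.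
move=> ->; apply: eq_Rintegral => s; rewrite inE => sT.
have s0 : 0 <= s by move: sT; rewrite /= in_itv/= => /andP[].
rewrite /Phi -(RintegralD mI); [|exact: integrable_pairing..].
by apply: eq_Rintegral => x; rewrite inE => xI; rewrite adjoint_psi// !extendedE.
Qed.

(** The weak form of [- w_x = k] with [A k = d + B w]: the first row of [A] gives [d1] as the second
    component of [k], and the second row is solved for the first component by dividing by [a]. This
    is the shape that [weak_trace] expects. *)
Lemma weak_time_average (h t : R) : 0 < h -> 0 < t ->
  let w1 := time_average (extended 0) t (t + h) in
  let w2 := time_average (extended 1) t (t + h) in
  let d1 := fun x => extended 0 (t + h) x - extended 0 t x in
  let d2 := fun x => extended 1 (t + h) x - extended 1 t x in
  \int[mu]_(x in `[0, L]) (th1' x * w1 x + th2' x * w2 x) =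
  \int[mu]_(x in `[0, L])
    (th1 x * ((a x)^-1 * (d2 x - b x * d1 x + e1 x * w1 x + e2 x * w2 x)) +
     th2 x * d1 x).
Proof.
move=> h0 t0 w1 w2 d1 d2.
have th : t <= t + h by rewrite lerDl ltW.
have sd1 : sqint L d1 by exact: square_integrableB.
have sd2 : sqint L d2 by exact: square_integrableB.
have sw1 : sqint L w1.
  by apply: time_average_square_integrable => //;
    [exact: extended_L2_continuous|exact: extended_measurable].
have sw2 : sqint L w2.
  by apply: time_average_square_integrable => //;
    [exact: extended_L2_continuous|exact: extended_measurable].
(* The identities at [t + h] and at [t] are subtracted, then the time integral is exchanged with the
   pairings. *)
have split_weak : << psi1, d1 >> + << psi2, d2 >> = << w1, y1 >> + << w2, y2 >>.
  have -> : << psi1, d1 >> + << psi2, d2 >> = \int[mu]_(s in `[t, t + h]) Phi s.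
    have E1 := weak_at t0; have E2 := weak_at (addr_gt0 t0 h0).
    rewrite (Rintegral_itv_split cPhi (ltW t0) th) in E2.
    rewrite /d1 /d2 !pairingBr//.
    by lra.
  rewrite /w1 /w2 !(pairing_time_average (extended_L2_continuous _) (extended_measurable _))//.
  rewrite -RintegralD//; exact: continuous_integrable_itv (curve_continuous _).
have ir : mu.-integrable `[0, L] (EFin \o (fun x => psi2 x * (e1 x * w1 x + e2 x * w2 x))).
  apply: integrableM_continuous => //; apply: itv_integrableD;
    by apply: integrableM_continuous => //; exact: square_integrable_integrable.
have iwy1 := integrable_pairing sw1 sy1; have iwy2 := integrable_pairing sw2 sy2.
have ipd1 := integrable_pairing spsi1 sd1; have ipd2 := integrable_pairing spsi2 sd2.
(* [th'] exceeds the pair [y1], [y2] by [B^T psi], and the last integral is that of [psi^T B w]. *)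
transitivity (<< w1, y1 >> + << w2, y2 >> +
  \int[mu]_(x in `[0, L]) (psi2 x * (e1 x * w1 x + e2 x * w2 x))).
  rewrite -(RintegralD mI iwy1 iwy2) -(RintegralD mI (itv_integrableD iwy1 iwy2) ir).
  by apply: eq_Rintegral => x _; rewrite /y1 /y2; ring.
rewrite -split_weak.
rewrite -(RintegralD mI ipd1 ipd2) -(RintegralD mI (itv_integrableD ipd1 ipd2) ir).
apply: eq_Rintegral => x; rewrite inE => xI; rewrite /psi1 /psi2.
by field; exact: a_neq0.
Qed.

End test.
End weak_solution.

(** * Stability *)

Section coefficients.
Context {R : realType}.
Implicit Types (F G : R -> R) (L : R).

Definition is_C1 L F := exists f, C1_on L F f.

Lemma is_C1_continuous L F : is_C1 L F -> {within `[0, L], continuous F}.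
Proof. by move=> [f]; exact: C1_on_continuous. Qed.

Lemma is_C1D L F G : is_C1 L F -> is_C1 L G -> is_C1 L (fun x => F x + G x).
Proof. by move=> [f Ff] [g Gg]; eexists; exact: C1_onD Ff Gg. Qed.

Lemma is_C1M L F G : is_C1 L F -> is_C1 L G -> is_C1 L (fun x => F x * G x).
Proof. by move=> [f Ff] [g Gg]; eexists; exact: C1_onM Ff Gg. Qed.

Lemma is_C1_cst L (c : R) : is_C1 L (fun=> c).
Proof. by eexists; exact: C1_on_cst. Qed.

Lemma is_C1N L F : is_C1 L F -> is_C1 L (fun x => - F x).
Proof.
move=> C1F; rewrite (_ : (fun x => _) = fun x => - 1 * F x).
  exact: is_C1M (is_C1_cst L (- 1)) C1F.
by apply/funext => x; rewrite mulN1r.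
Qed.

Lemma is_C1_sqrt L F : (forall x, x \in `[0, L] -> 0 < F x) -> is_C1 L F ->
  is_C1 L (fun x => Num.sqrt (F x)).
Proof.
move=> F0 [f [dF cf]]; exists (fun x => (2 * Num.sqrt (F x))^-1 * f x).
have ds x : x \in `[0, L] -> is_derive_within `[0, L] (fun x => Num.sqrt (F x)) x
    ((2 * Num.sqrt (F x))^-1 * f x).
  by move=> xI; apply: is_derive_within_sqrt; [exact: F0|exact: dF].
split=> //.
have dV x : x \in `[0, L] -> is_derive_within `[0, L]
    (fun x => (2 * Num.sqrt (F x))^-1) x
    (- (2 * Num.sqrt (F x)) ^- 2 * (2 * ((2 * Num.sqrt (F x))^-1 * f x))).
  move=> xI; apply: is_derive_withinV; last by apply: is_derive_withinZ; exact: ds.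
  by rewrite mulf_neq0// gt_eqF// sqrtr_gt0 F0.
by move=> x; apply: cvgM; [exact: (is_derive_within_continuous dV)|exact: cf].
Qed.

Lemma C1_within_is_C1 L F : C1_within `[0, L] F -> is_C1 L F.
Proof. by move=> [dF cF]; exists (derive_within `[0, L] F); split => // x xI; exact: dF. Qed.

Lemma is_derive_partialH (F : R -> R -> R) (H Q : R) : derivable (F^~ Q) H 1 ->
  is_derive H 1 (F^~ Q) (partialH F H Q).
Proof. by move=> dF; rewrite /partialH derive1E; exact: DeriveDef. Qed.

Lemma within_continuous_curve (D : set R) (F : R -> R -> R) (H : R -> R) (Q : R) :
  continuous (fun HQ : R * R => F HQ.1 HQ.2) -> {within D, continuous H} ->
  {within D, continuous (fun x => F (H x) Q)}.
Proof.
move=> cF cH x; apply: (@continuous_comp (subspace D) R R H (F^~ Q)); first exact: cH.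
exact: continuous2_left.
Qed.

(** * Regularity of the coefficients along the steady state *)

Section steady_state.
Variables (L : R) (f g : R -> R -> R) (Q : R) (H : R -> R).
Hypothesis (L0 : 0 < L) (hf : C2_plane f) (hg : C1_plane g).
Hypothesis dH : forall x, x \in `[0, L] -> derivable_within `[0, L] H x.
Hypothesis steady : forall x, x \in `[0, L] ->
  derive_within `[0, L] (fun y => f (H y) Q) x + g (H x) Q = 0.
Hypothesis a_neq0 : forall x, x \in `[0, L] -> partialH f (H x) Q != 0.

(** [H] is only assumed differentiable. The chain rule turns the steady equation into
    [partialH f * H' = - g]; dividing by the nonvanishing [partialH f] shows that the derivative of
    [H] is continuous, which makes every [C^1] function of [H] a [C^1] function of [x]. *)
Let H' x := - g (H x) Q * (partialH f (H x) Q)^-1.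

Let is_derive_H x : x \in `[0, L] -> is_derive_within `[0, L] H x (H' x).
Proof.
move=> xI; have dHx := derivable_withinP (dH xI).
have [[df _ _ _ _] _ _] := hf.
have dfH := is_derive_within_comp dHx (is_derive_partialH (df (H x) Q)).
have := steady xI; rewrite (is_derive_withinE L0 xI dfH) => /eqP.
rewrite addr_eq0 => /eqP E; rewrite (_ : H' x = derive_within `[0, L] H x)//.
by rewrite /H' -E mulrC mulKf// a_neq0.
Qed.

Let cH : {within `[0, L], continuous H}.
Proof. exact: is_derive_within_continuous is_derive_H. Qed.

Let is_derive_curve (F : R -> R -> R) x : C1_plane F -> x \in `[0, L] ->
  is_derive_within `[0, L] (fun y => F (H y) Q) x (partialH F (H x) Q * H' x).
Proof.
move=> [dF _ _ _ _] xI.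
exact: is_derive_within_comp (is_derive_H xI) (is_derive_partialH (dF (H x) Q)).
Qed.

Let cH' : {within `[0, L], continuous H'}.
Proof.
have [_ hfH _] := hf; have [_ _ cg _ _] := hg.
have dV x : x \in `[0, L] -> is_derive_within `[0, L] (fun x => (partialH f (H x) Q)^-1) x
    (- (partialH f (H x) Q) ^- 2 * (partialH (partialH f) (H x) Q * H' x)).
  by move=> xI; apply: is_derive_withinV; [exact: a_neq0|exact: is_derive_curve].
move=> x; apply: cvgM; last exact: (is_derive_within_continuous dV).
by apply: cvgN; exact: (within_continuous_curve cg cH).
Qed.

Lemma steady_curve_is_C1 (F : R -> R -> R) : C1_plane F -> is_C1 L (fun x => F (H x) Q).
Proof.
move=> hF; exists (fun x => partialH F (H x) Q * H' x); split.
  by move=> x xI; exact: is_derive_curve.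
have [_ _ _ cF _] := hF.
by move=> x; apply: cvgM; [exact: (within_continuous_curve cF cH)|exact: cH'].
Qed.

Lemma steady_curve_continuous (F : R -> R -> R) :
  continuous (fun HQ : R * R => F HQ.1 HQ.2) ->
  {within `[0, L], continuous (fun x => F (H x) Q)}.
Proof. by move=> cF; exact: within_continuous_curve. Qed.

End steady_state.

(** By Cayley-Hamilton [tr S * v^T S v - det S * |v|^2 = |S v|^2 >= 0], so [det S / tr S] bounds the
    form from below. Both are continuous and positive on [[0, L]], and the minimum of the
    determinant over the maximum of the trace is a uniform constant. *)
Lemma bform_coercive L (s11 s12 s22 : R -> R) : 0 <= L ->
  {within `[0, L], continuous s11} -> {within `[0, L], continuous s12} ->
  {within `[0, L], continuous s22} ->
  (forall x v1 v2, x \in `[0, L] -> (v1 != 0) || (v2 != 0) ->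
    0 < bform (s11 x) (s12 x) (s22 x) v1 v2 v1 v2) ->
  exists2 c, 0 < c & forall x v1 v2, x \in `[0, L] ->
    c * (v1 ^+ 2 + v2 ^+ 2) <= bform (s11 x) (s12 x) (s22 x) v1 v2 v1 v2.
Proof.
move=> L0 c11 c12 c22 pos.
have cdet : {within `[0, L], continuous (fun x => s11 x * s22 x - s12 x * s12 x)}.
  by move=> x; apply: cvgB; apply: cvgM; [exact: c11|exact: c22|exact: c12|exact: c12].
have ctr : {within `[0, L], continuous (fun x => s11 x + s22 x)}.
  by move=> x; apply: cvgD; [exact: c11|exact: c22].
have [xd xdI detmin] := EVT_min L0 cdet; have [xt xtI trmax] := EVT_max L0 ctr.
have s11_gt0 x : x \in `[0, L] -> 0 < s11 x.
  move=> xI; have := pos x 1 0 xI; rewrite oner_neq0 /bform => /(_ isT).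
  by rewrite !mulr1 !mulr0 !addr0 mulr0 addr0.
have s22_gt0 x : x \in `[0, L] -> 0 < s22 x.
  move=> xI; have := pos x 0 1 xI; rewrite oner_neq0 orbT /bform => /(_ isT).
  by rewrite !mulr1 !mul0r !mulr0 !add0r mulr0 add0r.
have det_gt0 x : x \in `[0, L] -> 0 < s11 x * s22 x - s12 x * s12 x.
  move=> xI; have s11x := s11_gt0 x xI.
  (* At this vector the form is [s11 x] times the determinant. *)
  have := pos x (- s12 x) (s11 x) xI; rewrite (gt_eqF s11x) orbT => /(_ isT).
  have -> : bform (s11 x) (s12 x) (s22 x) (- s12 x) (s11 x) (- s12 x) (s11 x) =
    s11 x * (s11 x * s22 x - s12 x * s12 x) by rewrite /bform; ring.
  by rewrite pmulr_rgt0.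
have tr_gt0 x : x \in `[0, L] -> 0 < s11 x + s22 x.
  by move=> xI; rewrite addr_gt0// ?s11_gt0// s22_gt0.
exists ((s11 xd * s22 xd - s12 xd * s12 xd) / (s11 xt + s22 xt)).
  by rewrite divr_gt0// ?det_gt0// tr_gt0.
move=> x v1 v2 xI; rewrite mulrAC ler_pdivrMr ?tr_gt0//.
have v0 : 0 <= v1 ^+ 2 + v2 ^+ 2 by rewrite addr_ge0// sqr_ge0.
have q0 : 0 <= bform (s11 x) (s12 x) (s22 x) v1 v2 v1 v2.
  have [vn|] := boolP ((v1 != 0) || (v2 != 0)); first exact: ltW (pos x _ _ xI vn).
  rewrite negb_or !negbK => /andP[/eqP -> /eqP ->].
  by rewrite /bform !(mulr0, mul0r, addr0).
apply: (@le_trans _ _ ((s11 x * s22 x - s12 x * s12 x) * (v1 ^+ 2 + v2 ^+ 2))).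
  by rewrite ler_wpM2r// detmin.
apply: (@le_trans _ _ (bform (s11 x) (s12 x) (s22 x) v1 v2 v1 v2 * (s11 x + s22 x))); last first.
  by rewrite ler_wpM2l// trmax.
rewrite -subr_ge0 (_ : _ - _ = (s11 x * v1 + s12 x * v2) ^+ 2 +
  (s12 x * v1 + s22 x * v2) ^+ 2); last by rewrite /bform; ring.
by rewrite addr_ge0// sqr_ge0.
Qed.

Lemma bform_bounded L (s11 s12 s22 : R -> R) :
  {within `[0, L], continuous s11} -> {within `[0, L], continuous s12} ->
  {within `[0, L], continuous s22} ->
  exists2 C, 0 < C & forall x v1 v2, x \in `[0, L] ->
    bform (s11 x) (s12 x) (s22 x) v1 v2 v1 v2 <= C * (v1 ^+ 2 + v2 ^+ 2).
Proof.
move=> /continuous_itv_bounded[C1 h1] /continuous_itv_bounded[C2 h2].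
move=> /continuous_itv_bounded[C3 h3].
exists (`|C1| + `|C2| + `|C3| + 1); first by rewrite ltr_wpDl// !addr_ge0.
move=> x v1 v2 xI.
have B1 : s11 x <= `|C1| := le_trans (ler_norm _) (le_trans (h1 x xI) (ler_norm _)).
have B3 : s22 x <= `|C3| := le_trans (ler_norm _) (le_trans (h3 x xI) (ler_norm _)).
have : `|s12 x| <= `|C2| := le_trans (h2 x xI) (ler_norm _).
rewrite ler_norml => /andP[B2 B2'].
have n1 := normr_ge0 C1; have n2 := normr_ge0 C2; have n3 := normr_ge0 C3.
have p1 : 0 <= (`|C1| - s11 x) * v1 ^+ 2 by rewrite mulr_ge0 ?sqr_ge0// subr_ge0.
have p3 : 0 <= (`|C3| - s22 x) * v2 ^+ 2 by rewrite mulr_ge0 ?sqr_ge0// subr_ge0.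
(* The terms [p2] and [p4] control the cross term: their sum is
   [2 |C2| (v1^2 + v2^2) - 4 s12 v1 v2]. *)
have p2 : 0 <= (`|C2| - s12 x) * (v1 + v2) ^+ 2 by rewrite mulr_ge0 ?sqr_ge0// subr_ge0.
have p4 : 0 <= (`|C2| + s12 x) * (v1 - v2) ^+ 2.
  by rewrite mulr_ge0 ?sqr_ge0//; lra.
have q1 : 0 <= `|C1| * v2 ^+ 2 by rewrite mulr_ge0 ?sqr_ge0.
have q3 : 0 <= `|C3| * v1 ^+ 2 by rewrite mulr_ge0 ?sqr_ge0.
have r1 := sqr_ge0 v1; have r2 := sqr_ge0 v2.
by rewrite /bform; nra.
Qed.

(** [l2 * v1 + v2] and [v2 - l1 * v1] are the characteristic components [N v], with velocities [l1]
    and [- l2]. At the left end the boundary condition makes the incoming one a multiple of the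
    outgoing one, and the hypothesis bounds the square of this reflection coefficient. *)
Lemma boundary_left (al aq l1 l2 p1 p2 v1 v2 : R) :
  0 < l1 -> 0 < l2 -> 0 < p1 -> 0 < p2 -> al + aq * l1 != 0 ->
  ((al - aq * l2) / (al + aq * l1)) ^+ 2 < p2 / p1 * (l2 / l1) ->
  al * v1 + aq * v2 = 0 ->
  p1 * l1 * (l2 * v1 + v2) ^+ 2 <= p2 * l2 * (v2 - l1 * v1) ^+ 2.
Proof.
move=> l10 l20 p10 p20 n0 r bc.
have E : l2 * v1 + v2 = (al - aq * l2) / (al + aq * l1) * (v2 - l1 * v1).
  rewrite mulrAC; apply: (mulIf n0); rewrite divfK//.
  have : (l1 + l2) * (al * v1 + aq * v2) = 0 by rewrite bc mulr0.
  by move=> ?; lra.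
rewrite E exprMn mulrA ler_wpM2r ?sqr_ge0//.
rewrite (_ : p2 * l2 = p1 * l1 * (p2 / p1 * (l2 / l1))); last first.
  by field; rewrite !gt_eqF.
by rewrite ler_pM2l ?mulr_gt0// ltW.
Qed.

End coefficients.

(** * Exponential stability from bounds on quadratic forms *)

Section stability.
Context {R : realType}.
Notation mu := (@lebesgue_measure R).
Notation sqint L := (square_integrable mu `[0, L]).

(** Reversing the orientation of the interval exchanges the velocities and the weights and changes
    the signs of [v1] and [bq], which reduces this end to [boundary_left]. *)
Lemma boundary_right (bh bq l1 l2 p1 p2 v1 v2 : R) :
  0 < l1 -> 0 < l2 -> 0 < p1 -> 0 < p2 -> bh - bq * l2 != 0 ->
  ((bh + bq * l1) / (bh - bq * l2)) ^+ 2 < p1 / p2 * (l1 / l2) ->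
  bh * v1 + bq * v2 = 0 ->
  p2 * l2 * (v2 - l1 * v1) ^+ 2 <= p1 * l1 * (l2 * v1 + v2) ^+ 2.
Proof.
move=> l10 l20 p10 p20 n0 r bc.
have := @boundary_left _ bh (- bq) l2 l1 p2 p1 (- v1) v2 l20 l10 p20 p10.
rewrite !mulNr opprK => /(_ n0 r); rewrite -bc => h.
have -> : v2 - l1 * v1 = l1 * - v1 + v2 by ring.
have -> : l2 * v1 + v2 = v2 - l2 * - v1 by ring.
by apply: h; rewrite mulrN -opprD bc oppr0.
Qed.

Variables (L : R) (a a' b b' e1 e2 : R -> R) (c01 c02 cL1 cL2 : R).
Variables (p11 p12 p22 m11 m12 m22 m11' m12' m22' : R -> R) (lo hi nu : R).
Hypothesis L0 : 0 < L.
Hypotheses (C1a : C1_on L a a') (C1b : C1_on L b b').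
Hypothesis a_neq0 : forall x, x \in `[0, L] -> a x != 0.
Hypotheses (ce1 : {within `[0, L], continuous e1}) (ce2 : {within `[0, L], continuous e2}).
Hypotheses (cp11 : {within `[0, L], continuous p11})
  (cp12 : {within `[0, L], continuous p12})
  (cp22 : {within `[0, L], continuous p22}).
Hypotheses (C1m11 : C1_on L m11 m11') (C1m12 : C1_on L m12 m12')
  (C1m22 : C1_on L m22 m22').
(* [M = P A], with [M] symmetric. *)
Hypothesis M_PA : forall x, x \in `[0, L] ->
  [/\ m11 x = p12 x * a x, m12 x = p11 x + p12 x * b x,
      m12 x = p22 x * a x & m22 x = p12 x + p22 x * b x].
Hypotheses (lo0 : 0 < lo) (hi0 : 0 < hi) (nu0 : 0 < nu).
Hypothesis P_lo : forall x v1 v2, x \in `[0, L] ->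
  lo * (v1 ^+ 2 + v2 ^+ 2) <= bform (p11 x) (p12 x) (p22 x) v1 v2 v1 v2.
Hypothesis P_hi : forall x v1 v2, x \in `[0, L] ->
  bform (p11 x) (p12 x) (p22 x) v1 v2 v1 v2 <= hi * (v1 ^+ 2 + v2 ^+ 2).
(* The right-hand side is the quadratic form of [- M_x + B^T P + P B]. *)
Hypothesis S_lo : forall x v1 v2, x \in `[0, L] ->
  nu * bform (p11 x) (p12 x) (p22 x) v1 v2 v1 v2 <=
  bform (- m11' x + 2 * p12 x * e1 x) (- m12' x + p12 x * e2 x + p22 x * e1 x)
    (- m22' x + 2 * p22 x * e2 x) v1 v2 v1 v2.
Hypothesis bc_left : forall v1 v2, c01 * v1 + c02 * v2 = 0 ->
  bform (m11 0) (m12 0) (m22 0) v1 v2 v1 v2 <= 0.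
Hypothesis bc_right : forall v1 v2, cL1 * v1 + cL2 * v2 = 0 ->
  0 <= bform (m11 L) (m12 L) (m22 L) v1 v2 v1 v2.
Let A x := mx22 0 1 (a x) (b x).
Let B x := mx22 0 0 (e1 x) (e2 x).

Section solution.
Variables (z0 : R -> 'cV[R]_2) (z : R -> R -> 'cV[R]_2).
Hypothesis z0_L2 : in_L2 L z0.
Hypothesis solz : L2_solution L A B (row2 c01 c02) (row2 cL1 cL2) z0 z.

Let cz i : L2_continuous L (extended z i) := extended_L2_continuous solz i.

(** Here [A k = d + B w], so [w^T M k = w^T P (d + B w)]. The pointwise hypothesis of [dissipation]
    then becomes [S_lo] evaluated at [w]. *)
Lemma average_dissipates (h t : R) : 0 < h -> 0 < t ->
  2 * energy_form L p11 p12 p22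
        (time_average (extended z 0) t (t + h)) (time_average (extended z 1) t (t + h))
        (fun x => extended z 0 (t + h) x - extended z 0 t x)
        (fun x => extended z 1 (t + h) x - extended z 1 t x) <=
  - nu * energy_form L p11 p12 p22
        (time_average (extended z 0) t (t + h)) (time_average (extended z 1) t (t + h))
        (time_average (extended z 0) t (t + h)) (time_average (extended z 1) t (t + h)).
Proof.
move=> h0 t0.
set w1 := time_average (extended z 0) _ _; set w2 := time_average (extended z 1) _ _.
have mI : measurable (`[0, L]%classic : set (measurableTypeR R)) by exact: measurable_itv.
have th : t <= t + h by rewrite lerDl ltW.
set d1 := fun x => _ - _; set d2 := fun x => _ - _.
have sd1 : sqint L d1 by apply: square_integrableB => //; exact: (cz 0).1.
have sd2 : sqint L d2 by apply: square_integrableB => //; exact: (cz 1).1.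
have sw1 : sqint L w1.
  by apply: time_average_square_integrable => //;
    move=> s1 s2; exact: (extended_measurable solz).
have sw2 : sqint L w2.
  by apply: time_average_square_integrable => //;
    move=> s1 s2; exact: (extended_measurable solz).
have cinv := C1_on_continuous (C1_on_inv C1a a_neq0).
have cb := C1_on_continuous C1b.
have sk1 : sqint L (fun x => (a x)^-1 * (d2 x - b x * d1 x + e1 x * w1 x + e2 x * w2 x)).
  apply: (weight_square_integrable cinv).
  apply: square_integrableD => //; last exact: weight_square_integrable.
  apply: square_integrableD => //; last exact: weight_square_integrable.
  by apply: square_integrableB => //; exact: weight_square_integrable.
apply: (dissipation L0 sw1 sw2 sd1 sd2 sk1 sd1 C1m11 C1m12 C1m22 cp11 cp12 cp22
  _ bc_left bc_right).
- move=> th1 th1' th2 th2' C1 C2 b0 bL.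
  exact: (weak_time_average L0 C1a C1b a_neq0 ce1 ce2 solz C1 C2 b0 bL h0 t0).
- move=> x xI; have [E1 E2 E3 E4] := M_PA xI.
  rewrite -subr_ge0; apply: le_trans (_ : 0 <= bform
    (- m11' x + 2 * p12 x * e1 x) (- m12' x + p12 x * e2 x + p22 x * e1 x)
    (- m22' x + 2 * p22 x * e2 x) (w1 x) (w2 x) (w1 x) (w2 x) -
    nu * bform (p11 x) (p12 x) (p22 x) (w1 x) (w2 x) (w1 x) (w2 x)) _.
    by rewrite subr_ge0 S_lo.
  rewrite le_eqVlt; apply/orP; left; apply/eqP.
  set k := (X in bform (m11 x) _ _ _ _ X _).
  have ak : a x * k = d2 x - b x * d1 x + e1 x * w1 x + e2 x * w2 x.
    by rewrite /k mulrA mulfV ?mul1r// a_neq0.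
  (* Both expressions of [m12] in [M_PA] are used, one for each cross term: the symmetry of [M]
     enters here. *)
  have E : bform (m11 x) (m12 x) (m22 x) (w1 x) (w2 x) k (d1 x) =
    p12 x * w1 x * (a x * k) + p22 x * w2 x * (a x * k) +
    (p11 x + p12 x * b x) * w1 x * d1 x + (p12 x + p22 x * b x) * w2 x * d1 x.
    by rewrite /bform E1 E4 mulrDr {1}E2 E3; ring.
  by rewrite E ak /bform; ring.
Qed.

Let energy s := energy_form L p11 p12 p22 (extended z 0 s) (extended z 1 s)
  (extended z 0 s) (extended z 1 s).

Let norm2 s := pairing mu `[0, L] (extended z 0 s) (extended z 0 s) +
  pairing mu `[0, L] (extended z 1 s) (extended z 1 s).

Let energy_continuous : continuous energy.
Proof.
have := energy_form_continuous cp11 cp12 cp22 (cz 0) (cz 1) (cz 0) (cz 1).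
exact: (@continuous2_diag _ (fun s r => energy_form L p11 p12 p22
  (extended z 0 s) (extended z 1 s) (extended z 0 r) (extended z 1 r))).
Qed.

(** [energy_decay] starts at positive times; continuity of the energy lets the starting time tend to
    [0] from the right. *)
Lemma energy_exponential_decay t : 0 <= t -> energy t <= expR (- nu * t) * energy 0.
Proof.
rewrite le_eqVlt => /predU1P[<-|t0]; first by rewrite mulr0 expR0 mul1r.
have c : expR (- nu * (t - s)) * energy s @[s --> 0^'+] --> expR (- nu * (t - 0)) * energy 0.
  apply: cvg_at_right_filter; apply: cvgM; last exact: energy_continuous.
  apply: continuous_cvg; first exact: continuous_expR.
  by apply: cvgM; [exact: cvg_cst|apply: cvgB; [exact: cvg_cst|exact: cvg_id]].
rewrite subr0 in c; apply: (cvgr_to_ge c); near=> s.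
apply: (energy_decay cp11 cp12 cp22 (cz 0) (cz 1)).
- by move=> s1 s2; exact: (extended_measurable solz).
- by move=> s1 s2; exact: (extended_measurable solz).
- by move=> h r h0 r0; exact: average_dissipates.
- by near: s; exact: nbhs_right_gt.
- by near: s; exact: nbhs_right_le.
Unshelve. all: by end_near. Qed.

Let norm2E s : norm2 s = \int[mu]_(x in `[0, L])
  (extended z 0 s x * extended z 0 s x + extended z 1 s x * extended z 1 s x).
Proof.
have mI : measurable (`[0, L]%classic : set (measurableTypeR R)) by exact: measurable_itv.
have [s0 s1] := ((cz 0).1 s, (cz 1).1 s).
by rewrite (RintegralD mI (integrable_pairing s0 s0) (integrable_pairing s1 s1)).
Qed.

Let integrable_norm2 s (c : R) : mu.-integrable `[0, L] (EFin \o (fun x =>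
  c * (extended z 0 s x * extended z 0 s x + extended z 1 s x * extended z 1 s x))).
Proof.
by apply: itv_integrableZ; apply: itv_integrableD; apply: integrable_pairing;
  first [exact: (cz 0).1|exact: (cz 1).1].
Qed.

Let integrable_energy s : mu.-integrable `[0, L] (EFin \o (fun x =>
  bform (p11 x) (p12 x) (p22 x) (extended z 0 s x) (extended z 1 s x)
    (extended z 0 s x) (extended z 1 s x))).
Proof. by apply: integrable_bform => //; first [exact: (cz 0).1|exact: (cz 1).1]. Qed.

Let energy_lo s : lo * norm2 s <= energy s.
Proof.
have mI : measurable (`[0, L]%classic : set (measurableTypeR R)) by exact: measurable_itv.
have i1 : mu.-integrable `[0, L] (EFin \o (fun x =>
    extended z 0 s x * extended z 0 s x + extended z 1 s x * extended z 1 s x)).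
  by apply: eq_itv_integrable (integrable_norm2 s 1) => x _; rewrite mul1r.
rewrite norm2E -(RintegralZl lo mI i1).
apply: (le_Rintegral mI) => //.
by move=> x xI; have := P_lo (extended z 0 s x) (extended z 1 s x) xI; rewrite !expr2.
Qed.

Let energy_hi s : energy s <= hi * norm2 s.
Proof.
have mI : measurable (`[0, L]%classic : set (measurableTypeR R)) by exact: measurable_itv.
have i1 : mu.-integrable `[0, L] (EFin \o (fun x =>
    extended z 0 s x * extended z 0 s x + extended z 1 s x * extended z 1 s x)).
  by apply: eq_itv_integrable (integrable_norm2 s 1) => x _; rewrite mul1r.
rewrite norm2E -(RintegralZl hi mI i1).
apply: (le_Rintegral mI) => //.
by move=> x xI; have := P_hi (extended z 0 s x) (extended z 1 s x) xI; rewrite !expr2.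
Qed.

Let norm_extended t : 0 <= t -> norm_L2 L (z t) ^+ 2 = norm2 t.
Proof.
move=> t0; have E i : (fun x => z t x i 0) = extended z i t.
  by apply/funext => x; rewrite extendedE.
by rewrite norm_L2_sqr ?E//; [exact: (cz 0).1|exact: (cz 1).1].
Qed.

Let norm_initial : norm_L2 L z0 ^+ 2 = norm2 0.
Proof.
have s0 i := in_L2_square_integrable i z0_L2.
rewrite norm_L2_sqr//; have [_ _ z00 _] := solz.
have E i : pairing mu `[0, L] (fun x => z0 x i 0) (fun x => z0 x i 0) =
    pairing mu `[0, L] (extended z i 0) (extended z i 0).
  apply: ae_eq_Rintegral.
  - by apply: measurable_funM; exact: (s0 i).1.
  - by apply: measurable_funM; exact: ((cz i).1 0).1.
  - refine (@filterS _ (almost_everywhere mu) (ae_filter_ringOfSetsType mu) _ _ _ z00).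
    by move=> x h xI; rewrite extendedE// h.
by rewrite /norm2 !E.
Qed.

(** The energy lies between [lo] and [hi] times the squared norm, so the squared norm decays at rate
    [nu] with constant [hi / lo]; the stated constants come from taking square roots. *)
Lemma solution_decay t : 0 <= t ->
  norm_L2 L (z t) <= Num.sqrt (hi / lo) * expR (- (nu / 2) * t) * norm_L2 L z0.
Proof.
move=> t0; rewrite -(@ler_pXn2r _ 2)//; last 2 first.
- by rewrite nnegrE sqrtr_ge0.
- by rewrite nnegrE !mulr_ge0 ?sqrtr_ge0// expR_ge0.
rewrite !exprMn (@sqr_sqrtr _ (hi / lo)); last by rewrite divr_ge0 ?ltW.
rewrite norm_extended// norm_initial -expRM_natl.
have -> : 2%:R * (- (nu / 2) * t) = - nu * t by field.
rewrite -(ler_pM2l lo0); apply: le_trans (energy_lo t) _.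
apply: le_trans (energy_exponential_decay t0) _.
rewrite (_ : lo * _ = expR (- nu * t) * (hi * norm2 0)); last first.
  by field; rewrite gt_eqF.
by rewrite ler_pM2l ?expR_gt0.
Qed.

End solution.

Lemma quadratic_stability :
  L2_exponentially_stable L A B (row2 c01 c02) (row2 cL1 cL2).
Proof.
exists (Num.sqrt (hi / lo)), (nu / 2); split.
- by rewrite sqrtr_gt0 divr_gt0.
- by rewrite divr_gt0.
- by move=> z0 z z0_L2 solz t t0; exact: solution_decay.
Qed.

End stability.

(** * Two by two matrices and characteristic velocities *)

Section matrices.
Context {R : realType}.

Lemma mx22M (a b c d a' b' c' d' : R) :
  mx22 a b c d *m mx22 a' b' c' d' =
  mx22 (a * a' + b * c') (a * b' + b * d') (c * a' + d * c') (c * b' + d * d').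
Proof.
apply/matrixP => i j; rewrite !mxE !big_ord_recl big_ord0 addr0 !mxE /=.
by case: i => -[|[|//]] ?; case: j => -[|[|//]] ?.
Qed.

Lemma mx22D (a b c d a' b' c' d' : R) :
  mx22 a b c d + mx22 a' b' c' d' = mx22 (a + a') (b + b') (c + c') (d + d').
Proof.
apply/matrixP => i j; rewrite !mxE.
by case: i => -[|[|//]] ?; case: j => -[|[|//]] ?.
Qed.

Lemma mx22N (a b c d : R) : - mx22 a b c d = mx22 (- a) (- b) (- c) (- d).
Proof.
apply/matrixP => i j; rewrite !mxE.
by case: i => -[|[|//]] ?; case: j => -[|[|//]] ?.
Qed.

(** A quadratic form sees only the symmetric part of its matrix, hence the mean of the off-diagonal
    entries. *)
Lemma mx22_positive_definite (s11 s12 s21 s22 v1 v2 : R) :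
  positive_definite (mx22 s11 s12 s21 s22) -> (v1 != 0) || (v2 != 0) ->
  0 < bform s11 ((s12 + s21) / 2) s22 v1 v2 v1 v2.
Proof.
move=> pd v0; have : col2 v1 v2 != 0.
  apply/negP => /eqP/matrixP E; move: v0.
  by have := E 0 0; have := E 1 0; rewrite !mxE /= => -> ->; rewrite eqxx.
move=> /pd; rewrite dotcvE !mx22_mul_col !mxE /=.
by congr (_ < _); rewrite /bform; field.
Qed.

Lemma is_derive_within_mx22 (D : set R) (x : R) (m00 m01 m10 m11 : R -> R)
    (d00 d01 d10 d11 : R) :
  is_derive_within D m00 x d00 -> is_derive_within D m01 x d01 ->
  is_derive_within D m10 x d10 -> is_derive_within D m11 x d11 ->
  is_derive_within D (fun y => mx22 (m00 y) (m01 y) (m10 y) (m11 y)) x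
    (mx22 d00 d01 d10 d11).
Proof.
move=> h00 h01 h10 h11; apply: (@is_derive_within_mx _ 1 1) => i j; rewrite mxE.
by case: ifPn => i0; case: ifPn => j0; [move: h00|move: h01|move: h10|move: h11];
  congr is_derive_within; apply/funext => y;
  rewrite mxE ?(negbTE i0) ?(negbTE j0) ?i0 ?j0.
Qed.

End matrices.

(** [lambda1] and [- lambda2] are the roots of [X^2 - b X - a], the characteristic polynomial of
    [A]; their product is [- a] and their sum is [b]. *)
Lemma lambda_properties (R : realType) (a b : R -> R) (x : R) :
  0 < b x ^+ 2 + 4 * a x ->
  a x = lambda1 a b x * lambda2 a b x /\ b x = lambda1 a b x - lambda2 a b x.
Proof.
move=> d0; rewrite /lambda1 /lambda2; have := sqr_sqrtr (ltW d0).
set s := Num.sqrt _ => s2; split; last by field.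
have -> : a x = (s ^+ 2 - b x ^+ 2) / 4 by rewrite s2; field.
by field.
Qed.

(** Division by zero yields [0], so a vanishing denominator would make the strict boundary
    inequalities true; the nonzero conditions restore the meaning of the fractions. *)
Theorem theorem2 (R : realType) (L : R) (hL : 0 < L)
  (f g alpha beta : R -> R -> R)
  (hf : C2_plane f) (hg : C1_plane g)
  (halpha : C1_plane alpha) (hbeta : C1_plane beta)
  (HLs Qs : R) (Hs : R -> R)
  (hHs_diff : forall x, x \in `[0, L] -> derivable_within `[0, L] Hs x)
  (hHs : forall x, x \in `[0, L] ->
     derive_within `[0, L] (fun y => f (Hs y) Qs) x + g (Hs x) Qs = 0)
  (hHsL : Hs L = HLs) :
  let a := fun x => partialH f (Hs x) Qs in
  let b := fun x => partialQ f (Hs x) Qs in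
  let ta := fun x => partialH g (Hs x) Qs in
  let tb := fun x => partialQ g (Hs x) Qs in
  let alpha_h := partialH alpha (Hs 0) Qs in
  let alpha_q := partialQ alpha (Hs 0) Qs in
  let beta_h := partialH beta HLs Qs in
  let beta_q := partialQ beta HLs Qs in
  let l1 := lambda1 a b in
  let l2 := lambda2 a b in
  let A := fun x => mx22 0 1 (a x) (b x) in
  let B := fun x => mx22 0 0
                      (derive_within `[0, L] a x + ta x)
                      (derive_within `[0, L] b x + tb x) in
  let N := fun x => mx22 (l2 x) 1 (- l1 x) 1 in
  (forall x, x \in `[0, L] ->
     [/\ 0 < b x ^+ 2 + 4 * a x, 0 < l1 x & 0 < l2 x]) ->
  (exists p1 p2 : R -> R,
     let P := fun x => (N x)^T *m mx22 (p1 x) 0 0 (p2 x) *m N x in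
     let M := fun x => P x *m A x in
     [/\ C1_within `[0, L] p1 /\ (forall x, x \in `[0, L] -> 0 < p1 x),
         C1_within `[0, L] p2 /\ (forall x, x \in `[0, L] -> 0 < p2 x),
         alpha_h + alpha_q * l1 0 != 0 /\
         ((alpha_h - alpha_q * l2 0) / (alpha_h + alpha_q * l1 0)) ^+ 2
           < p2 0 / p1 0 * (l2 0 / l1 0),
         beta_h - beta_q * l2 L != 0 /\
         ((beta_h + beta_q * l1 L) / (beta_h - beta_q * l2 L)) ^+ 2
           < p1 L / p2 L * (l1 L / l2 L) &
         forall x, x \in `[0, L] ->
           positive_definite
             (- derive_within `[0, L] M x + (B x)^T *m P x + P x *m B x)]) ->
  L2_exponentially_stable L A B
    (row2 alpha_h alpha_q) (row2 beta_h beta_q).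
Proof.
move=> a b ta tb alpha_h alpha_q beta_h beta_q l1 l2 A B N hyp [p1 [p2 hp]].
pose P x := (N x)^T *m mx22 (p1 x) 0 0 (p2 x) *m N x.
pose M x := P x *m A x.
have [[C1p1 p1_gt0] [C1p2 p2_gt0] [n0 r0] [nL rL] pd] : [/\
    C1_within `[0, L] p1 /\ (forall x, x \in `[0, L] -> 0 < p1 x),
    C1_within `[0, L] p2 /\ (forall x, x \in `[0, L] -> 0 < p2 x),
    alpha_h + alpha_q * l1 0 != 0 /\
      ((alpha_h - alpha_q * l2 0) / (alpha_h + alpha_q * l1 0)) ^+ 2
      < p2 0 / p1 0 * (l2 0 / l1 0),
    beta_h - beta_q * l2 L != 0 /\
      ((beta_h + beta_q * l1 L) / (beta_h - beta_q * l2 L)) ^+ 2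
      < p1 L / p2 L * (l1 L / l2 L) &
    forall x, x \in `[0, L] -> positive_definite
      (- derive_within `[0, L] M x + (B x)^T *m P x + P x *m B x)] := hp.
have L0' := ltW hL.
have I0 : 0 \in `[0, L] by rewrite in_itv/= lexx ltW.
have IL : L \in `[0, L] by rewrite in_itv/= lexx ltW.
have l12 x : x \in `[0, L] -> a x = l1 x * l2 x /\ b x = l1 x - l2 x.
  by move=> /hyp[d0 _ _]; exact: lambda_properties.
have a_neq0 x : x \in `[0, L] -> partialH f (Hs x) Qs != 0.
  move=> xI; have [_ l10 l20] := hyp x xI; have [ax _] := l12 x xI.
  by rewrite -/(a x) ax gt_eqF// mulr_gt0.
have [_ hfH hfQ] := hf; have [_ _ _ cgH cgQ] := hg.
have C1ab F hF := @steady_curve_is_C1 R L f g Qs Hs hL hf hg hHs_diff hHs a_neq0 F hF.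
have cts F cF := @steady_curve_continuous R L f g Qs Hs hL hf hHs_diff hHs a_neq0 F cF.
have is_C1a : is_C1 L a by exact: C1ab hfH.
have is_C1b : is_C1 L b by exact: C1ab hfQ.
have is_C1s : is_C1 L (fun x => Num.sqrt (b x ^+ 2 + 4 * a x)).
  apply: is_C1_sqrt; first by move=> x /hyp[].
  by apply: is_C1D; [exact: is_C1M|exact: is_C1M (is_C1_cst L 4) is_C1a].
have is_C1l1 : is_C1 L l1.
  by apply: is_C1M (is_C1_cst L 2^-1); exact: is_C1D.
have is_C1l2 : is_C1 L l2.
  apply: is_C1N; apply: is_C1M (is_C1_cst L 2^-1); apply: is_C1D => //.
  exact: is_C1N.
have is_C1p1 := C1_within_is_C1 C1p1; have is_C1p2 := C1_within_is_C1 C1p2.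
have [a' C1a] := is_C1a; have [b' C1b] := is_C1b.
pose e1 x := derive_within `[0, L] a x + ta x.
pose e2 x := derive_within `[0, L] b x + tb x.
(* [e1] and [e2] contain [derive_within], which is identified with the continuous derivative on
   [[0, L]] only; continuity within the interval does not see other points. *)
have ce (F F' G : R -> R) : C1_on L F F' -> {within `[0, L], continuous G} ->
    {within `[0, L], continuous (fun x => derive_within `[0, L] F x + G x)}.
  move=> [dF cF'] cG; apply: (@subspace_eq_continuous _ _ _ (fun x => F' x + G x)).
    by move=> x /set_mem xI /=; rewrite -(is_derive_withinE hL xI (dF x xI)).
  by move=> x; apply: cvgD; [exact: cF'|exact: cG].
have ce1 : {within `[0, L], continuous e1} by exact: ce C1a (cts _ cgH).
have ce2 : {within `[0, L], continuous e2} by exact: ce C1b (cts _ cgQ).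
pose p11 x := p1 x * (l2 x * l2 x) + p2 x * (l1 x * l1 x).
pose p12 x := p1 x * l2 x + - (p2 x * l1 x).
pose p22 x := p1 x + p2 x.
(* The rows of [N] are left eigenvectors of [A] for [l1] and [- l2], so
   [M = N^T diag(p1 l1, - p2 l2) N], which is symmetric. *)
pose m11 x := p1 x * l1 x * (l2 x * l2 x) + - (p2 x * l2 x * (l1 x * l1 x)).
pose m12 x := p1 x * l1 x * l2 x + p2 x * l2 x * l1 x.
pose m22 x := p1 x * l1 x + - (p2 x * l2 x).
have PE x : P x = mx22 (p11 x) (p12 x) (p12 x) (p22 x).
  rewrite /P /N mx22_tr !mx22M /p11 /p12 /p22; congr mx22; ring.
have ME x : x \in `[0, L] -> M x = mx22 (m11 x) (m12 x) (m12 x) (m22 x).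
  move=> xI; have [ax bx] := l12 x xI.
  rewrite /M PE /A mx22M ax bx /p11 /p12 /p22 /m11 /m12 /m22; congr mx22; ring.
have is_C1p11 : is_C1 L p11 by do ![assumption|apply: is_C1D|apply: is_C1M].
have is_C1p12 : is_C1 L p12 by do ![assumption|apply: is_C1D|apply: is_C1N|apply: is_C1M].
have is_C1p22 : is_C1 L p22 by exact: is_C1D.
have [m11' C1m11] : is_C1 L m11 by do ![assumption|apply: is_C1D|apply: is_C1N|apply: is_C1M].
have [m12' C1m12] : is_C1 L m12 by do ![assumption|apply: is_C1D|apply: is_C1N|apply: is_C1M].
have [m22' C1m22] : is_C1 L m22 by do ![assumption|apply: is_C1D|apply: is_C1N|apply: is_C1M].
have dM x : x \in `[0, L] ->
    derive_within `[0, L] M x = mx22 (m11' x) (m12' x) (m12' x) (m22' x).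
  move=> xI; apply: is_derive_withinE => //.
  have xI' : `[0, L]%classic x by [].
  apply: (is_derive_within_eq xI' (F := fun y => mx22 (m11 y) (m12 y) (m12 y) (m22 y))).
    by move=> y yI; rewrite ME.
  by apply: is_derive_within_mx22; [exact: C1m11.1|exact: C1m12.1|exact: C1m12.1|exact: C1m22.1].
have [cp11 cp12] := (is_C1_continuous is_C1p11, is_C1_continuous is_C1p12).
have cp22 := is_C1_continuous is_C1p22.
(* Entries of the symmetric matrix [- M_x + B^T P + P B]; as the first row of [B] is zero, only
   [p12] and [p22] multiply [e1] and [e2]. *)
pose s11 x := - m11' x + 2 * p12 x * e1 x.
pose s12 x := - m12' x + p12 x * e2 x + p22 x * e1 x.
pose s22 x := - m22' x + 2 * p22 x * e2 x.
have cs11 : {within `[0, L], continuous s11}.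
  move=> x; apply: cvgD; first by apply: cvgN; exact: C1m11.2.
  by apply: cvgM; [apply: cvgM; [exact: cvg_cst|exact: cp12]|exact: ce1].
have cs12 : {within `[0, L], continuous s12}.
  move=> x; apply: cvgD; last by apply: cvgM; [exact: cp22|exact: ce1].
  apply: cvgD; first by apply: cvgN; exact: C1m12.2.
  by apply: cvgM; [exact: cp12|exact: ce2].
have cs22 : {within `[0, L], continuous s22}.
  move=> x; apply: cvgD; first by apply: cvgN; exact: C1m22.2.
  by apply: cvgM; [apply: cvgM; [exact: cvg_cst|exact: cp22]|exact: ce2].
have S_pos x v1 v2 : x \in `[0, L] -> (v1 != 0) || (v2 != 0) ->
    0 < bform (s11 x) (s12 x) (s22 x) v1 v2 v1 v2.
  move=> xI v0; have := pd x xI.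
  have BE : B x = mx22 0 0 (e1 x) (e2 x) by [].
  rewrite (dM x xI) (PE x) BE mx22N mx22_tr !mx22M !mx22D.
  move=> /mx22_positive_definite/(_ v0); congr (_ < _).
  by rewrite /bform /s11 /s12 /s22; field.
have P_pos x v1 v2 : x \in `[0, L] -> (v1 != 0) || (v2 != 0) ->
    0 < bform (p11 x) (p12 x) (p22 x) v1 v2 v1 v2.
  move=> xI v0; have [_ l10 l20] := hyp x xI.
  have -> : bform (p11 x) (p12 x) (p22 x) v1 v2 v1 v2 =
    p1 x * (l2 x * v1 + v2) ^+ 2 + p2 x * (v2 - l1 x * v1) ^+ 2.
    by rewrite /bform /p11 /p12 /p22; ring.
  have h1 := p1_gt0 x xI; have h2 := p2_gt0 x xI.
  (* [N] is injective: when the second component of [N v] vanishes, the first one is [(l1 + l2) v1],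
     with [l1 + l2 > 0]. *)
  have [E|E] := eqVneq (v2 - l1 x * v1) 0; last first.
    apply: ltr_wpDl; first by rewrite mulr_ge0 ?sqr_ge0// ltW.
    by rewrite mulr_gt0// exprn_even_gt0.
  have v2E : v2 = l1 x * v1 by apply/eqP; rewrite -subr_eq0 E.
  rewrite E expr0n mulr0 addr0 mulr_gt0// exprn_even_gt0//= v2E -mulrDl.
  rewrite mulf_neq0//; first by rewrite gt_eqF// addr_gt0.
  by apply/eqP => v10; move: v0; rewrite v2E v10 mulr0 eqxx.
have [sc sc0 S_lo] := bform_coercive L0' cs11 cs12 cs22 S_pos.
have [lo lo0 P_lo] := bform_coercive L0' cp11 cp12 cp22 P_pos.
have [hi hi0 P_hi] := bform_bounded cp11 cp12 cp22.
(* The rate [sc / hi]: the form of the stability matrix is at least [sc |v|^2], and [|v|^2] is at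
   least the form of [P] divided by [hi]. *)
apply: (@quadratic_stability R L a a' b b' e1 e2 _ _ _ _ p11 p12 p22
  m11 m12 m22 m11' m12' m22' lo hi (sc / hi)) => //.
- move=> x xI; have [ax bx] := l12 x xI.
  by rewrite ax bx /m11 /m12 /m22 /p11 /p12 /p22; split; ring.
- by rewrite divr_gt0.
- move=> x v1 v2 xI; apply: le_trans (S_lo x v1 v2 xI).
  rewrite mulrAC ler_pdivrMr// -mulrA ler_pM2l// mulrC.
  exact: P_hi.
(* The form of [M] is [p1 l1 (l2 v1 + v2)^2 - p2 l2 (v2 - l1 v1)^2], so [boundary_left] gives its
   sign at [0], and [boundary_right] the opposite sign at [L]. *)
- move=> v1 v2 bc; have [_ l10 l20] := hyp 0 I0.
  have := boundary_left l10 l20 (p1_gt0 0 I0) (p2_gt0 0 I0) n0 r0 bc.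
  by rewrite -subr_le0; congr (_ <= _); rewrite /bform /m11 /m12 /m22; ring.
- move=> v1 v2 bc; have [_ l10 l20] := hyp L IL.
  have := boundary_right l10 l20 (p1_gt0 L IL) (p2_gt0 L IL) nL rL bc.
  by rewrite -subr_ge0; congr (_ <= _); rewrite /bform /m11 /m12 /m22; ring.
Qed.
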